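(* Let $\theta\in[0,2\pi)$ and let $g(\mathbf{x})=g_1([\mathbf{r}_{-\theta}\mathbf{x}]_1)\,g_2([\mathbf{r}_{-\theta}\mathbf{x}]_2)$ with $g_1,g_2\in L^2(\mathbb{R})$ real-valued. Let $\psi^{++}$ be a hypercomplexing wavelet and $\boldsymbol{\theta}_s=(\theta_{s,1},\theta_{s,2})\in\mathbb{R}^2$. Then for all $\boldsymbol{\xi}=(a,\theta,\mathbf{b})$, $a>0$, $\mathbf{b}\in\mathbb{R}^2$ (with the same $\theta$), $$\big|w^{(++)}_\psi(\boldsymbol{\xi};\Lambda^{2D}_{\boldsymbol{\theta}_s,\theta}g)\big|^2=\big|w^{(++)}_\psi(\boldsymbol{\xi};g)\big|^2.$$
   Context: $\mathbb{H}$: quaternions with units $\mathbf{i},\mathbf{j},\mathbf{k}$, $\mathbf{i}^2=\mathbf{j}^2=\mathbf{k}^2=\mathbf{i}\mathbf{j}\mathbf{k}=-1$, conjugation $q\mapsto q^*$, modulus $|q|$. $\mathbf{r}_\theta=\begin{pmatrix}\cos\theta&-\sin\theta\\ \sin\theta&\cos\theta\end{pmatrix}$, $R_\theta h(\mathbf{x})=h(\mathbf{r}_{-\theta}\mathbf{x})$. Partial Hilbert transforms $\mathcal{H}_l$, $l=1,2$: Fourier multipliers $-\mathbf{j}\,\mathrm{sgn}(f_l)$ for the Fourier transform $\int h(\mathbf{x})e^{-2\pi\mathbf{j}\mathbf{f}^T\mathbf{x}}d^2\mathbf{x}$. $\theta$-hypercomplex signal of real $h$: $h^{(++)}_\theta=R_\theta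 h+\mathbf{i}R_\theta\mathcal{H}_1h+\mathbf{j}R_\theta\mathcal{H}_2h+\mathbf{k}R_\theta\mathcal{H}_1\mathcal{H}_2h$. For real $g$, $\widetilde g_{-\theta}(\mathbf{x})=g(\mathbf{r}_\theta\mathbf{x})$, $\widetilde g^{(++)}_{-\theta,\theta}=(\widetilde g_{-\theta})^{(++)}_\theta$. Phase shift: for $g$ separable in the frame rotated by $\theta$ as in the claim, $\widetilde g^{(++)}_{-\theta,\theta}$ has a polar form $\widetilde g^{(++)}_{-\theta,\theta}(\mathbf{x})=|\widetilde g^{(++)}_{-\theta,\theta}(\mathbf{x})|e^{2\pi\mathbf{i}\alpha(\mathbf{x})}e^{2\pi\mathbf{j}\beta(\mathbf{x})}$ with real $\alpha,\beta$ (no $\mathbf{k}$-phase), and $\Lambda^{2D}_{\boldsymbol{\theta}_s,\theta}g(\mathbf{x})=|\widetilde g^{(++)}_{-\theta,\theta}(\mathbf{x})|\cos(2\pi\alpha(\mathbf{x})-\theta_{s,1})\cos(2\pi\beta(\mathbf{x})-\theta_{s,2})$. Hypercomplexing wavelet: $\psi^{++}=\psi^{(ee)}+\mathbf{i}\mathcal{H}_1\psi^{(ee)}+\mathbf{j}\mathcal{H}_2\psi^{(ee)}-\mathbf{k}\mathcal{H}_2\mathcal{H}_1\psi^{(ee)}$ with $\psi^{(ee)}\in L^2(\mathbb{R}^2)$ real, $\int|\psi^{(ee)}|^2=1$, $0<(2\pi)^2\int|\Psi^{(ee)}(\mathbf{f})|^2/|\mathbf{f}|^2d^2\mathbf{f}<\infty$,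 $\psi^{(ee)}(x_1,x_2)=\psi^{(ee)}(\pm x_1,\pm x_2)=\psi^{(ee)}(x_2,x_1)$. $\psi_{\boldsymbol{\xi}}(\mathbf{x})=\frac1a\psi(\mathbf{r}_{-\theta}(\mathbf{x}-\mathbf{b})/a)$ and $w^{(++)}_\psi(\boldsymbol{\xi};h)=\int_{\mathbb{R}^2}h(\mathbf{x})[\psi^{++}_{\boldsymbol{\xi}}(\mathbf{x})]^*d^2\mathbf{x}$. *)

(* Defs.v *)
From HB Require Import structures.
From mathcomp Require Import all_boot all_order all_algebra.
From mathcomp Require Import all_classical all_reals all_analysis.
From mathcomp Require Import ring.

Set Implicit Arguments.
Unset Strict Implicit.
Unset Printing Implicit Defensive.

Import Order.TTheory GRing.Theory Num.Theory.
Import numFieldNormedType.Exports.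

Local Open Scope classical_set_scope.
Local Open Scope ring_scope.

(* q_re + q_i i + q_j j + q_k k *)
Record quat (R : Type) := Quat { q_re : R; q_i : R; q_j : R; q_k : R }.

HB.instance Definition _ (R : Type) := gen_eqMixin (quat R).
HB.instance Definition _ (R : Type) := gen_choiceMixin (quat R).

Section quaternions.
Variable R : realType.
Implicit Types p q : quat R.

Definition qzero : quat R := Quat 0 0 0 0.
Definition qone : quat R := Quat 1 0 0 0.
Definition qopp p := Quat (- q_re p) (- q_i p) (- q_j p) (- q_k p).
Definition qadd p q :=
  Quat (q_re p + q_re q) (q_i p + q_i q) (q_j p + q_j q) (q_k p + q_k q).
Definition qmul p q := Quat
  (q_re p * q_re q - q_i p * q_i q - q_j p * q_j q - q_k p * q_k q)
  (q_re p * q_i q + q_i p * q_re q + q_j p * q_k q - q_k p * q_j q)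
  (q_re p * q_j q - q_i p * q_k q + q_j p * q_re q + q_k p * q_i q)
  (q_re p * q_k q + q_i p * q_j q - q_j p * q_i q + q_k p * q_re q).

Let qaddA : associative qadd.
Proof. by move=> [? ? ? ?] [? ? ? ?] [? ? ? ?]; congr Quat; rewrite /= addrA. Qed.
Let qaddC : commutative qadd.
Proof. by move=> [? ? ? ?] [? ? ? ?]; congr Quat; rewrite /= addrC. Qed.
Let qadd0 : left_id qzero qadd.
Proof. by move=> [? ? ? ?]; congr Quat; rewrite /= add0r. Qed.
Let qaddN : left_inverse qzero qopp qadd.
Proof. by move=> [? ? ? ?]; congr Quat; rewrite /= addNr. Qed.

HB.instance Definition _ := GRing.isZmodule.Build (quat R)
  qaddA qaddC qadd0 qaddN.

Let qmulA : associative qmul.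
Proof. by move=> [? ? ? ?] [? ? ? ?] [? ? ? ?]; congr Quat => /=; ring. Qed.
Let qmul1l : left_id qone qmul.
Proof. by move=> [? ? ? ?]; congr Quat => /=; ring. Qed.
Let qmul1r : right_id qone qmul.
Proof. by move=> [? ? ? ?]; congr Quat => /=; ring. Qed.
Let qmulDl : left_distributive qmul qadd.
Proof. by move=> [? ? ? ?] [? ? ? ?] [? ? ? ?]; congr Quat => /=; ring. Qed.
Let qmulDr : right_distributive qmul qadd.
Proof. by move=> [? ? ? ?] [? ? ? ?] [? ? ? ?]; congr Quat => /=; ring. Qed.
Let qone_neq0 : qone != 0.
Proof. by apply/eqP => -[] /eqP; rewrite oner_eq0. Qed.

HB.instance Definition _ := GRing.Zmodule_isNzRing.Build (quat R)
  qmulA qmul1l qmul1r qmulDl qmulDr qone_neq0.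

Definition qreal (x : R) : quat R := Quat x 0 0 0.
Definition qi : quat R := Quat 0 1 0 0.
Definition qj : quat R := Quat 0 0 1 0.
Definition qk : quat R := Quat 0 0 0 1.

Lemma qunitsE : [/\ qi * qi = -1, qj * qj = -1, qk * qk = -1
  & qi * qj * qk = -1].
Proof. by split; congr Quat => /=; ring. Qed.

Definition qconj q := Quat (q_re q) (- q_i q) (- q_j q) (- q_k q).
Definition qnorm q :=
  Num.sqrt (q_re q ^+ 2 + q_i q ^+ 2 + q_j q ^+ 2 + q_k q ^+ 2).

Definition qexpi (t : R) : quat R := qreal (cos t) + qi * qreal (sin t).
Definition qexpj (t : R) : quat R := qreal (cos t) + qj * qreal (sin t).

End quaternions.

Notation leb2 R := (@lebesgue_measure R \x @lebesgue_measure R)%E.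

Section L2_and_Fourier.
Variable R : realType.
Local Notation R2 := (R * R)%type.

Local Notation mu2 := (leb2 R).

Definition qintegral (F : R2 -> quat R) : quat R := Quat
  (\int[mu2]_x q_re (F x)) (\int[mu2]_x q_i (F x))
  (\int[mu2]_x q_j (F x)) (\int[mu2]_x q_k (F x)).

Definition qL2 (F : R2 -> quat R) : Prop :=
  [/\ (fun x => q_re (F x)) \in Lfun mu2 2%:E,
      (fun x => q_i (F x)) \in Lfun mu2 2%:E,
      (fun x => q_j (F x)) \in Lfun mu2 2%:E &
      (fun x => q_k (F x)) \in Lfun mu2 2%:E].

(* Meaningful for integrable h. *)
Definition fourierL1 (h : R2 -> R) (f : R2) : quat R :=
  qintegral (fun x =>
    qreal (h x) * qexpj (- (2 * pi * (f.1 * x.1 + f.2 * x.2)))).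

(* H represents the L^2 extension by continuity, from the dense subspace
   of the functions that are both in L^1 and in L^2, of the Fourier transform at h. *)
Definition is_fourier (h : R2 -> R) (H : R2 -> quat R) : Prop :=
  [/\ h \in Lfun mu2 2%:E, qL2 H &
    exists h_ : nat -> R2 -> R,
      [/\ forall n, h_ n \in Lfun mu2 1 /\ h_ n \in Lfun mu2 2%:E,
          'N[mu2]_2%:E[EFin \o (h_ n \- h)%R]%E
            @[n --> \oo] --> 0%E &
          'N[mu2]_2%:E[EFin \o @qnorm R \o (fourierL1 (h_ n) \- H)%R]%E
            @[n --> \oo] --> 0%E]].

(* A chosen representative of the (a.e. unique) L^2 Fourier transform; the
   default value 0 is only used when h is not in L^2. *)
Definition fourier (h : R2 -> R) : R2 -> quat R :=
  xget (fun=> 0) [set H | is_fourier h H].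

(* A chosen representative of the real L^2 function whose Fourier transform is
   - j sgn(f_l) times that of h, for the coordinate map c = f |-> f_l. *)
Definition hilbert (c : R2 -> R) (h : R2 -> R) : R2 -> R :=
  xget (fun=> 0) [set v : R2 -> R | v \in Lfun mu2 2%:E /\
    {ae mu2, forall f : R2,
       fourier v f = - qj R * qreal (Num.sg (c f)) * fourier h f}].

Definition hilbert1 := hilbert (fun f => f.1).
Definition hilbert2 := hilbert (fun f => f.2).

End L2_and_Fourier.

Section phase_shift.
Variable R : realType.
Local Notation R2 := (R * R)%type.

Definition rotv (t : R) (x : R2) : R2 :=
  (cos t * x.1 - sin t * x.2, sin t * x.1 + cos t * x.2).

Definition rotf (t : R) (h : R2 -> R) : R2 -> R := fun x => h (rotv (- t) x).

Definition hypercomplex_signal (t : R) (h : R2 -> R) (x : R2) : quat R :=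
  qreal (rotf t h x)
  + qi R * qreal (rotf t (hilbert1 h) x)
  + qj R * qreal (rotf t (hilbert2 h) x)
  + qk R * qreal (rotf t (hilbert1 (hilbert2 h)) x).

(* (alpha, beta) with q = |q| e^(2 pi i alpha) e^(2 pi j beta); any two such
   pairs give the same value of phase_shift. The default (0, 0) is used for
   those q that have no such form, i.e., that have a k-phase. *)
Definition polar_phases (q : quat R) : R * R :=
  xget (0, 0) [set ab : R * R |
    q = qreal (qnorm q) * qexpi (2 * pi * ab.1) * qexpj (2 * pi * ab.2)].

Definition phase_shift (ts : R * R) (t : R) (g : R2 -> R) (x : R2) : R :=
  let q := hypercomplex_signal t (fun y => g (rotv t y)) x in
  let ab := polar_phases q in
  qnorm q * cos (2 * pi * ab.1 - ts.1) * cos (2 * pi * ab.2 - ts.2).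

End phase_shift.

Section wavelets.
Variable R : realType.
Local Notation R2 := (R * R)%type.

Definition wavelet_seed (psi : R2 -> R) : Prop :=
  [/\ psi \in Lfun (leb2 R) 2%:E,
      (\int[leb2 R]_x ((psi x) ^+ 2)%:E = 1)%E,
      (0 < ((2 * pi) ^+ 2)%:E * \int[leb2 R]_f
          (qnorm (fourier psi f) ^+ 2 / (f.1 ^+ 2 + f.2 ^+ 2))%:E < +oo)%E &
      {ae leb2 R, forall x : R2,
        [/\ psi x = psi (- x.1, x.2), psi x = psi (x.1, - x.2),
            psi x = psi (- x.1, - x.2) & psi x = psi (x.2, x.1)]}].

Definition hypercomplexify (psi : R2 -> R) (x : R2) : quat R :=
  qreal (psi x) + qi R * qreal (hilbert1 psi x)
  + qj R * qreal (hilbert2 psi x)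
  - qk R * qreal (hilbert2 (hilbert1 psi) x).

Definition hypercomplexing_wavelet (Psi : R2 -> quat R) : Prop :=
  exists2 psi : R2 -> R, wavelet_seed psi & Psi = hypercomplexify psi.

Definition atom (Psi : R2 -> quat R) (a t : R) (b : R2) (x : R2) : quat R :=
  qreal a^-1 * Psi (rotv (- t) ((x.1 - b.1) / a, (x.2 - b.2) / a)).

Definition wavelet_transform (Psi : R2 -> quat R) (a t : R) (b : R2)
    (h : R2 -> R) : quat R :=
  qintegral (fun x => qreal (h x) * qconj (atom Psi a t b x)).

End wavelets.

(* Main.v *)
Require Import Defs.
From HB Require Import structures.
From mathcomp Require Import all_boot all_order all_algebra.
From mathcomp Require Import all_classical all_reals all_analysis.
From mathcomp Require Import measurable_realfun ring lra.

Set Implicit Arguments.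
Unset Strict Implicit.
Unset Printing Implicit Defensive.

Import Order.TTheory GRing.Theory Num.Theory.
Import numFieldNormedType.Exports.

Local Open Scope classical_set_scope.
Local Open Scope ring_scope.

(* In the frame rotated by theta, g becomes the tensor product G of g1 and g2,
   so that H1 G and H2 G act on one factor each and G * H1 (H2 G) = H1 G * H2 G
   almost everywhere.  This is exactly the condition under which the quaternion
   with these four components has a polar form without k-phase, and expanding
   the two cosines turns the phase shift of g into the linear combination of
   G, H1 G, H2 G and H1 (H2 G) with the coefficients c1 c2, s1 c2, c1 s2, s1 s2,
   where c and s are the cosines and sines of the two angles.
   After the change of variables to that frame, Parseval's identity expresses
   all pairings of these four functions with the components of the wavelet by
   four numbers z1, .., z4: a Hilbert transform on either side contributes a sign
   of a frequency, and the dilation commutes with these signs.  For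
   the combination with coefficients k0, .., k3 the squared modulus of the
   wavelet transform is a^2 times
     (k0^2 + k1^2 + k2^2 + k3^2) (z1^2 + z2^2 + z3^2 + z4^2)
       + 4 (k1 k2 - k0 k3) (z1 z4 + z2 z3),
   which takes the same value at (c1 c2, s1 c2, c1 s2, s1 s2) and at (1, 0, 0, 0).
   Plancherel's identity follows from the weights exp (- c (|f1| + |f2|)), whose
   Fourier transforms are Poisson kernels, and the Hilbert transforms exist
   because the odd multipliers that act on L^2 contain sin (2 pi t f_l) (by
   translations), and are closed under bounded pointwise limits and under
   s |-> (3 s - s^3) / 2, whose iterates tend to the sign. *)

(** The sum of the squares of the coefficients does not control the modulus by itself: the cross
    term must vanish too. It does because the coefficients are the products of the entries of (c1,
    s1) with those of (c2, s2), so that k0 k3 = k1 k2, and the squares then sum to (c1^2 +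
    s1^2)(c2^2 + s2^2) = 1. The values of [fourier], [hilbert] and [polar_phases] are chosen, with
    defaults. Hence existence has to be proved before any of their properties, and every identity
    holds only up to null sets, for whichever representative was chosen. A Hilbert transform is a
    preimage under the Fourier transform. It is not obtained by inverting that transform but built
    from translates of the function, in a complete family. The family is abstract because the
    construction is used twice: on all of L^2, for existence, and on tensor products with one factor
    left free, where it shows that H1 (a b) is w b with a [w] that does not depend on b. This
    uniformity is what identifies H1 (H2 G) with the product of the two transformed factors. *)

Definition small (R : realType) (u : nat -> \bar R) :=
  forall e : R, 0 < e -> \forall n \near \oo, (u n < e%:E)%E.

Section small.
Variable R : realType.
Implicit Types u v : nat -> \bar R.

Lemma small_le u v : (forall n, (u n <= v n)%E) -> small v -> small u.
Proof.
move=> uv sv e e0; apply: filterS (sv e e0) => n; exact: le_lt_trans.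
Qed.

Lemma smallD u v : small u -> small v -> small (fun n => u n + v n)%E.
Proof.
move=> su sv e e0; have e2 : 0 < e / 2 by rewrite divr_gt0.
apply: filterS2 (su _ e2) (sv _ e2) => n un vn.
by rewrite (splitr e) EFinD lteD.
Qed.

Lemma smallZ (c : R) u : (0 <= c) -> small u -> small (fun n => c%:E * u n)%E.
Proof.
move=> c0 su e e0; have e2 : 0 < e / (c + 1).
  by rewrite divr_gt0// ltr_wpDl.
apply: filterS (su _ e2) => n un.
have [->|cn0] := eqVneq c 0; first by rewrite mul0e lte_fin.
have cp : 0 < c by rewrite lt_def cn0.
apply: (@lt_trans _ _ (c%:E * (e / (c + 1))%:E)%E).
  by rewrite lte_pmul2l ?lte_fin.
rewrite -EFinM lte_fin mulrCA gtr_pMr// ltr_pdivrMr ?mul1r ?ltrDl//.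
by rewrite ltr_wpDl.
Qed.

Lemma small_le_cst u (x : \bar R) : small u -> (forall n, (x <= u n)%E) -> (x <= 0)%E.
Proof.
move=> su xu; apply/lee_addgt0Pr => e e0; rewrite add0e.
near \oo => n; rewrite (le_trans (xu n))// ltW//.
by near: n; exact: su.
Unshelve. all: by end_near. Qed.

(** [small] bounds from above only, so that comparisons need no finiteness of the terms; for
    nonnegative terms it is convergence to 0. *)
Lemma small_cvg u : (forall n, 0 <= u n)%E -> small u <-> u @ \oo --> 0%E.
Proof.
move=> u0; split.
  move=> su; apply/fine_cvgP; split.
    apply: filterS (su 1 ltr01) => n un.
    by rewrite ge0_fin_numE// (lt_trans un)// ltry.
  apply/cvgr0Pnorm_lt => e e0; apply: filterS (su e e0) => n un.
  have fn : u n \is a fin_num by rewrite ge0_fin_numE// (lt_trans un)// ltry.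
  by rewrite /= ger0_norm ?fine_ge0// -lte_fin fineK.
move=> /fine_cvgP[fu /cvgr0Pnorm_lt uc] e e0.
apply: filterS2 fu (uc e e0) => n fn; rewrite /= ger0_norm ?fine_ge0//.
by rewrite -lte_fin fineK.
Qed.

End small.

(** * The space L^2 *)

Section L2n.
Context d (T : measurableType d) (R : realType) (mu : {measure set T -> \bar R}).
Implicit Types f g h : T -> R.

(** The square of the L^2 norm. Avoiding the root keeps it additive over components; the triangle
    inequality is replaced by the bound with factors 2 that follows from (f - g)^2 >= 0. *)
Definition L2n f : \bar R := \int[mu]_x ((f x) ^+ 2)%:E.

Arguments L2n f%_R.

Definition isL2 f := measurable_fun setT f /\ (L2n f < +oo)%E.

Lemma L2n_ge0 f : (0 <= L2n f)%E.
Proof. by apply: integral_ge0 => x _; rewrite lee_fin sqr_ge0. Qed.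

Lemma Lnorm2E f : (('N[mu]_2%:E[EFin \o f]) `^ 2 = L2n f)%E.
Proof.
rewrite powR_Lnorm//; apply: eq_integral => x _ /=.
by rewrite powR_mulrn// real_normK ?num_real.
Qed.

Lemma LfunP2 f : f \in Lfun mu 2%:E <-> isL2 f.
Proof.
split.
  move=> /andP[]; rewrite !inE/= => mf; rewrite /finite_norm => nf.
  by split=> //; rewrite -Lnorm2E; apply: poweR_lty.
move=> [mf lf]; apply/andP; rewrite !inE/=; split=> //.
by rewrite /finite_norm (@lty_poweRy _ _ 2)// Lnorm2E.
Qed.

Lemma small_Lnorm (f_ : nat -> T -> R) :
  small (fun n => L2n (f_ n)) <-> 'N[mu]_2%:E[EFin \o f_ n]%E @[n --> \oo] --> 0%E.
Proof.
rewrite -small_cvg; last by move=> n; exact: Lnorm_ge0.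
split=> sf e e0.
  have e2 : 0 < e ^+ 2 by rewrite exprn_gt0.
  apply: filterS (sf _ e2) => n; rewrite -Lnorm2E.
  case: ('N[mu]_2%:E[_])%E (Lnorm_ge0 mu 2%:E (EFin \o f_ n)) => [r||]//.
  - by rewrite /= !lte_fin lee_fin => r0; rewrite powR_mulrn// ltr_pXn2r ?nnegrE// ltW.
  - by rewrite poweRyr.
have e2 : 0 < Num.sqrt e by rewrite sqrtr_gt0.
apply: filterS (sf _ e2) => n; rewrite -Lnorm2E.
case: ('N[mu]_2%:E[_])%E (Lnorm_ge0 mu 2%:E (EFin \o f_ n)) => [r||]//=.
rewrite !lte_fin lee_fin => r0; rewrite powR_mulrn// => re.
by rewrite -(sqr_sqrtr (ltW e0)) ltr_pXn2r ?nnegrE// ltW.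
Qed.

Lemma measurable_sqr f : measurable_fun setT f ->
  measurable_fun setT (EFin \o (fun x => (f x) ^+ 2)).
Proof. by move=> mf; apply/measurable_EFinP; exact: measurable_funX. Qed.

Lemma eq_L2n f g : f =1 g -> L2n f = L2n g.
Proof. by move=> fg; congr L2n; exact/funext. Qed.

Lemma L2nN f : L2n (\- f) = L2n f.
Proof. by apply: eq_integral => x _ /=; rewrite sqrrN. Qed.

Lemma L2nZ (c : R) f : measurable_fun setT f ->
  L2n (fun x => c * f x) = ((c ^+ 2)%:E * L2n f)%E.
Proof.
move=> mf; rewrite /L2n -ge0_integralZl_EFin//.
- by apply: eq_integral => x _; rewrite exprMn EFinM.
- by move=> x _; rewrite lee_fin sqr_ge0.
- exact: measurable_sqr.
- exact: sqr_ge0.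
Qed.

Lemma L2n_leD f g : measurable_fun setT f -> measurable_fun setT g ->
  (L2n (f \+ g) <= 2%:E * L2n f + 2%:E * L2n g)%E.
Proof.
move=> mf mg; rewrite /L2n -!ge0_integralZl_EFin//; last first.
- exact: measurable_sqr.
- by move=> x _; rewrite lee_fin sqr_ge0.
- exact: measurable_sqr.
- by move=> x _; rewrite lee_fin sqr_ge0.
rewrite -ge0_integralD//; last first.
- apply: measurable_funeM; exact: measurable_sqr.
- by move=> x _; rewrite mule_ge0// lee_fin sqr_ge0.
- apply: measurable_funeM; exact: measurable_sqr.
- by move=> x _; rewrite mule_ge0// lee_fin sqr_ge0.
apply: ge0_le_integral => //.
- by move=> x _; rewrite lee_fin sqr_ge0.
- apply: measurable_sqr; exact: measurable_funD.
- apply: emeasurable_funD; apply: measurable_funeM; exact: measurable_sqr.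
- move=> x _; rewrite -!EFinM -EFinD lee_fin /=.
  by have := sqr_ge0 (f x - g x); nra.
Qed.

Lemma L2n_leB f g : measurable_fun setT f -> measurable_fun setT g ->
  (L2n (f \- g) <= 2%:E * L2n f + 2%:E * L2n g)%E.
Proof.
by move=> mf mg; rewrite -(L2nN g); apply: L2n_leD => //; exact: measurableT_comp.
Qed.

Lemma isL2D f g : isL2 f -> isL2 g -> isL2 (f \+ g).
Proof.
move=> [mf lf] [mg lg]; split; first exact: measurable_funD.
by rewrite (le_lt_trans (L2n_leD mf mg))// lte_add_pinfty// lte_mul_pinfty.
Qed.

Lemma isL2Z (c : R) f : isL2 f -> isL2 (fun x => c * f x).
Proof.
move=> [mf lf]; split; first exact: measurable_funM.
by rewrite L2nZ// lte_mul_pinfty ?lee_fin ?sqr_ge0.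
Qed.

Lemma isL2N f : isL2 f -> isL2 (\- f).
Proof. by move=> [mf lf]; split; [exact: measurableT_comp|rewrite L2nN]. Qed.

Lemma isL2B f g : isL2 f -> isL2 g -> isL2 (f \- g).
Proof. by move=> lf lg; apply: isL2D => //; exact: isL2N. Qed.

Lemma isL20 : isL2 (fun=> 0).
Proof. by split => //; rewrite /L2n expr0n integral0. Qed.

Lemma isL2_fin f : isL2 f -> L2n f \is a fin_num.
Proof. by move=> [_ lf]; rewrite ge0_fin_numE ?L2n_ge0. Qed.

Lemma ae_eq_L2n f g : measurable_fun setT f -> measurable_fun setT g ->
  {ae mu, forall x, f x = g x} -> L2n f = L2n g.
Proof.
move=> mf mg fg; apply: ae_eq_integral => //; try exact: measurable_sqr.
by apply: filterS fg => x /= -> .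
Qed.

Lemma L2n_eq0 f : measurable_fun setT f -> L2n f = 0%E ->
  {ae mu, forall x, f x = 0}.
Proof.
move=> mf f0; have := (@ae_eq_integral_abs _ _ _ mu setT measurableT
   (fun x => ((f x) ^+ 2)%:E) (measurable_sqr mf)).1.
rewrite (_ : (\int[mu]_x _ = 0)%E); last first.
  rewrite -f0; apply: eq_integral => x _ /=.
  by rewrite ger0_norm ?sqr_ge0.
move=> /(_ erefl); apply: filterS => x /= /(_ I)[] /eqP.
by rewrite sqrf_eq0 => /eqP.
Qed.

Lemma isL2_le f g : measurable_fun setT f -> (forall x, `|f x| <= `|g x|) ->
  isL2 g -> isL2 f.
Proof.
move=> mf fg [mg lg]; split=> //; apply: le_lt_trans lg.
apply: ge0_le_integral => //.
- by move=> x _; rewrite lee_fin sqr_ge0.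
- exact: measurable_sqr.
- exact: measurable_sqr.
- move=> x _; rewrite lee_fin -(@real_normK _ (f x)) ?num_real//.
  by rewrite -(@real_normK _ (g x)) ?num_real// ler_sqr ?nnegrE.
Qed.

Lemma L2n_le f g : measurable_fun setT f -> measurable_fun setT g ->
  (forall x, `|f x| <= `|g x|) -> (L2n f <= L2n g)%E.
Proof.
move=> mf mg fg; apply: ge0_le_integral => //.
- by move=> x _; rewrite lee_fin sqr_ge0.
- exact: measurable_sqr.
- exact: measurable_sqr.
- move=> x _; rewrite lee_fin -(@real_normK _ (f x)) ?num_real//.
  by rewrite -(@real_normK _ (g x)) ?num_real// ler_sqr ?nnegrE.
Qed.

Lemma isL2_integrableM f g : isL2 f -> isL2 g ->
  mu.-integrable setT (EFin \o (fun x => f x * g x)).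
Proof.
move=> /LfunP2 lf /LfunP2 lg; apply/Lfun1_integrable.
exact: Lfun2_mul_Lfun1.
Qed.

Lemma isL2_integrable_sqr f : isL2 f ->
  mu.-integrable setT (EFin \o (fun x => f x ^+ 2)).
Proof.  by move=> /LfunP2/Lfun2_integrable_sqr. Qed.

Lemma RintegralM_polar f g : isL2 f -> isL2 g ->
  4 * \int[mu]_x (f x * g x) = fine (L2n (f \+ g)) - fine (L2n (f \- g)).
Proof.
move=> lf lg; have fg := isL2_integrableM lf lg.
have := isL2_integrable_sqr (isL2D lf lg).
have := isL2_integrable_sqr (isL2B lf lg).
move=> iB iD; rewrite -[fine (L2n (f \+ g))]/(\int[mu]_x (f x + g x) ^+ 2).
rewrite -[fine (L2n (f \- g))]/(\int[mu]_x (f x - g x) ^+ 2).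
rewrite -RintegralB// -RintegralZl//; apply: eq_Rintegral => x _.
ring.
Qed.

Lemma limn_einf_le (u : nat -> \bar R) (c : \bar R) :
  (\forall n \near \oo, (u n <= c)%E) -> (limn_einf u <= c)%E.
Proof.
move=> uc; rewrite limn_einf_lim; apply: lime_le; first exact: is_cvg_einfs.
apply: nearW => n; near \oo => m.
apply: (@le_trans _ _ (u m)); last by near: m.
apply: ereal_inf_lbound; exists m => //=.
by near: m; exists n.
Unshelve. all: by end_near. Qed.

Lemma L2n_fatou (f_ : nat -> T -> R) f (c : \bar R) :
  (forall n, measurable_fun setT (f_ n)) -> measurable_fun setT f ->
  {ae mu, forall x, f_ n x @[n --> \oo] --> f x} ->
  (\forall n \near \oo, (L2n (f_ n) <= c)%E) -> (L2n f <= c)%E.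
Proof.
move=> mf_ mf ff fc.
have m2 n : measurable_fun setT (EFin \o (fun x => (f_ n x) ^+ 2)).
  exact: measurable_sqr.
apply: le_trans (limn_einf_le fc).
apply: le_trans (fatou mu measurableT m2 _); last first.
  by move=> n x _; rewrite lee_fin sqr_ge0.
rewrite le_eqVlt; apply/orP; left; apply/eqP.
apply: ae_eq_integral => //; first exact: measurable_sqr.
  rewrite /limn_einf; apply: measurableT_comp => //.
  apply: (@measurable_fun_limn_esup _ _ _ _ (fun n x => - (f_ n x ^+ 2)%:E)%E) => n.
  exact: (measurableT_comp (@oppe_measurable R setT) (m2 n)).
apply: filterS ff => x fx _.
have /cvg_limn_einf_sup[e _] : (EFin \o (fun n => f_ n x ^+ 2)) @ \oo --> (f x ^+ 2)%:E.
  by apply: cvg_EFin; [exact: nearW|rewrite expr2; exact: cvgM].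
by rewrite -e.
Qed.

(* A subsequence with rapidly decreasing increments converges almost everywhere,
   and Fatou's lemma identifies its pointwise limit as the limit in L^2. *)
Lemma L2_complete (f_ : nat -> T -> R) : (forall n, isL2 (f_ n)) ->
  (forall e : R, 0 < e -> exists N, forall m n, (N <= m)%N -> (N <= n)%N ->
     (L2n (f_ m \- f_ n) < e%:E)%E) ->
  exists2 f, isL2 f & small (fun n => L2n (f_ n \- f)).
Proof.
move=> lf cf.
have [N HN] : {N : nat -> nat & forall k m n, (N k <= m)%N -> (N k <= n)%N ->
     (L2n (f_ m \- f_ n) < (8^-1 ^+ k)%:E)%E}.
  apply: (@choice _ _ (fun k N => forall m n, (N <= m)%N -> (N <= n)%N ->
     (L2n (f_ m \- f_ n) < (8^-1 ^+ k)%:E)%E)) => k.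
  by apply: cf; rewrite exprn_gt0.
(* Summing the thresholds gives indices beyond all earlier [N k], without any monotonicity of
   [N]. *)
pose phi k := (\sum_(i < k.+1) N i)%N.
have phiN k j : (k <= j)%N -> (N k <= phi j)%N.
  move=> kj; rewrite /phi (bigD1 (Ordinal (kj : (k < j.+1)%N)))//=.
  exact: leq_addr.
have mf n : measurable_fun setT (f_ n) by case: (lf n).
pose a k x := f_ (phi k.+1) x - f_ (phi k) x.
have ma k : measurable_fun setT (a k) by apply: measurable_funB.
(* The squared norm of [a k] is at most 8^-k. The weight 4^k leaves the summable 2^-k, and where
   [g x] is finite it gives |a k x| <= sqrt (g x) 2^-k, so that the telescoping series converges. *)
pose g x := (\sum_(k <oo) (4 ^+ k * a k x ^+ 2)%:E)%E.
have mterm k : measurable_fun setT (EFin \o (fun x => 4 ^+ k * a k x ^+ 2)).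
  apply/measurable_EFinP; apply: measurable_funM => //.
  exact: (measurable_funX 2 (ma k)).
have term0 k x : (0 <= (4 ^+ k * a k x ^+ 2)%:E)%E.
  by rewrite lee_fin mulr_ge0 ?sqr_ge0 ?exprn_ge0.
have intg : (\int[mu]_x g x <= 2%:E)%E.
  rewrite /g integral_nneseries//.
  apply: (@le_trans _ _ (\sum_(k <oo) (2 / (2 ^ (k + 1))%:R)%:E)%E).
    apply: lee_nneseries => [k _ _|k _]; first exact: integral_ge0.
    rewrite (_ : (\int[mu]_x _ = (4 ^+ k)%:E * L2n (a k))%E); last first.
      rewrite -ge0_integralZl_EFin//; last exact: measurable_sqr.
      by move=> x _; rewrite lee_fin sqr_ge0.
    apply: (@le_trans _ _ ((4 ^+ k)%:E * (8^-1 ^+ k)%:E)%E).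
      rewrite lee_pmul2l ?lte_fin ?exprn_gt0//.
      by apply/ltW/HN; apply: phiN.
    rewrite -EFinM lee_fin -exprMn (_ : 4 * 8^-1 = 2^-1); last by field.
    rewrite addn1 natrX exprS invfM mulrA divff// mul1r exprVn //.
  have /cvg_lim := @cvg_geometric_eseries_half R 2 0; rewrite expr0 divr1.
  by move=> ->.
have mg : measurable_fun setT g.
  apply: (@ge0_emeasurable_sum _ _ _ setT
    (fun k x => (4 ^+ k * a k x ^+ 2)%:E) xpredT).
    by move=> *; exact: term0.
  by move=> *; exact: mterm.
have g0 x : (0 <= g x)%E by apply: nneseries_ge0.
have ig : mu.-integrable setT g.
  apply/integrableP; split => //.
  under eq_integral do rewrite gee0_abs//.
  by rewrite (le_lt_trans intg)// ltry.
have cvx : {ae mu, forall x, cvgn (fun k => f_ (phi k) x)}.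
  apply: filterS (integrable_ae measurableT ig) => x /= /(_ I) fg.
  pose M := fine (g x).
  have aM k : `|a k x| <= Num.sqrt M * 2^-1 ^+ k.
    have : ((4 ^+ k * a k x ^+ 2)%:E <= g x)%E.
      rewrite /g (nneseriesD1 (n := k))//.
      rewrite leeDl//; apply: nneseries_ge0 => *; exact: term0.
    rewrite -(fineK fg) lee_fin => aM.
    rewrite -(@ler_pXn2r _ 2) ?nnegrE ?mulr_ge0 ?sqrtr_ge0 ?exprn_ge0//.
    rewrite exprMn sqr_sqrtr ?fine_ge0// real_normK ?num_real// -exprM mulnC exprM.
    rewrite (_ : 2^-1 ^+ 2 = 4^-1); last by field.
    by rewrite exprVn ler_pdivlMr ?exprn_gt0// mulrC.
  have cs : cvgn (series (a^~ x)).
    apply: normed_cvg; apply: (@series_le_cvg _ _ (geometric (Num.sqrt M) 2^-1)).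
    - by move=> n; exact: normr_ge0.
    - by move=> n; rewrite /= mulr_ge0 ?sqrtr_ge0 ?exprn_ge0 ?invr_ge0.
    - exact: aM.
    apply: is_cvg_geometric_series; rewrite ger0_norm ?invr_ge0// invf_lt1// ltr1n//.
  have -> : (fun k => f_ (phi k) x) = (fun k => f_ (phi 0%N) x + series (a^~ x) k).
    apply/funext => k; rewrite /series/= /a.
    by rewrite (telescope_sumr (fun k => f_ (phi k) x))// addrC subrK.
  by apply: is_cvgD => //; exact: is_cvg_cst.
(* The upper limit is measurable without exception and equals the limit wherever the subsequence
   converges. *)
pose f x := fine (limn_esup (fun k => (f_ (phi k) x)%:E)).
have mff : measurable_fun setT f.
  apply: measurableT_comp => //; apply: measurable_fun_limn_esup => k.
  exact/measurable_EFinP.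
have ff : {ae mu, forall x, f_ (phi k) x @[k --> \oo] --> f x}.
  apply: filterS cvx => x /cvg_ex[l fl].
  have /cvg_limn_einf_sup[_ e] : (EFin \o (fun k => f_ (phi k) x)) @ \oo --> l%:E.
    by apply: cvg_EFin => //; exact: nearW.
  by rewrite /f (_ : limn_esup _ = l%:E).
have lfn j n : (N j <= n)%N -> (L2n (f_ n \- f) <= (8^-1 ^+ j)%:E)%E.
  move=> jn; apply: (@L2n_fatou (fun k => f_ n \- f_ (phi k))).
  - by move=> k; apply: measurable_funB.
  - exact: measurable_funB.
  - by apply: filterS ff => x fx /=; apply: cvgB => //; exact: cvg_cst.
  - exists j => // k /= jk; apply/ltW/HN => //; exact: phiN.
exists f.
  have := lfn 0%N (N 0%N) (leqnn _); set n := N 0%N => l0.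
  have -> : f = (f_ n \- (f_ n \- f)) by apply/funext => x /=; rewrite opprB addrC subrK.
  apply: isL2B => //; split; first exact: measurable_funB.
  by rewrite (le_lt_trans l0)// ltry.
move=> e e0.
have h8 : `|8^-1 : R| < 1 by rewrite ger0_norm// invf_lt1// ltr1n.
have /cvgr0Pnorm_lt h := @cvg_geometric R 1 _ h8.
have [j _ /(_ j (leqnn j)) je] := h e e0.
exists (N j) => // n /= jn; apply: (le_lt_trans (lfn j n jn)).
rewrite lte_fin; move: je => /=; rewrite mul1r ger0_norm// exprn_ge0//.
Qed.

End L2n.
Arguments L2n {d T R} mu f%_R.
Arguments isL2 {d T R} mu f%_R.

(** * Linear changes of variables *)

(** For an affine [phi], [c] is the absolute value of the determinant. Only nonnegative functions
    are required to obey the formula; null sets, integrable functions and L^2 norms are treated by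
    consequence. *)
Definition has_jacobian d (T : measurableType d) (R : realType)
    (mu : {measure set T -> \bar R}) (c : R) (phi : T -> T) :=
  measurable_fun setT phi /\
  forall F : T -> \bar R, measurable_fun setT F -> (forall x, 0 <= F x)%E ->
    (c%:E * \int[mu]_x F (phi x) = \int[mu]_x F x)%E.

Section has_jacobian.
Context d (T : measurableType d) (R : realType).
Variable mu : {measure set T -> \bar R}.
Variables (c : R) (phi : T -> T).
Hypotheses (c0 : 0 < c) (J : has_jacobian mu c phi).

Let mphi : measurable_fun setT phi := J.1.

(** Preimages of null sets are null: the formula for an indicator function, divided by the nonzero
    [c]. *)
Lemma jacobian_ae (P : T -> Prop) :
  {ae mu, forall x, P x} -> {ae mu, forall x, P (phi x)}.
Proof.
move=> [N [mN N0 PN]].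
have mpN : measurable (phi @^-1` N).
  by rewrite -[X in measurable X]setTI; exact: mphi.
exists (phi @^-1` N); split => //; last by move=> x Px; exact: PN.
have mI : measurable_fun setT (EFin \o \1_N : T -> \bar R).
  by apply/measurable_EFinP; exact: measurable_indic.
have I0 x : (0 <= (EFin \o \1_N : T -> \bar R) x)%E by rewrite lee_fin.
have /eqP := J.2 _ mI I0.
rewrite /= (_ : (\int[mu]_x (\1_N (phi x))%:E = mu (phi @^-1` N))%E); last first.
  rewrite (_ : (fun x => _) = (fun x => (\1_(phi @^-1` N) x)%:E))//.
  by rewrite integral_indic// setIT.
rewrite integral_indic// setIT [mu N]N0 mule_eq0 eqe gt_eqF//= => /eqP//.
Qed.

Lemma jacobian_integrable (F : T -> \bar R) : mu.-integrable setT F ->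
  mu.-integrable setT (F \o phi) /\
  (c%:E * \int[mu]_x F (phi x) = \int[mu]_x F x)%E.
Proof.
move=> iF; have mF := measurable_int _ iF.
have iFphi : mu.-integrable setT (F \o phi).
  apply/integrableP; split; first exact: measurableT_comp.
  have := J.2 _ (measurableT_comp (@abse_measurable R setT) mF) (fun x => abse_ge0 _).
  move: iF => /integrableP[_] /[swap] /= <-.
  have : (0 <= \int[mu]_x `|F (phi x)|)%E by exact: integral_ge0.
  case: (\int[mu]_x `|F (phi x)|)%E => [r||]// _; rewrite ?ltry//.
  by rewrite gt0_muley ?lte_fin.
split => //.
rewrite [in RHS]integralE [in LHS]integralE.
rewrite muleBr//; last exact: integrable_add_def.
rewrite -(J.2 _ (measurable_funepos mF))// -(J.2 _ (measurable_funeneg mF))//.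
by congr (_ * _ - _ * _)%E; apply: eq_integral => x _; rewrite ?(funeposE, funenegE).
Qed.

Lemma jacobian_Rintegral (F : T -> R) : mu.-integrable setT (EFin \o F) ->
  c * \int[mu]_x F (phi x) = \int[mu]_x F x.
Proof.
move=> iF; have [iFphi e] := jacobian_integrable iF.
rewrite /Rintegral -[in RHS]e fineM//.
exact: (integrable_fin_num _ iFphi).
Qed.

Lemma jacobian_L2n (h : T -> R) : measurable_fun setT h ->
  (c%:E * L2n mu (h \o phi) = L2n mu h)%E.
Proof.
move=> mh; apply: (J.2 _ (measurable_sqr mh)) => x; by rewrite /= lee_fin sqr_ge0.
Qed.

Lemma jacobian_isL2 (h : T -> R) : isL2 mu h -> isL2 mu (h \o phi).
Proof.
move=> [mh lh]; split; first exact: measurableT_comp.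
move: lh; rewrite -jacobian_L2n//; have := L2n_ge0 mu (h \o phi).
by case: (L2n _ _) => [r||]//; rewrite ?ltry// gt0_muley ?lte_fin.
Qed.


End has_jacobian.

(** * Affine maps of the line *)

Section line.
Variable R : realType.
Local Notation mu := (@lebesgue_measure R).

(** The right-hand side is a measure in [A] with the values of the Lebesgue measure on half-open
    intervals, so uniqueness applies. *)
Lemma lebesgue_measure_affine (a b : R) (A : set R) : 0 < a -> measurable A ->
  mu A = (a%:E * mu ((fun x => a * x + b)%R @^-1` A))%E.
Proof.
move=> a0 mA.
have mphi : measurable_fun setT (fun x : measurableTypeR R => a * x + b : measurableTypeR R).
  by apply: measurable_funD => //; exact: measurable_funM.
have aN : 0 <= a := ltW a0.
rewrite -[RHS]/(pushforward (mscale (NngNum aN) mu)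
  (fun x : measurableTypeR R => a * x + b : measurableTypeR R) A).
apply: lebesgue_measure_unique => //.
move=> _ [[s t] _ <-]/=.
rewrite /mscale/= /pushforward.
rewrite (_ : _ @^-1` _ = `](s - b) / a, (t - b) / a]%classic); last first.
  apply/seteqP; split=> x /=; rewrite !in_itv/= ltr_pdivrMr// ler_pdivlMr//;
    by rewrite ltrBlDr lerBrDr mulrC.
rewrite !lebesgue_measure_itv/= !lte_fin ltr_pM2r ?invr_gt0// ltrD2r.
case: ifP => _; last by rewrite mule0.
by rewrite -!EFinB -EFinM; congr EFin; field; rewrite gt_eqF.
Qed.

Lemma line_jacobian (a b : R) : 0 < a -> has_jacobian mu a (fun x => a * x + b).
Proof.
move=> a0; have mphi : measurable_fun setT (fun x : R => a * x + b).
  by apply: measurable_funD => //; exact: measurable_funM.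
split => // F mF F0; have aN : 0 <= a := ltW a0.
rewrite -[a%:E]/((NngNum aN)%:num%:E) -ge0_integral_mscale//; last first.
  exact: (measurableT_comp mF mphi).
rewrite -(@ge0_integral_pushforward _ _ (measurableTypeR R) (measurableTypeR R)
  R _ mphi (mscale (NngNum aN) mu) setT F)//.
apply: eq_measure_integral => A mA _.
by rewrite [RHS](lebesgue_measure_affine b a0).
Qed.

End line.

Lemma has_jacobian_comp d (T : measurableType d) (R : realType)
    (mu : {measure set T -> \bar R}) (c c' : R) (phi phi' : T -> T) :
  has_jacobian mu c phi -> has_jacobian mu c' phi' ->
  has_jacobian mu (c' * c) (phi \o phi').
Proof.
move=> [mp Hp] [mp' Hp']; split; first exact: measurableT_comp.
move=> F mF F0; rewrite mulrC EFinM -muleA.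
by rewrite (Hp' (F \o phi))//= ?Hp//; exact: measurableT_comp.
Qed.

(** * Dilations, shears and rotations of the plane *)

Section plane.
Variable R : realType.
Local Notation lambda := (@lebesgue_measure R).
Local Notation mu2 := (leb2 R).

Lemma measurable_pair (d : measure_display) (T : measurableType d) (f g : T -> R) :
  measurable_fun setT f -> measurable_fun setT g ->
  measurable_fun setT (fun x => (f x, g x)).
Proof. by move=> mf mg; exact: measurable_fun_pair. Qed.

Lemma plane_jacobian (a b1 b2 : R) : 0 < a ->
  has_jacobian mu2 (a ^+ 2) (fun x : R * R => (a * x.1 + b1, a * x.2 + b2)).
Proof.
move=> a0; set phi := fun x : R * R => _.
have mphi : measurable_fun setT phi.
  by apply: measurable_pair; apply: measurable_funD => //; apply: measurable_funM.
split => // F mF F0.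
have mG : measurable_fun setT (F \o phi) by exact: measurableT_comp.
rewrite [X in (_ * X)%E](fubini_tonelli1 (m1 := lambda) (m2 := lambda))//.
rewrite [RHS](fubini_tonelli1 (m1 := lambda) (m2 := lambda))//.
rewrite -[RHS](line_jacobian b1 a0).2; last 2 first.
- exact: measurable_fun_fubini_tonelli_F mF F0.
- by move=> x; exact: integral_ge0.
rewrite expr2 EFinM -muleA; congr (_ * _)%E.
rewrite -ge0_integralZl_EFin//; last 3 first.
- by move=> x _; exact: integral_ge0.
- exact: (@measurable_fun_fubini_tonelli_F _ _ _ _ R lambda (F \o phi) mG (fun x => F0 (phi x))) .
- exact: ltW.
apply: eq_integral => x _; apply: ((line_jacobian b2 a0).2 (fun y => F (a * x + b1, y))) => //.
exact: measurableT_comp.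
Qed.

(** A shear translates each line parallel to an axis, so Tonelli's theorem reduces it to the
    translation invariance of the line. *)
Lemma shear1_jacobian (t : R) :
  has_jacobian mu2 1 (fun x : R * R => (x.1 + t * x.2, x.2)).
Proof.
have ms : measurable_fun setT (fun x : R * R => (x.1 + t * x.2, x.2)).
  apply: measurable_pair => //; apply: measurable_funD => //; exact: measurable_funM.
split=> // F mF F0; rewrite mul1e.
rewrite fubini_tonelli2//; last exact: measurableT_comp.
rewrite fubini_tonelli2//; apply: eq_integral => y _.
have := (line_jacobian (t * y) ltr01).2 (fun x => F (x, y)) (measurableT_comp mF (measurable_pair2 y)) (fun x => F0 (x, y)).
rewrite mul1e => e; rewrite [RHS]/(\int[lambda]_x F (x, y))%E -[RHS]e.
by rewrite /fubini_G; apply: eq_integral => x _ /=; rewrite mul1r.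
Qed.

Lemma shear2_jacobian (t : R) :
  has_jacobian mu2 1 (fun x : R * R => (x.1, t * x.1 + x.2)).
Proof.
have ms : measurable_fun setT (fun x : R * R => (x.1, t * x.1 + x.2)).
  apply: measurable_pair => //; apply: measurable_funD => //; exact: measurable_funM.
split=> // F mF F0; rewrite mul1e.
rewrite fubini_tonelli1//; last exact: measurableT_comp.
rewrite fubini_tonelli1//; apply: eq_integral => x _.
have := (line_jacobian (t * x) ltr01).2 (fun y => F (x, y)) (measurableT_comp mF (measurable_pair1 x)) (fun y => F0 (x, y)).
rewrite mul1e => e; rewrite [RHS]/(\int[lambda]_y F (x, y))%E -[RHS]e.
by rewrite /fubini_F; apply: eq_integral => y _ /=; rewrite mul1r addrC.
Qed.

(* A rotation is a product of three shears, unless it is the half turn, which is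
   the square of a quarter turn. *)
Lemma rot_jacobian (t : R) : has_jacobian mu2 1 (rotv t).
Proof.
have main (s : R) : cos s != -1 -> has_jacobian mu2 1 (rotv s).
  move=> cs.
  have c0 : 1 + cos s != 0 by apply: contra_neq cs => /eqP; rewrite addrC addr_eq0 => /eqP.
  (* This is tan (s / 2), the slope of the two outer shears. *)
  pose u := sin s / (1 + cos s).
  have := has_jacobian_comp (shear1_jacobian (- u))
    (has_jacobian_comp (shear2_jacobian (sin s)) (shear1_jacobian (- u))).
  rewrite !mulr1; congr has_jacobian.
  apply/funext => -[x y]; rewrite /rotv /=.
  have h : sin s * u = 1 - cos s.
    rewrite /u mulrA -expr2 sin2cos2; apply: (mulIf c0); rewrite mulfVK//.
    by ring.
  have h2 : u * (1 + cos s) = sin s by rewrite /u mulfVK.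
  congr pair; last first.
    have -> : sin s * (x + - u * y) + y = sin s * x + (1 - sin s * u) * y by ring.
    by rewrite h; ring.
  have -> : x + - u * y + - u * (sin s * (x + - u * y) + y) = (1 - sin s * u) * x
     + (u * (sin s * u) - 2 * u) * y by ring.
  by rewrite h -[in RHS]h2; ring.
have [ct|] := eqVneq (cos t) (-1); last exact: main.
have t2 : t = t / 2 + t / 2 by rewrite -splitr.
have ch : cos (t / 2) != -1.
  apply/eqP => ch; move: ct; rewrite t2 cosD -!expr2 sin2cos2 ch; lra.
have := has_jacobian_comp (main _ ch) (main _ ch).
rewrite mulr1; congr has_jacobian; apply/funext => x.
rewrite /rotv /= [in RHS]t2 cosD sinD; congr pair; ring.
Qed.

End plane.

(** * The Plancherel identity on the intersection of L^1 and L^2 *)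

Section param.
Context d1 d2 (T1 : measurableType d1) (T2 : measurableType d2) (R : realType).
Variables (m1 : {sigma_finite_measure set T1 -> \bar R}).
Variables (m2 : {sigma_finite_measure set T2 -> \bar R}).

Lemma measurable_Rint_param (f : T1 * T2 -> R) : measurable_fun setT f ->
  measurable_fun setT (fun x => \int[m2]_y f (x, y)).
Proof.
move=> mf; have mF : measurable_fun setT (EFin \o f) by apply/measurable_EFinP.
apply: measurableT_comp => //.
rewrite (_ : (fun x => _) = (fubini_F m2 (EFin \o f)^\+ \- fubini_F m2 (EFin \o f)^\-)%E).
  apply: emeasurable_funB; apply: measurable_fun_fubini_tonelli_F => //.
    exact: measurable_funepos.
  exact: measurable_funeneg.
apply/funext => x; rewrite /fubini_F/= [LHS]integralE; congr (_ - _)%E;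
  by apply: eq_integral => y _; rewrite ?(funeposE, funenegE).
Qed.

Lemma integrable_boundedM d (T : measurableType d) (m : {measure set T -> \bar R})
    (h k : T -> R) (M : R) : m.-integrable setT (EFin \o h) ->
  measurable_fun setT k -> (forall x, `|k x| <= M) ->
  m.-integrable setT (EFin \o (fun x => h x * k x)).
Proof.
move=> ih mk kM; have mh : measurable_fun setT h.
  by apply/measurable_EFinP; exact: measurable_int ih.
apply: (@le_integrable _ _ _ m setT measurableT _ (fun x => M%:E * (h x)%:E)%E).
- by apply/measurable_EFinP; exact: measurable_funM.
- move=> x _; rewrite -EFinM !abse_EFin lee_fin !normrM mulrC ler_wpM2r//.
  by rewrite (le_trans (kM x))// ler_norm.
- exact: integrableZl.
Qed.

Lemma Rint_boundedM_le d (T : measurableType d) (m : {measure set T -> \bar R})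
    (h k : T -> R) (M : R) : m.-integrable setT (EFin \o h) ->
  measurable_fun setT k -> (forall x, `|k x| <= M) ->
  `|\int[m]_x (h x * k x)| <= M * \int[m]_x `|h x|.
Proof.
move=> ih mk kM; have ihk := integrable_boundedM ih mk kM.
apply: (le_trans (le_normr_Rintegral _ ihk)) => //.
rewrite -RintegralZl//; last exact: integrable_norm.
apply: le_Rintegral => //.
- exact: (integrable_norm ihk).
- by apply: (@integrableZl _ _ _ m setT measurableT M (EFin \o (fun x => `|h x|))); exact: integrable_norm.
- by move=> x _; rewrite normrM mulrC ler_wpM2r.
Qed.

Lemma integrable_tensor (E : T1 -> R) (h : T2 -> R) :
  m1.-integrable setT (EFin \o E) -> m2.-integrable setT (EFin \o h) ->
  (m1 \x m2)%E.-integrable setT (EFin \o (fun z => E z.1 * h z.2)).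
Proof.
move=> iE ih; have mE : measurable_fun setT E.
  by apply/measurable_EFinP; exact: measurable_int iE.
have mh : measurable_fun setT h.
  by apply/measurable_EFinP; exact: measurable_int ih.
apply/integrable12ltyP.
  by apply/measurable_EFinP; apply: measurable_funM; exact: measurableT_comp.
have -> : (\int[m1]_x \int[m2]_y `|((E x * h y)%R)%:E| =
   \int[m1]_x (`|(E x)%:E| * \int[m2]_y `|(h y)%:E|))%E.
  apply: eq_integral => x _; rewrite -ge0_integralZl//.
  - by apply: eq_integral => y _; rewrite /= normrM.
  - by apply: measurableT_comp => //; exact/measurable_EFinP.
rewrite ge0_integralZr//; last 2 first.
- by apply: measurableT_comp => //; exact/measurable_EFinP.
- exact: integral_ge0.
move/integrableP: iE => [_ iE]; move/integrableP: ih => [_ ih].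
apply: lte_mul_pinfty => //; first exact: integral_ge0.
by rewrite ge0_fin_numE//; exact: integral_ge0.
Qed.

(** A bounded kernel keeps the tensor product of two integrable functions integrable, which is all
    that Fubini's theorem asks for. *)
Lemma Rintegral_swap (E : T1 -> R) (h : T2 -> R) (k : T1 * T2 -> R) (M : R) :
  m1.-integrable setT (EFin \o E) -> m2.-integrable setT (EFin \o h) ->
  measurable_fun setT k -> (forall z, `|k z| <= M) ->
  \int[m1]_x (E x * \int[m2]_y (h y * k (x, y))) =
  \int[m2]_y (h y * \int[m1]_x (E x * k (x, y))).
Proof.
move=> iE ih mk kM; have iEh := integrable_tensor iE ih.
have iEhk := integrable_boundedM iEh mk kM.
have := Fubini iEhk; rewrite /Rintegral => /(congr1 fine) e.
have m1k y : measurable_fun setT (fun x => k (x, y)) by exact: measurableT_comp.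
have m2k x : measurable_fun setT (fun y => k (x, y)) by exact: measurableT_comp.
transitivity (fine (\int[m1]_x (\int[m2]_y (E x * h y * k (x, y))%:E)))%E.
  congr fine; apply: eq_integral => x _.
  have i := integrable_boundedM ih (m2k x) (fun y => kM (x, y)).
  rewrite EFinM fineK; last exact: (integrable_fin_num _ i).
  by rewrite -integralZl//; apply: eq_integral => y _; rewrite /= -EFinM mulrA.
rewrite [LHS]e; congr fine; apply: eq_integral => y _.
have i := integrable_boundedM iE (m1k y) (fun x => kM (x, y)).
rewrite EFinM fineK; last exact: (integrable_fin_num _ i).
by rewrite -integralZl//; apply: eq_integral => x _; rewrite /= -EFinM mulrA (mulrC (h y)).
Qed.

End param.

(** * The Fourier transform of the weight exp (- c |x|) *)

Section poisson.
Variable R : realType.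
Local Notation mu := (@lebesgue_measure R).
Implicit Types b c x : R.

Lemma lineN_jacobian : has_jacobian mu 1 (fun x : R => - x).
Proof.
have mphi : measurable_fun setT (-%R : measurableTypeR R -> measurableTypeR R) by [].
split=> [|F mF F0]; [exact: mphi|rewrite mul1e].
rewrite -(@ge0_integral_pushforward _ _ (measurableTypeR R) (measurableTypeR R)
  R _ mphi mu setT F)//.
by apply: eq_measure_integral => A mA _; exact: lebesgue_measureN.
Qed.

Lemma is_derive_expRM c x :
  is_derive x 1 (fun x : R => expR (- (c * x))) (- c * expR (- (c * x))).
Proof.
have h : is_derive x 1 (fun x : R => - (c * x)) (- c).
  by apply: is_derive_eq; rewrite /GRing.scale/= mulr1.
have := @is_derive1_comp _ expR (fun x : R => - (c * x)) x _ _ _ h.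
move=> /(_ _ (is_derive_expR _)) h'; apply: is_derive_eq.
by rewrite mulrC.
Qed.

Lemma is_derive_sinM b x :
  is_derive x 1 (fun x : R => sin (b * x)) (b * cos (b * x)).
Proof.
have h : is_derive x 1 (fun x : R => b * x) b.
  by apply: is_derive_eq; rewrite /GRing.scale/= mulr1.
have := @is_derive1_comp _ sin (fun x : R => b * x) x _ _ _ h.
move=> /(_ _ (is_derive_sin _)) h'; apply: is_derive_eq.
by rewrite mulrC.
Qed.

Lemma is_derive_cosM b x :
  is_derive x 1 (fun x : R => cos (b * x)) (- b * sin (b * x)).
Proof.
have h : is_derive x 1 (fun x : R => b * x) b.
  by apply: is_derive_eq; rewrite /GRing.scale/= mulr1.
have := @is_derive1_comp _ cos (fun x : R => b * x) x _ _ _ h.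
move=> /(_ _ (is_derive_cos _)) h'; apply: is_derive_eq.
by rewrite mulrC mulNr mulrN.
Qed.

Definition laplace_wt c x : R := expR (- (c * `|x|)).

Lemma laplace_wt_ge0 c x : 0 <= laplace_wt c x.
Proof. exact: expR_ge0. Qed.

Lemma continuous_laplace_wt c : continuous (laplace_wt c).
Proof.
move=> x; apply: (@continuous_comp _ _ _ (fun x : R => - (c * `|x|)) expR).
  by apply: cvgN; apply: cvgMl_tmp; exact: norm_continuous.
exact: continuous_expR.
Qed.

Lemma continuous_cosM b : continuous (fun x : R => cos (b * x)).
Proof.
move=> x; apply: (@continuous_comp _ _ _ (fun x : R => b * x) cos).
  by apply: cvgMl_tmp.
exact: continuous_cos.
Qed.

(* The term [1] makes the integrand nonnegative. *)
Lemma half_poisson c b : 0 < c ->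
  (\int[mu]_(x in `[0%R, +oo[) (expR (- (c * x)) * (1 + cos (b * x)))%:E =
   (c / (b ^+ 2 + c ^+ 2) + c^-1)%:E)%E.
Proof.
move=> c0; pose D := b ^+ 2 + c ^+ 2.
have D0 : D != 0 by rewrite gt_eqF// ltr_wpDl ?sqr_ge0 ?exprn_gt0.
(* The antiderivative that vanishes at infinity; its value at 0 is - (c / D + 1 / c). *)
pose F x := expR (- (c * x)) * (b / D * sin (b * x) + (- c / D) * cos (b * x) - c^-1).
have dF x : is_derive x 1 F (expR (- (c * x)) * (1 + cos (b * x))).
  have h1 := is_derive_expRM c x.
  have h2 := is_derive_sinM b x.
  have h3 := is_derive_cosM b x.
  apply: is_derive_eq; rewrite /GRing.scale/= /D.
  by field; rewrite [_ == 0]gt_eqF//=.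
have Fy : F x @[x --> +oo] --> (0 : R).
  pose M := `|b / D| + `|- c / D| + `|c^-1|.
  have eM : expR (- (c * x)) * M @[x --> +oo] --> (0 : R).
    rewrite -(mul0r M); apply: cvgMr_tmp.
    apply: (cvg_comp (fun x => c * x) (fun x => expR (- x))); last exact: cvgr_expR.
    by apply: gt0_cvgMry => //; exact: cvg_id.
  apply/norm_cvg0P; apply: (squeeze_cvgr _ (cvg_cst 0) eM).
  apply: nearW => x; rewrite normr_ge0/= /F normrM ger0_norm ?expR_ge0//.
  rewrite ler_wpM2l ?expR_ge0// (le_trans (ler_normB _ _))// lerD2r.
  rewrite (le_trans (ler_normD _ _))// !normrM lerD// ler_piMr//.
    by rewrite ler_norml sin_geN1 sin_le1.
  by rewrite ler_norml cos_geN1 cos_le1.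
have cf : continuous (fun x => expR (- (c * x)) * (1 + cos (b * x))).
  move=> x; apply: cvgM; last first.
    by apply: cvgD; [exact: cvg_cst|exact: continuous_cosM].
  apply: (@continuous_comp _ _ _ (fun x : R => - (c * x)) expR).
    by apply: cvgN; apply: cvgMl_tmp.
  exact: continuous_expR.
rewrite (ge0_continuous_FTC2y _ _ Fy).
- rewrite -EFinB /F !(mulr0, oppr0) expR0 sin0 cos0; congr EFin.
  by rewrite /D; field; rewrite [_ == 0]gt_eqF//=.
- move=> x _; rewrite mulr_ge0 ?expR_ge0// -lerBlDl sub0r cos_geN1//.
- exact: continuous_subspaceT.
- by move=> x _; apply: ex_derive.
- apply: cvg_at_right_filter; apply: differentiable_continuous.
  by apply/derivable1_diffP; exact: ex_derive.
- by move=> x _; rewrite derive1E; exact: derive_val.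
Qed.

Lemma measurable_laplace_wt c : measurable_fun setT (laplace_wt c).
Proof. by apply: continuous_measurable_fun; exact: continuous_laplace_wt. Qed.

Lemma measurable_cosM b : measurable_fun setT (fun x : R => cos (b * x)).
Proof. by apply: continuous_measurable_fun; exact: continuous_cosM. Qed.

Lemma poisson1 c b : 0 < c ->
  (\int[mu]_x (laplace_wt c x * (1 + cos (b * x)))%:E =
   (2 * (c / (b ^+ 2 + c ^+ 2) + c^-1))%:E)%E.
Proof.
move=> c0; rewrite ge0_symfun_integralT.
- rewrite EFinM -half_poisson// -set_itvcy; congr (_ * _)%E.
  apply: eq_integral => x; rewrite inE/= in_itv/= andbT => x0.
  by rewrite /laplace_wt ger0_norm.
- move=> x; rewrite mulr_ge0 ?expR_ge0// -lerBlDl sub0r cos_geN1//.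
- move=> x; apply: cvgM; first exact: continuous_laplace_wt.
  by apply: cvgD; [exact: cvg_cst|exact: continuous_cosM].
- by move=> x /=; rewrite /laplace_wt normrN mulrN cosN.
Qed.

Lemma laplace_wt_integrable c : 0 < c -> mu.-integrable setT (EFin \o laplace_wt c).
Proof.
move=> c0; have ml := measurable_laplace_wt c.
have i2 : mu.-integrable setT (EFin \o (fun x => laplace_wt c x * (1 + cos (0 * x)))).
  apply/integrableP; split.
    apply/measurable_EFinP; apply: measurable_funM => //.
    by apply: measurable_funD => //; exact: measurable_cosM.
  under eq_integral => x _.
    rewrite /= ger0_norm; last first.
      by rewrite mulr_ge0 ?expR_ge0// -lerBlDl sub0r cos_geN1.
    over.
  by rewrite poisson1// ltry.
apply: le_integrable i2 => //; first exact/measurable_EFinP.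
move=> x _; rewrite /= lee_fin mul0r cos0 normrM ler_peMr// ger0_norm//.
by rewrite lerDl.
Qed.

Lemma bounded_cos x : `|cos x| <= 1.
Proof. by rewrite ler_norml cos_geN1 cos_le1. Qed.

Lemma bounded_sin x : `|sin x| <= 1.
Proof. by rewrite ler_norml sin_geN1 sin_le1. Qed.

(** The case b = 0 of the integral with 1 + cos gives the total mass 2 / c of the weight, and
    subtracting it removes the auxiliary 1. *)
Lemma laplace_cos c b : 0 < c ->
  \int[mu]_x (laplace_wt c x * cos (b * x)) = 2 * c / (b ^+ 2 + c ^+ 2).
Proof.
move=> c0; have il := laplace_wt_integrable c0.
have il' := il.
have ic b' := integrable_boundedM il (measurable_cosM b') (fun x => bounded_cos _).
have h b' : \int[mu]_x laplace_wt c x + \int[mu]_x (laplace_wt c x * cos (b' * x)) =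
    2 * (c / (b' ^+ 2 + c ^+ 2) + c^-1).
  rewrite -RintegralD//; under eq_Rintegral do rewrite -[X in X + _]mulr1 -mulrDr.
  by rewrite /Rintegral poisson1.
have l1 : \int[mu]_x laplace_wt c x = 2 / c.
  have := h 0; under [X in _ + X]eq_Rintegral do rewrite mul0r cos0 mulr1.
  have -> : 2 * (c / (0 ^+ 2 + c ^+ 2) + c^-1) = 4 / c by field; rewrite gt_eqF.
  move=> e; apply: (@mulIf _ 2) => //; rewrite mulr_natr mulr2n e; field; rewrite gt_eqF//.
have := h b; rewrite l1 mulrDr => /eqP; rewrite addrC -subr_eq0 => /eqP e.
by apply/eqP; rewrite -subr_eq0 -mulrA -e; apply/eqP; ring.
Qed.

Lemma laplace_sin c b : 0 < c ->
  \int[mu]_x (laplace_wt c x * sin (b * x)) = 0.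
Proof.
move=> c0; have il := laplace_wt_integrable c0.
have ms : measurable_fun setT (fun x : R => sin (b * x)).
  apply: (measurableT_comp (f := sin)); last exact: measurable_funM.
  by apply: continuous_measurable_fun => x; exact: continuous_sin.
have isn := integrable_boundedM il ms (fun x => bounded_sin _).
have := jacobian_Rintegral ltr01 lineN_jacobian isn.
rewrite mul1r => e; have : \int[mu]_x (laplace_wt c x * sin (b * x)) =
   - \int[mu]_x (laplace_wt c x * sin (b * x)).
  rewrite -[LHS]e -[in RHS]mulN1r -RintegralZl//; apply: eq_Rintegral => x _.
  by rewrite /laplace_wt normrN mulrN sinN; ring.
lra.
Qed.

End poisson.

Lemma leb2_sigma_finite (R : realType) :
  sigma_finite [set: measurableTypeR R * measurableTypeR R] (leb2 R).
Proof.
have /sigma_finiteP[F [TF ndF Foo]] := sigma_finiteT (@lebesgue_measure R).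
exists (fun n => F n `*` F n).
  rewrite -setXTT TF predeqE => -[x y]; split.
    move=> [/= [n _ Fnx] [k _ Gky]]; exists (maxn n k) => //; split.
    - by move: x Fnx; exact/subsetPset/ndF/leq_maxl.
    - by move: y Gky; exact/subsetPset/ndF/leq_maxr.
  by move=> [n _ []/= ? ?]; split; exists n.
move=> k; have [? ?] := Foo k; split; first exact: measurableX.
by rewrite product_measure1E// lte_mul_pinfty// ge0_fin_numE.
Qed.

(* The sigma-finiteness of product measures is not found by unification. *)
Definition leb2s (R : realType) :
    {sigma_finite_measure set (measurableTypeR R * measurableTypeR R)%type -> \bar R} :=
  HB.pack (leb2 R) (@Measure_isSigmaFinite.Build _ _ _ (leb2 R) (leb2_sigma_finite R)).

(** * Cosine and sine transforms and their weighted energy *)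

Section fourier_kernel.
Variable R : realType.
Local Notation lambda := (@lebesgue_measure R).
Local Notation mu2 := (leb2 R).
Local Notation R2 := (R * R)%type.
Implicit Types (h : R2 -> R) (f x y u : R2) (c : R).

Lemma Rintegral_tensor d1 d2 (T1 : measurableType d1) (T2 : measurableType d2)
    (m1 : {sigma_finite_measure set T1 -> \bar R})
    (m2 : {sigma_finite_measure set T2 -> \bar R}) (E : T1 -> R) (h : T2 -> R) :
  m1.-integrable setT (EFin \o E) -> m2.-integrable setT (EFin \o h) ->
  \int[(m1 \x m2)%E]_z (E z.1 * h z.2) = \int[m1]_x E x * \int[m2]_y h y.
Proof.
move=> iE ih; have i := integrable_tensor iE ih.
rewrite /Rintegral -(integral12_prod_meas1 i).
rewrite -fineM ?(integrable_fin_num _ iE) ?(integrable_fin_num _ ih)//.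
congr fine; rewrite -(fineK (integrable_fin_num _ ih))// -integralZr//.
apply: eq_integral => x _; rewrite /fubini_F/= fineK ?(integrable_fin_num _ ih)//.
by rewrite -integralZl.
Qed.

Definition ph f x : R := 2 * pi * (f.1 * x.1 + f.2 * x.2).

(** The Fourier transform of an integrable [h] is [Fc h] - j [Fs h]; the analysis is done on these
    two real functions. *)
Definition Fc h f := \int[mu2]_x (h x * cos (ph f x)).
Definition Fs h f := \int[mu2]_x (h x * sin (ph f x)).

Lemma measurable_cos : measurable_fun setT (@cos R).
Proof. by apply: continuous_measurable_fun => x; exact: continuous_cos. Qed.

Lemma measurable_sin : measurable_fun setT (@sin R).
Proof. by apply: continuous_measurable_fun => x; exact: continuous_sin. Qed.

Lemma measurable_ph : measurable_fun setT (fun z : R2 * R2 => ph z.1 z.2).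
Proof.
apply: measurable_funM => //; apply: measurable_funD; apply: measurable_funM;
  exact: measurableT_comp.
Qed.

Lemma measurable_cos_ph : measurable_fun setT (fun z : R2 * R2 => cos (ph z.1 z.2)).
Proof. exact: (measurableT_comp measurable_cos measurable_ph). Qed.

Lemma measurable_sin_ph : measurable_fun setT (fun z : R2 * R2 => sin (ph z.1 z.2)).
Proof. exact: (measurableT_comp measurable_sin measurable_ph). Qed.

Lemma measurable_cos_phr f : measurable_fun setT (fun x => cos (ph f x)).
Proof. exact: (measurableT_comp measurable_cos_ph (measurable_pair1 f)). Qed.

Lemma measurable_sin_phr f : measurable_fun setT (fun x => sin (ph f x)).
Proof. exact: (measurableT_comp measurable_sin_ph (measurable_pair1 f)). Qed.

Lemma measurable_cos_phl x : measurable_fun setT (fun f => cos (ph f x)).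
Proof. exact: (measurableT_comp measurable_cos_ph (measurable_pair2 x)). Qed.

Lemma measurable_sin_phl x : measurable_fun setT (fun f => sin (ph f x)).
Proof. exact: (measurableT_comp measurable_sin_ph (measurable_pair2 x)). Qed.

Lemma measurable_Fc h : measurable_fun setT h -> measurable_fun setT (Fc h).
Proof.
move=> mh.
suff mF : measurable_fun setT (fun z : R2 * R2 => h z.2 * cos (ph z.1 z.2)).
  exact (measurable_Rint_param (leb2s R) mF).
apply: measurable_funM; last exact: measurable_cos_ph.
exact: measurableT_comp.
Qed.

Lemma measurable_Fs h : measurable_fun setT h -> measurable_fun setT (Fs h).
Proof.
move=> mh.
suff mF : measurable_fun setT (fun z : R2 * R2 => h z.2 * sin (ph z.1 z.2)).
  exact (measurable_Rint_param (leb2s R) mF).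
apply: measurable_funM; last exact: measurable_sin_ph.
exact: measurableT_comp.
Qed.

Definition shift2 u x : R2 := (x.1 + u.1, x.2 + u.2).

Lemma shift_jacobian u : has_jacobian mu2 1 (shift2 u).
Proof.
have := plane_jacobian u.1 u.2 ltr01; rewrite expr1n; congr has_jacobian.
by apply/funext => x; rewrite !mul1r.
Qed.

Definition wt c f : R := laplace_wt c f.1 * laplace_wt c f.2.

(** The Fourier transform of [wt c]: one Poisson kernel for each coordinate. *)
Definition kern c u : R :=
  (2 * c / ((2 * pi * u.1) ^+ 2 + c ^+ 2)) * (2 * c / ((2 * pi * u.2) ^+ 2 + c ^+ 2)).

Lemma wt_integrable c : 0 < c -> mu2.-integrable setT (EFin \o wt c).
Proof. by move=> c0; apply: integrable_tensor; exact: laplace_wt_integrable. Qed.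

Lemma measurable_wt c : measurable_fun setT (wt c).
Proof.
by apply: measurable_funM; apply: (measurableT_comp (measurable_laplace_wt c)).
Qed.

Lemma wt_cos c u : 0 < c -> \int[mu2]_f (wt c f * cos (ph f u)) = kern c u.
Proof.
move=> c0; have il := laplace_wt_integrable c0.
pose kc (b x : R) : R := laplace_wt c x * cos (b * x).
pose ks (b x : R) : R := laplace_wt c x * sin (b * x).
have ic b : lambda.-integrable setT (EFin \o kc b).
  by apply: (integrable_boundedM il (measurable_cosM b)) => x; exact: bounded_cos.
have isn b : lambda.-integrable setT (EFin \o ks b).
  apply: (integrable_boundedM (M := 1) il) => [|x]; last exact: bounded_sin.
  by apply: (measurableT_comp measurable_sin); exact: measurable_funM.
transitivity (\int[mu2]_f (kc (2 * pi * u.1) f.1 * kc (2 * pi * u.2) f.2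
                       - ks (2 * pi * u.1) f.1 * ks (2 * pi * u.2) f.2)).
  apply: eq_Rintegral => f _; rewrite /wt /ph mulrDr cosD /kc /ks.
  rewrite !(mulrC (f.1)) !(mulrC (f.2)) !mulrA; ring.
rewrite RintegralB//; [|exact: integrable_tensor..].
by rewrite !Rintegral_tensor// !laplace_cos// !laplace_sin// mulr0 subr0.
Qed.

Lemma kern_ge0 c u : 0 <= c -> 0 <= kern c u.
Proof.
move=> c0; rewrite mulr_ge0// divr_ge0 ?mulr_ge0// addr_ge0 ?sqr_ge0//.
Qed.

Lemma measurable_kern c : 0 < c -> measurable_fun setT (kern c).
Proof.
move=> c0; rewrite (_ : kern c = fun u => \int[mu2]_f (wt c f * cos (ph u f))).
  suff mF : measurable_fun setT (fun z : R2 * R2 => wt c z.2 * cos (ph z.1 z.2)).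
    exact (measurable_Rint_param (leb2s R) mF).
  apply: measurable_funM; last exact: measurable_cos_ph.
  by apply: (measurableT_comp (measurable_wt c)).
apply/funext => u; rewrite -wt_cos//; apply: eq_Rintegral => f _.
by rewrite /ph !(mulrC (f.1)) !(mulrC (f.2)).
Qed.

Lemma phB f x y : cos (ph f x - ph f y) = cos (ph f x) * cos (ph f y) + sin (ph f x) * sin (ph f y).
Proof. by rewrite cosB. Qed.

(** The left-hand side is the real part of the transform at [f] times exp (2 pi j f.y), that is, the
    cosine transform after a translation by [y]. *)
Lemma FcFs_cos h f y : mu2.-integrable setT (EFin \o h) ->
  Fc h f * cos (ph f y) + Fs h f * sin (ph f y) =
  \int[mu2]_x (h x * cos (ph f (x.1 - y.1, x.2 - y.2))).
Proof.
move=> ih.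
have ic := integrable_boundedM ih (measurable_cos_phr f) (fun x => bounded_cos _).
have isn := integrable_boundedM ih (measurable_sin_phr f) (fun x => bounded_sin _).
rewrite /Fc /Fs -!RintegralZr//.
rewrite -RintegralD//; last 2 first.
- by apply: (@integrableZr _ _ _ mu2 setT measurableT (cos (ph f y)) _ ic).
- by apply: (@integrableZr _ _ _ mu2 setT measurableT (sin (ph f y)) _ isn).
apply: eq_Rintegral => x _.
have -> : ph f (x.1 - y.1, x.2 - y.2) = ph f x - ph f y by rewrite /ph/=; ring.
by rewrite phB; ring.
Qed.

(** The squared modulus of the transform is the double integral of h(x) h(y) cos (ph f (x - y)). The
    integrable weight permits integrating over the frequency first, which turns the cosine into
    [kern c] at x - y. *)
Lemma weighted_norm_kern c h : 0 < c -> mu2.-integrable setT (EFin \o h) ->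
  \int[mu2]_f (wt c f * (Fc h f ^+ 2 + Fs h f ^+ 2)) =
  \int[mu2]_y (h y * \int[mu2]_u (h (shift2 y u) * kern c u)).
Proof.
move=> c0 ih.
have mh : measurable_fun setT h by apply/measurable_EFinP; exact: measurable_int ih.
have iw := wt_integrable c0.
pose k (z : R2 * R2) := Fc h z.1 * cos (ph z.1 z.2) + Fs h z.1 * sin (ph z.1 z.2).
have mk : measurable_fun setT k.
  apply: measurable_funD; apply: measurable_funM.
  - by apply: (measurableT_comp (measurable_Fc mh)).
  - exact: measurable_cos_ph.
  - by apply: (measurableT_comp (measurable_Fs mh)).
  - exact: measurable_sin_ph.
have kM z : `|k z| <= 1 * \int[mu2]_x `|h x|.
  rewrite /k FcFs_cos//; apply: Rint_boundedM_le => // [|x]; last exact: bounded_cos.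
  apply: (measurableT_comp (measurable_cos_phr z.1) (f := fun x : R2 => _)).
  by apply: measurable_pair; apply: measurable_funB.
transitivity (\int[mu2]_f (wt c f * \int[mu2]_y (h y * k (f, y)))).
  apply: eq_Rintegral => f _; congr (_ * _).
  have ic := integrable_boundedM ih (measurable_cos_phr f) (fun x => bounded_cos _).
  have isn := integrable_boundedM ih (measurable_sin_phr f) (fun x => bounded_sin _).
  rewrite !expr2 [in X in X + _]/Fc [in X in _ + X]/Fs -!RintegralZl//.
  rewrite -RintegralD//; last 2 first.
  - by apply: (@integrableZl _ _ _ mu2 setT measurableT (Fc h f) _ ic).
  - by apply: (@integrableZl _ _ _ mu2 setT measurableT (Fs h f) _ isn).
  by apply: eq_Rintegral => y _; rewrite /k /Fc /Fs/=; ring.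
rewrite [LHS](@Rintegral_swap _ _ _ _ _ (leb2s R) (leb2s R) _ _ _ _ iw ih mk kM)/=; apply: eq_Rintegral => y _; congr (_ * _).
under eq_Rintegral do rewrite /k/= FcFs_cos//.
pose k' (z : R2 * R2) := cos (ph z.1 (z.2.1 - y.1, z.2.2 - y.2)).
have mk' : measurable_fun setT k'.
  have mg : measurable_fun setT (fun z : R2 * R2 => (z.1, (z.2.1 - y.1, z.2.2 - y.2) : R2)).
    apply: measurable_fun_pair => //.
    by apply: measurable_pair; apply: measurable_funB => //; exact: measurableT_comp.
  exact: (measurableT_comp measurable_cos_ph mg).
rewrite [LHS](@Rintegral_swap _ _ _ _ _ (leb2s R) (leb2s R) (wt c) h k' 1 iw ih mk')/= => [|z]; last exact: bounded_cos.
under eq_Rintegral do rewrite /k'/= wt_cos//.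
have mkern := measurable_kern c0.
have mky : measurable_fun setT (fun x : R2 => kern c (x.1 - y.1, x.2 - y.2)).
  apply: (measurableT_comp mkern (f := fun x : R2 => _)).
  by apply: measurable_pair; apply: measurable_funB.
have ihk : mu2.-integrable setT (EFin \o (fun x => h x * kern c (x.1 - y.1, x.2 - y.2))).
  apply: (integrable_boundedM (M := 1 * \int[mu2]_x `|wt c x|) ih mky) => x.
  rewrite -wt_cos//; apply: Rint_boundedM_le => // [|z]; last exact: bounded_cos.
  exact: measurable_cos_phl.
have := jacobian_Rintegral ltr01 (shift_jacobian y) ihk; rewrite mul1r => <-.
by apply: eq_Rintegral => u _; rewrite /shift2/= !addrK -surjective_pairing.
Qed.

End fourier_kernel.

(** * Continuity of translations in L^2 *)

Section dominated.
Context d (T : measurableType d) (R : realType) (mu : {measure set T -> \bar R}).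

Lemma L2n_dominated (f_ : nat -> T -> R) (g : T -> R) :
  (forall n, measurable_fun setT (f_ n)) -> isL2 mu g ->
  (forall n x, `|f_ n x| <= `|g x|) ->
  (forall x, f_ n x @[n --> \oo] --> (0 : R)) ->
  small (fun n => L2n mu (f_ n)).
Proof.
move=> mf lg fg f0; have ig := isL2_integrable_sqr lg.
have m2 n : measurable_fun setT (EFin \o (fun x => f_ n x ^+ 2)) by exact: measurable_sqr.
have [//|||_ _] := @dominated_convergence _ _ _ mu setT measurableT
  (fun n => EFin \o (fun x => f_ n x ^+ 2)) (cst 0%E) _ m2 _ _ ig.
- apply: nearW => x _; apply: cvg_EFin; first exact: nearW.
  by have := cvgM (f0 x) (f0 x); rewrite mulr0; apply.
- apply: nearW => x n _; rewrite /= lee_fin ger0_norm ?sqr_ge0//.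
  rewrite -(@real_normK _ (f_ n x)) ?num_real//.
  by rewrite -(@real_normK _ (g x)) ?num_real// ler_sqr ?nnegrE.
- rewrite integral0 => h; apply/small_cvg => // n; exact: L2n_ge0.
Qed.

(* Density argument: the functions moved continuously by [tau] form a closed set. *)
Lemma transl_closed (tau : nat -> T -> T) (h : T -> R) :
  (forall n, has_jacobian mu 1 (tau n)) -> isL2 mu h ->
  (forall e : R, 0 < e -> exists phi, [/\ isL2 mu phi, (L2n mu (h \- phi) < e%:E)%E &
     small (fun n => L2n mu ((phi \o tau n) \- phi))]) ->
  small (fun n => L2n mu ((h \o tau n) \- h)).
Proof.
move=> J lh H e e0; have e12 : 0 < e / 12 by rewrite divr_gt0.
have [phi [lp hp sp]] := H _ e12.
have e8 : 0 < e / 8 by rewrite divr_gt0.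
apply: filterS (sp _ e8) => n pn.
have ld := isL2B lh lp.
(* The first and the last term have the same norm because [tau n] preserves the measure, so the
   total is below 2 (e/12) + 2 (2 (e/8) + 2 (e/12)) = e. *)
have -> : (h \o tau n) \- h = ((h \- phi) \o tau n) \+ (((phi \o tau n) \- phi) \- (h \- phi)).
  by apply/funext => x /=; ring.
have m1 : measurable_fun setT ((h \- phi) \o tau n).
  by apply: measurableT_comp; [exact: ld.1|exact: (J n).1].
have m2 : measurable_fun setT ((phi \o tau n) \- phi).
  apply: measurable_funB; last exact: lp.1.
  by apply: measurableT_comp; [exact: lp.1|exact: (J n).1].
have hh := L2n_leD mu m1 (measurable_funB m2 ld.1).
apply: (le_lt_trans hh).
have := jacobian_L2n (J n) ld.1; rewrite mul1e => ->.
apply: (@le_lt_trans _ _ (2%:E * L2n mu (h \- phi) +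
  2%:E * (2%:E * L2n mu ((phi \o tau n) \- phi) + 2%:E * L2n mu (h \- phi)))%E).
  rewrite leeD2l// lee_pmul2l//; apply: L2n_leB => //; exact: ld.1.
have f1 := isL2_fin ld.
have f2 : L2n mu ((phi \o tau n) \- phi) \is a fin_num.
  by rewrite ge0_fin_numE ?L2n_ge0// (lt_trans pn)// ltry.
move: hp pn; rewrite -(fineK f1) -(fineK f2).
by rewrite -?EFinM -?EFinD -?EFinM -?EFinD !lte_fin; lra.
Qed.

End dominated.

Section cutoffs.
Variable R : realType.
Local Notation mu := (@lebesgue_measure R).

(** The shifts are bounded, hence all translates of [c] vanish outside one bounded interval, and 2 K
    times its indicator dominates the differences. *)
Lemma bump_transl (c : R -> R) (K N : R) (s_ : nat -> R) :
  continuous c -> (forall x, `|c x| <= K) -> (forall x, N < `|x| -> c x = 0) ->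
  s_ @ \oo --> (0 : R) ->
  small (fun n => L2n mu ((c \o (fun x => 1 * x + s_ n)) \- c)).
Proof.
move=> cc cK cN s0.
have mc : measurable_fun setT c by apply: continuous_measurable_fun.
have [M [_ sM]] := cvg_seq_bounded (cvgP _ s0).
have {}sM n : `|s_ n| <= `|M| + 1.
  by apply: (sM (`|M| + 1)) => //; have := ler_norm M; lra.
pose A := `[- (N + (`|M| + 1)), N + (`|M| + 1)]%classic : set R.
have mA : measurable A by exact: measurable_itv.
pose g : R -> R := fun x => (2 * K) * \1_A x.
have K0 : 0 <= K by rewrite (le_trans _ (cK 0)).
have lg : isL2 mu g.
  apply: isL2Z; split; first exact: measurable_indic.
  have -> : L2n mu \1_A = (\int[mu]_x (\1_A x)%:E)%E.
    apply: eq_integral => x _; congr EFin.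
    by rewrite /indic; case: (_ \in _); rewrite ?expr1n ?expr0n.
  have mA' : (mu A < +oo)%E by rewrite /A lebesgue_measure_itv/=; case: ifP => _; rewrite ?ltry.
  by rewrite integral_indic// setIT.
apply: (L2n_dominated _ lg).
- move=> n; apply: measurable_funB => //; apply: measurableT_comp => //.
  by apply: measurable_funD => //; exact: measurable_funM.
- move=> n x; rewrite /g /indic /= mul1r; case: (boolP (x \in A)) => xA.
    rewrite mulr1 [leRHS]ger0_norm ?mulr_ge0// (le_trans (ler_normB _ _))//.
    by have := cK x; have := cK (x + s_ n); lra.
  have xN : N + (`|M| + 1) < `|x|.
    rewrite ltNge; apply: contra xA; rewrite ler_norml => xx.
    by rewrite inE /A/= in_itv/=.
  have sn := sM n.
  rewrite !cN ?subrr ?mulr0//; first by have := normr_ge0 M; lra.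
  have := ler_normB (x + s_ n) (s_ n); rewrite addrK; lra.
- move=> x; rewrite -(subrr (c x)); apply: cvgB; last exact: cvg_cst.
  apply: (@continuous_cvg _ _ _ _ _ (fun n => 1 * x + s_ n) c); first exact: cc.
  by rewrite -[X in _ --> X](addr0 x) mul1r; apply: cvgD => //; exact: cvg_cst.
Qed.

(** A trapezoid: 1 up to distance [N] from the origin, 0 from distance N + 1 on, linear in
    between. *)
Definition cutoff (N x : R) : R := Num.max 0 (Num.min 1 (N + 1 - `|x|)).

Definition clamp (K x : R) : R := Num.max (- K) (Num.min K x).

Lemma clamp_dist (K a x : R) : `|a| <= K -> `|a - clamp K x| <= `|a - x|.
Proof.
rewrite /clamp ler_norml => /andP[a1 a2].
have := ler_norm (a - x); have := ler_norm (x - a); rewrite (distrC x).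
by rewrite minEle maxEle; case: ifPn; case: ifPn; rewrite -?ltNge ?ler_norml; lra.
Qed.

Lemma clamp_le (K x : R) : 0 <= K -> `|clamp K x| <= K.
Proof.
by rewrite /clamp minEle maxEle; case: ifPn; case: ifPn; rewrite -?ltNge ?ler_norml; lra.
Qed.

Lemma continuous_clamp (K : R) : continuous (clamp K).
Proof.
move=> x; apply: (@continuous_max _ R (fun=> - K) (fun x => Num.min K x)).
  exact: cvg_cst.
by apply: (@continuous_min _ R (fun=> K) id); first exact: cvg_cst.
Qed.

Lemma continuous_cutoff (N : R) : continuous (cutoff N).
Proof.
move=> x; apply: (@continuous_max _ R (fun=> 0) (fun x => Num.min 1 (N + 1 - `|x|))).
  exact: cvg_cst.
apply: (@continuous_min _ R (fun=> 1) (fun x => N + 1 - `|x|)); first exact: cvg_cst.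
by apply: cvgB; [exact: cvg_cst|exact: norm_continuous].
Qed.

Lemma cutoff_ge0 (N x : R) : 0 <= cutoff N x.
Proof. by rewrite /cutoff le_max lexx. Qed.

Lemma cutoff_le1 (N x : R) : cutoff N x <= 1.
Proof. by rewrite /cutoff ge_max ler01 ge_min lexx. Qed.

Lemma cutoff1 (N x : R) : `|x| <= N -> cutoff N x = 1.
Proof.
by rewrite /cutoff minEle maxEle => xN; case: ifPn; case: ifPn; rewrite -?ltNge; lra.
Qed.

Lemma cutoff0 (N x : R) : N + 1 <= `|x| -> cutoff N x = 0.
Proof.
by rewrite /cutoff minEle maxEle => xN; case: ifPn; case: ifPn; rewrite -?ltNge; lra.
Qed.

End cutoffs.

Lemma L2n_trunc d (T : measurableType d) (R : realType) (mu : {measure set T -> \bar R})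
    (h : T -> R) (B : nat -> set T) :
  isL2 mu h -> (forall n, measurable (B n)) ->
  (forall x, \forall n \near \oo, B n x) ->
  small (fun n => L2n mu (h \- (fun x => h x * \1_(B n) x))).
Proof.
move=> lh mB Bx; apply: (L2n_dominated _ lh).
- move=> n; apply: measurable_funB; first exact: lh.1.
  by apply: measurable_funM; [exact: lh.1|exact: measurable_indic].
- move=> n x; rewrite /= /indic; case: (_ \in _); rewrite ?mulr1 ?subrr ?normr0//.
  by rewrite mulr0 subr0.
- move=> x; apply: cvg_near_cst; apply: filterS (Bx x) => n Bnx.
  by rewrite /= /indic mem_set// mulr1 subrr.
Qed.

Section line_translation.
Variable R : realType.
Local Notation mu := (@lebesgue_measure R).

(** Continuous functions approximate [h] in L^1. Clamping to [-K, K] and cutting off do not increase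
    the error, and between functions bounded by [K] the squared error is at most 2 K times the
    absolute error, whence the tolerance e / (2 K). *)
Lemma bounded_approx (h : R -> R) (K N : R) (e : R) : 0 < e -> 0 < K ->
  measurable_fun setT h -> (forall x, `|h x| <= K) ->
  (forall x, N < `|x| -> h x = 0) ->
  exists c : R -> R, [/\ continuous c, (forall x, `|c x| <= K),
    (forall x, N + 1 < `|x| -> c x = 0) & (L2n mu (h \- c) < e%:E)%E].
Proof.
move=> e0 K0 mh hK hN.
pose E : set R := `[- (N + 1), N + 1]%classic.
have mE : measurable E by exact: measurable_itv.
have EP x : E x <-> `|x| <= N + 1 by rewrite /E/= in_itv/= ler_norml.
have Efin : (mu E < +oo)%E.
  by rewrite /E lebesgue_measure_itv/=; case: ifP => _; rewrite ?ltry.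
have ih : mu.-integrable E (EFin \o h).
  apply: measurable_bounded_integrable => //; first exact: measurable_funS mh.
  exists K; split; first by rewrite num_real.
  by move=> M KM x _ /=; rewrite (le_trans (hK x))// ltW.
have [g_ [cg ig hg]] := approximation_continuous_integrable mE Efin ih.
have e2 : 0 < e / (2 * K) by rewrite divr_gt0 ?mulr_gt0.
have /small_cvg hs : (fun n => \int[mu]_(z in E) `|(h z - g_ n z)%:E|)%E @ \oo --> 0%E by [].
have [n _ /(_ n (leqnn n)) hgn] := hs (fun n => integral_ge0 _ (fun x _ => abse_ge0 _)) _ e2.
pose c x := clamp K (g_ n x) * cutoff N x.
have cK x : `|c x| <= K.
  rewrite normrM -[leRHS]mulr1 ler_pM//; first by apply: clamp_le; exact: ltW.
  by rewrite ger0_norm ?cutoff_ge0 ?cutoff_le1.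
have cc : continuous c.
  move=> x; apply: cvgM; last exact: continuous_cutoff.
  by apply: (@continuous_comp _ _ _ (g_ n) (clamp K)); [exact: cg|exact: continuous_clamp].
have c0 x : N + 1 <= `|x| -> c x = 0 by move=> xN; rewrite /c cutoff0 ?mulr0.
exists c; split => // [x xN|]; first by rewrite c0// ltW.
have mc : measurable_fun setT c by apply: continuous_measurable_fun.
have mg : measurable_fun setT (g_ n) by apply: continuous_measurable_fun.
have mhg : measurable_fun setT (fun x => `|(h x - g_ n x)%:E|%E).
  by apply: measurableT_comp => //; apply/measurable_EFinP; exact: measurable_funB.
have hc x : E x -> `|h x - c x| <= `|h x - g_ n x|.
  move=> _; have [xN|xN] := leP `|x| N.
    by rewrite /c cutoff1// mulr1; exact: clamp_dist.
  have := hK x; rewrite hN// normr0 !sub0r !normrN => _.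
  apply: (@le_trans _ _ `|clamp K (g_ n x)|).
    by rewrite normrM ler_piMr// ger0_norm ?cutoff_ge0 ?cutoff_le1.
  have := @clamp_dist R K 0 (g_ n x); rewrite normr0 !sub0r !normrN.
  by apply; exact: ltW.
have -> : L2n mu (h \- c) = (\int[mu]_(x in E) ((h x - c x) ^+ 2)%:E)%E.
  rewrite [RHS]integral_mkcond; apply: eq_integral => x _; rewrite patchE.
  case: ifPn => //; rewrite notin_setE => /EP/negP; rewrite -ltNge => xN /=.
  rewrite hN ?c0 ?subrr ?expr0n//; first exact: ltW.
  by rewrite (lt_trans _ xN)// ltrDl.
apply: (@le_lt_trans _ _ (\int[mu]_(x in E) ((2 * K)%:E * `|(h x - g_ n x)%:E|))%E).
  apply: ge0_le_integral => //.
  - by move=> x _; rewrite lee_fin sqr_ge0.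
  - by apply: measurable_funS (measurable_sqr (measurable_funB mh mc)).
  - by apply: measurable_funeM; exact: measurable_funS mhg.
  - move=> x Ex; rewrite abse_EFin -EFinM lee_fin -real_normK ?num_real// expr2.
    rewrite ler_pM//; last exact: hc.
    by rewrite (le_trans (ler_normB _ _))//; have := hK x; have := cK x; lra.
rewrite ge0_integralZl_EFin//; last 2 first.
- exact: measurable_funS mhg.
- by rewrite mulr_ge0// ltW.
move: hgn; set I := (\int[mu]_(x in E) _)%E => hgn.
rewrite -(@lte_pmul2l _ (2 * K)%:E) ?lte_fin ?mulr_gt0// in hgn.
by apply: (lt_le_trans hgn); rewrite -EFinM lee_fin mulrCA divff ?mulr1// gt_eqF ?mulr_gt0.
Qed.

Lemma line_transl (h : R -> R) (s_ : nat -> R) : isL2 mu h -> s_ @ \oo --> (0 : R) ->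
  small (fun n => L2n mu ((h \o (fun x => 1 * x + s_ n)) \- h)).
Proof.
move=> lh s0; apply: (transl_closed (fun n => line_jacobian (s_ n) ltr01) lh) => e e0.
(* Restriction to [B n] truncates both the support and the values of [h], as the approximation by
   continuous functions requires. *)
pose B n : set R := [set x | `|x| <= n%:R] `&` [set x | `|h x| <= n%:R].
have mB n : measurable (B n).
  apply: measurableI.
    rewrite (_ : [set _ | _] = setT `&` (fun x : R => `|x|) @^-1` `]-oo, n%:R]); last first.
      by apply/seteqP; split=> x /=; rewrite in_itv/=; [split|case].
    by apply: (@normr_measurable R setT) => //; exact: measurable_itv.
  rewrite (_ : [set _ | _] = setT `&` (fun x : R => `|h x|) @^-1` `]-oo, n%:R]); last first.
    by apply/seteqP; split=> x /=; rewrite in_itv/=; [split|case].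
  apply: (measurableT_comp (@normr_measurable R setT) lh.1) => //; exact: measurable_itv.
have Bx x : \forall n \near \oo, B n x.
  near=> n; split => /=; near: n.
    exact: nbhs_infty_ger.
  exact: nbhs_infty_ger.
have e4 : 0 < e / 4 by rewrite divr_gt0.
have [N _ HN] := L2n_trunc lh mB Bx e4.
(* The index [N.+1] in place of [N] makes the bound on the values positive. *)
have {HN} := HN N.+1 (leqnSn N); set h' := (fun x => h x * _) => hh'.
have mh' : measurable_fun setT h'.
  by apply: measurable_funM; [exact: lh.1|exact: measurable_indic].
have N0 : 0 < N.+1%:R :> R by rewrite ltr0n.
have h'N x : `|h' x| <= N.+1%:R.
  rewrite /h' /indic; case: (boolP (x \in B N.+1)); last by rewrite mulr0 normr0.
  by rewrite inE => -[_ ?]; rewrite mulr1.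
have h'0 x : N.+1%:R < `|x| -> h' x = 0.
  rewrite /h' /indic; case: (boolP (x \in B N.+1)); last by rewrite mulr0.
  by rewrite inE => -[/= xN _]; rewrite ltNge xN.
have [c [cc cK cN h'c]] := bounded_approx e4 N0 mh' h'N h'0.
have mc : measurable_fun setT c by apply: continuous_measurable_fun.
have hc : (L2n mu (h \- c) < e%:E)%E.
  have -> : h \- c = (h \- h') \+ (h' \- c) by apply/funext => x /=; ring.
  apply: (le_lt_trans (L2n_leD mu (measurable_funB lh.1 mh') (measurable_funB mh' mc))).
  have f1 : L2n mu (h \- h') \is a fin_num.
    by rewrite ge0_fin_numE ?L2n_ge0// (lt_trans hh')// ltry.
  have f2 : L2n mu (h' \- c) \is a fin_num.
    by rewrite ge0_fin_numE ?L2n_ge0// (lt_trans h'c)// ltry.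
  move: hh' h'c; rewrite -(fineK f1) -(fineK f2).
  by rewrite -?EFinM -?EFinD !lte_fin; lra.
exists c; split => //; last exact: (@bump_transl R c N.+1%:R (N.+1%:R + 1)).
have -> : c = h \- (h \- c) by apply/funext => x /=; ring.
apply: isL2B => //; split; first exact: measurable_funB lh.1 mc.
by rewrite (lt_trans hc)// ltry.
Unshelve. all: by end_near. Qed.

End line_translation.

Section ae.
Context d (T : measurableType d) (R : realType) (mu : {measure set T -> \bar R}).
Implicit Types P Q : T -> Prop.

Lemma ae_imp P Q : {ae mu, forall x, P x} -> (forall x, P x -> Q x) ->
  {ae mu, forall x, Q x}.
Proof. by move=> aP PQ; apply: filterS aP. Qed.

Lemma ae_imp2 P1 P2 Q : {ae mu, forall x, P1 x} -> {ae mu, forall x, P2 x} ->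
  (forall x, P1 x -> P2 x -> Q x) -> {ae mu, forall x, Q x}.
Proof. by move=> a1 a2 PQ; apply: filterS2 a1 a2. Qed.

End ae.

Section plane_translation.
Variable R : realType.
Local Notation lambda := (@lebesgue_measure R).
Local Notation mu2 := (leb2 R).
Local Notation R2 := (R * R)%type.

Definition swap2 (x : R2) : R2 := (x.2, x.1).

Lemma measurable_swap2 : measurable_fun setT swap2.
Proof. exact: measurable_pair. Qed.

Lemma swap_jacobian : has_jacobian mu2 1 swap2.
Proof.
split=> [|F mF F0]; first exact: measurable_swap2.
rewrite mul1e (fubini_tonelli1 (m1 := lambda) (m2 := lambda))//; last first.
  exact: (measurableT_comp mF measurable_swap2).
by rewrite [RHS](fubini_tonelli2 (m1 := lambda) (m2 := lambda)).
Qed.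

(** Almost every horizontal section of [h] is in L^2, where the one-dimensional case applies. The
    squared norms of the differences on the sections are at most 4 [G], and [G] is integrable, so
    dominated convergence passes to the plane. *)
Lemma plane_transl1 (h : R2 -> R) (s_ : nat -> R) : isL2 mu2 h -> s_ @ \oo --> (0 : R) ->
  small (fun n => L2n mu2 ((h \o shift2 (s_ n, 0)) \- h)).
Proof.
move=> lh s0.
pose G y := L2n lambda (fun x => h (x, y)).
have mh := lh.1; have m2 := measurable_sqr mh.
have intG : (\int[lambda]_y G y = L2n mu2 h)%E.
  rewrite /L2n [RHS](fubini_tonelli2 (m1 := lambda) (m2 := lambda))// => x.
  by rewrite lee_fin sqr_ge0.
have mG : measurable_fun setT G.
  by apply: (measurable_fun_fubini_tonelli_G (m1 := lambda) _ m2) => x; rewrite lee_fin sqr_ge0.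
have iG : lambda.-integrable setT G.
  apply/integrableP; split => //.
  under eq_integral => y _ do rewrite gee0_abs ?L2n_ge0//.
  by rewrite intG; exact: lh.2.
pose d n := (h \o shift2 (s_ n, 0)) \- h.
have md n : measurable_fun setT (d n).
  by apply: measurable_funB => //; apply: measurableT_comp => //; exact: (shift_jacobian _).1.
pose F n y := L2n lambda (fun x => d n (x, y)).
have intF n : (\int[lambda]_y F n y = L2n mu2 (d n))%E.
  rewrite /L2n [RHS](fubini_tonelli2 (m1 := lambda) (m2 := lambda))//.
    exact: (measurable_sqr (md n)).
  by move=> x; rewrite lee_fin sqr_ge0.
have mF n : measurable_fun setT (F n).
  apply: (measurable_fun_fubini_tonelli_G (m1 := lambda) _ (measurable_sqr (md n))) => x.
  by rewrite lee_fin sqr_ge0.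
have dE n y : (fun x => d n (x, y)) =
    ((fun x => h (x, y)) \o (fun x => 1 * x + s_ n)) \- (fun x => h (x, y)).
  by apply/funext => x; rewrite /d/= /shift2/= mul1r addr0.
have sec y : G y \is a fin_num -> isL2 lambda (fun x => h (x, y)).
  by move=> fG; split; [exact: measurableT_comp|rewrite ltey_eq fG].
have aeG : {ae lambda, forall y, G y \is a fin_num}.
  by apply: (ae_imp (integrable_ae measurableT iG)) => y; apply.
have G0 y : (0 <= G y)%E by exact: L2n_ge0.
have cF : {ae lambda, forall y, setT y -> F^~ y @ \oo --> (cst 0%E) y}.
  apply: (ae_imp aeG) => y fG _; apply/small_cvg => [n|]; first exact: L2n_ge0.
  have := line_transl (sec y fG) s0.
  by apply: small_le => n; rewrite /F dE.
have FG : {ae lambda, forall y n, setT y -> (`|F n y| <= 4%:E * G y)%E}.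
  apply: (ae_imp aeG) => y fG n _; rewrite gee0_abs ?L2n_ge0// /F dE.
  have ls := sec y fG; have lt := jacobian_isL2 ltr01 (line_jacobian (s_ n) ltr01) ls.
  apply: (le_trans (L2n_leB lambda lt.1 ls.1)).
  have := jacobian_L2n (line_jacobian (s_ n) ltr01) ls.1; rewrite mul1e => ->.
  by rewrite -ge0_muleDl// -EFinD (_ : 2 + 2 = 4 :> R)//; ring.
have iG4 : lambda.-integrable setT (fun y => 4%:E * G y)%E by exact: integrableZl.
have [_ _] := @dominated_convergence _ _ R lambda setT measurableT F (cst 0%E)
  (fun y => 4%:E * G y)%E mF (measurable_cst _) cF iG4 FG.
rewrite integral0 => h0; have /small_cvg : (fun n => \int[lambda]_y F n y)%E @ \oo --> 0%E by [].
by move=> /(_ (fun n => integral_ge0 _ (fun y _ => L2n_ge0 _ _))); apply: small_le => n; rewrite intF.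
Qed.

Lemma plane_transl2 (h : R2 -> R) (s_ : nat -> R) : isL2 mu2 h -> s_ @ \oo --> (0 : R) ->
  small (fun n => L2n mu2 ((h \o shift2 (0, s_ n)) \- h)).
Proof.
move=> lh s0; have lhs := jacobian_isL2 ltr01 swap_jacobian lh.
apply: small_le (plane_transl1 lhs s0) => n.
rewrite -[leLHS]mul1e -[X in (_ * X)%E]mul1e.
have J := jacobian_L2n swap_jacobian.
have := J (((h \o swap2) \o shift2 (s_ n, 0)) \- (h \o swap2)).
rewrite !mul1e => <-; last first.
  apply: measurable_funB; last exact: lhs.1.
  by apply: (measurableT_comp lhs.1); exact: (shift_jacobian _).1.
by rewrite le_eqVlt; apply/orP; left; apply/eqP; apply: eq_L2n => -[x y].
Qed.

Lemma plane_transl (h : R2 -> R) (u_ : nat -> R2) : isL2 mu2 h ->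
  (u_ n).1 @[n --> \oo] --> (0 : R) -> (u_ n).2 @[n --> \oo] --> (0 : R) ->
  small (fun n => L2n mu2 ((h \o shift2 (u_ n)) \- h)).
Proof.
move=> lh u1 u2.
have := smallD (smallZ (ler0n R 2) (plane_transl1 lh u1)) (smallZ (ler0n R 2) (plane_transl2 lh u2)).
apply: small_le => n.
have J u : has_jacobian mu2 1 (shift2 u) := shift_jacobian u.
have mhs u : measurable_fun setT (h \o shift2 u).
  by apply: (measurableT_comp lh.1); exact: (J u).1.
have -> : (h \o shift2 (u_ n)) \- h = (((h \o shift2 ((u_ n).1, 0)) \- h) \o shift2 (0, (u_ n).2))
    \+ ((h \o shift2 (0, (u_ n).2)) \- h).
  apply/funext => x /=; rewrite addrA subrK; congr (h _ - _).
  by rewrite /shift2/= !addr0.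
have m1 : measurable_fun setT ((h \o shift2 ((u_ n).1, 0)) \- h).
  exact: measurable_funB (mhs _) lh.1.
apply: (le_trans (L2n_leD mu2 _ _)).
- by apply: (measurableT_comp m1); exact: (J _).1.
- exact: measurable_funB (mhs _) lh.1.
by have := jacobian_L2n (J (0, (u_ n).2)) m1; rewrite mul1e => ->.
Qed.

End plane_translation.

(** * Weighted energy and autocorrelation *)

Section plancherel.
Variable R : realType.
Local Notation lambda := (@lebesgue_measure R).
Local Notation mu2 := (leb2 R).
Local Notation R2 := (R * R)%type.
Implicit Types (h : R2 -> R) (u x y f : R2) (c : R).

Definition autocorr h u := \int[mu2]_y (h y * h (shift2 u y)).

(** Expanding the square of the difference. This form yields both the bound of the autocorrelation
    by the squared norm and, with the continuity of translations, its limit at 0. *)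
Lemma autocorrE h u : isL2 mu2 h ->
  2 * autocorr h u = 2 * fine (L2n mu2 h) - fine (L2n mu2 ((h \o shift2 u) \- h)).
Proof.
move=> lh; have lhs := jacobian_isL2 ltr01 (shift_jacobian u) lh.
have i1 := isL2_integrable_sqr lh; have i2 := isL2_integrable_sqr lhs.
have i12 := isL2_integrableM lh lhs.
have e : fine (L2n mu2 (h \o shift2 u)) = fine (L2n mu2 h).
  by rewrite -[in RHS](jacobian_L2n (shift_jacobian u) lh.1) mul1e.
have -> : 2 * fine (L2n mu2 h) = fine (L2n mu2 h) + fine (L2n mu2 h) by ring.
rewrite -[X in X + _ - _]e.
rewrite -[X in X + _ - _]/(\int[mu2]_y (h (shift2 u y) ^+ 2)).
rewrite -[X in _ + X - _]/(\int[mu2]_y (h y ^+ 2)).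
rewrite -[X in _ - X]/(\int[mu2]_y ((h (shift2 u y) - h y) ^+ 2)).
rewrite -RintegralD// -RintegralB//; last 2 first.
- exact: (integrableD _ i2 i1).
- exact: isL2_integrable_sqr (isL2B lhs lh).
rewrite -RintegralZl//; apply: eq_Rintegral => y _ /=; ring.
Qed.

Lemma L2n_shiftB_le h u : isL2 mu2 h ->
  0 <= fine (L2n mu2 ((h \o shift2 u) \- h)) <= 4 * fine (L2n mu2 h).
Proof.
move=> lh; have lhs := jacobian_isL2 ltr01 (shift_jacobian u) lh.
rewrite fine_ge0 ?L2n_ge0//= -lee_fin EFinM.
rewrite (fineK (isL2_fin lh)) (fineK (isL2_fin (isL2B lhs lh))).
apply: (le_trans (L2n_leB mu2 lhs.1 lh.1)).
have := jacobian_L2n (shift_jacobian u) lh.1; rewrite mul1e => ->.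
by rewrite -ge0_muleDl// -EFinD (_ : 2 + 2 = 4 :> R)//; ring.
Qed.

Lemma autocorr_le h u : isL2 mu2 h -> `|autocorr h u| <= fine (L2n mu2 h).
Proof.
move=> lh; have := autocorrE u lh; have := L2n_shiftB_le u lh.
by rewrite ler_norml; lra.
Qed.

Lemma autocorr_cvg h (u_ : nat -> R2) : isL2 mu2 h ->
  (u_ n).1 @[n --> \oo] --> (0 : R) -> (u_ n).2 @[n --> \oo] --> (0 : R) ->
  autocorr h (u_ n) @[n --> \oo] --> fine (L2n mu2 h).
Proof.
move=> lh u1 u2; have st := plane_transl lh u1 u2.
apply/cvgrPdist_lt => e e0; apply: filterS (st e e0) => n.
have lhs := jacobian_isL2 ltr01 (shift_jacobian (u_ n)) lh.
have := autocorrE (u_ n) lh; have := L2n_shiftB_le (u_ n) lh.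
rewrite -(fineK (isL2_fin (isL2B lhs lh))) lte_fin.
by rewrite ltr_norml; lra.
Qed.

Lemma measurable_shift_joint :
  measurable_fun setT (fun z : R2 * R2 => shift2 z.1 z.2).
Proof.
by apply: measurable_pair; apply: measurable_funD; apply: measurableT_comp => //; exact: measurableT_comp.
Qed.

Lemma measurable_autocorr h : measurable_fun setT h -> measurable_fun setT (autocorr h).
Proof.
move=> mh.
suff mF : measurable_fun setT (fun z : R2 * R2 => h z.2 * h (shift2 z.1 z.2)).
  exact (measurable_Rint_param (leb2s R) mF).
apply: measurable_funM; first exact: measurableT_comp.
exact: (measurableT_comp mh measurable_shift_joint).
Qed.

(** Integration over [y] first. The exchange rests on |h(y) h(y + u)| <= h(y)^2 + h(y + u)^2, whose
    integral over [y] is twice the squared norm for every [u], and on the integrability of the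
    kernel. *)
Lemma weighted_norm_autocorr c h : 0 < c -> mu2.-integrable setT (EFin \o kern c) ->
  mu2.-integrable setT (EFin \o h) -> isL2 mu2 h ->
  \int[mu2]_f (wt c f * (Fc h f ^+ 2 + Fs h f ^+ 2)) =
  \int[mu2]_u (kern c u * autocorr h u).
Proof.
move=> c0 ik ih lh; rewrite weighted_norm_kern//.
have mh := lh.1; have mk := measurable_kern c0.
pose F (z : R2 * R2) := h z.1 * (h (shift2 z.1 z.2) * kern c z.2).
have mF : measurable_fun setT F.
  apply: measurable_funM; first exact: measurableT_comp.
  apply: measurable_funM; last exact: measurableT_comp.
  exact: (measurableT_comp mh measurable_shift_joint).
have shC u y : shift2 u y = shift2 y u by rewrite /shift2 addrC (addrC y.2).
have iF : (leb2s R \x leb2s R)%E.-integrable setT (EFin \o F).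
  apply/integrable21ltyP; first exact/measurable_EFinP.
  apply: (@le_lt_trans _ _ (\int[mu2]_u ((kern c u)%:E * (2%:E * L2n mu2 h)))%E).
    apply: ge0_le_integral => //.
    - by move=> u _; exact: integral_ge0.
    - apply: (measurable_fun_fubini_tonelli_G (m1 := leb2s R) (fun z => `|(F z)%:E|%E)) => //.
      by apply: measurableT_comp => //; exact/measurable_EFinP.
    - by apply: emeasurable_funM => //; exact/measurable_EFinP.
    - move=> u _; have lhs := jacobian_isL2 ltr01 (shift_jacobian u) lh.
      have ki : (0 <= kern c u)%R by rewrite kern_ge0// ltW.
      have -> : (2%:E * L2n mu2 h = \int[mu2]_y ((h y ^+ 2)%:E + (h (shift2 u y) ^+ 2)%:E))%E.
        rewrite ge0_integralD//; last 4 first.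
        - by move=> y _; rewrite lee_fin sqr_ge0.
        - exact: measurable_sqr.
        - by move=> y _; rewrite lee_fin sqr_ge0.
        - exact: (measurable_sqr lhs.1).
        rewrite -[X in (_ + X)%E]/(L2n mu2 (h \o shift2 u)).
        have := jacobian_L2n (shift_jacobian u) lh.1; rewrite mul1e => ->.
        by rewrite (_ : 2 = 1 + 1 :> R)// EFinD ge0_muleDl// mul1e.
      rewrite -ge0_integralZl_EFin//; last 2 first.
      - by move=> y _; rewrite adde_ge0// lee_fin sqr_ge0.
      - by apply: emeasurable_funD; [exact: measurable_sqr|exact: (measurable_sqr lhs.1)].
      apply: ge0_le_integral => //.
      - apply: measurableT_comp => //; apply/measurable_EFinP.
        exact: (measurableT_comp mF (measurable_pair2 u)).
      - apply: measurable_funeM.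
        by apply: emeasurable_funD; [exact: measurable_sqr|exact: (measurable_sqr lhs.1)].
      - move=> y _; rewrite /F /= -EFinD -EFinM lee_fin mulrA normrM.
        rewrite [X in _ * X]ger0_norm// mulrC ler_wpM2l// -shC normrM.
        rewrite -(@real_normK _ (h y)) ?num_real// -(@real_normK _ (h (shift2 u y))) ?num_real//.
        have := sqr_ge0 (`|h y| - `|h (shift2 u y)|).
        have := sqr_ge0 (`|h y|); have := sqr_ge0 (`|h (shift2 u y)|); nra.
  rewrite ge0_integralZr//; last 3 first.
  - exact/measurable_EFinP.
  - by move=> u _; rewrite lee_fin kern_ge0// ltW.
  - by rewrite mule_ge0// L2n_ge0.
  apply: lte_mul_pinfty; first by apply: integral_ge0 => u _; rewrite lee_fin kern_ge0// ltW.
  - exact: (integrable_fin_num _ ik).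
  - by rewrite lte_mul_pinfty// lh.2.
have inner1 y : mu2.-integrable setT (EFin \o (fun u => h (shift2 y u) * kern c u)).
  have lhs := jacobian_integrable ltr01 (shift_jacobian y) ih.
  apply: (integrable_boundedM (M := 1 * \int[mu2]_x `|wt c x|) lhs.1 mk) => u.
  rewrite -wt_cos//; apply: Rint_boundedM_le; [exact: wt_integrable|exact: measurable_cos_phl|].
  by move=> z; exact: bounded_cos.
have inner2 u : mu2.-integrable setT (EFin \o (fun y => h y * h (shift2 u y))).
  exact: isL2_integrableM lh (jacobian_isL2 ltr01 (shift_jacobian u) lh).
have e : (\int[mu2]_y \int[mu2]_u (F (y, u))%:E = \int[mu2]_u \int[mu2]_y (F (y, u))%:E)%E.
  exact: Fubini iF.
transitivity (fine (\int[mu2]_y \int[mu2]_u (F (y, u))%:E))%E.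
  congr fine; apply: eq_integral => y _.
  rewrite EFinM fineK; last exact: (integrable_fin_num _ (inner1 y)).
  by rewrite -integralZl//; exact: inner1.
rewrite e [RHS]/Rintegral; congr fine; apply: eq_integral => u _.
rewrite EFinM fineK; last exact: (integrable_fin_num _ (inner2 u)).
rewrite -integralZl//; last exact: inner2.
apply: eq_integral => y _; rewrite -EFinM; congr EFin.
by rewrite /F/= -shC; ring.
Qed.

End plancherel.

(** * Removal of the weight *)

Section plancherel_limit.
Variable R : realType.
Local Notation lambda := (@lebesgue_measure R).
Local Notation mu2 := (leb2 R).
Local Notation R2 := (R * R)%type.
Implicit Types (h : R2 -> R) (u x y f : R2) (c : R).

Definition cauchy_pdf (x : R) : R := pi^-1 / (1 + x ^+ 2).

Lemma cauchy_pdf_ge0 (x : R) : 0 <= cauchy_pdf x.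
Proof. by rewrite divr_ge0 ?invr_ge0 ?pi_ge0// addr_ge0// sqr_ge0. Qed.

Lemma cauchy_pdf_integral : (\int[lambda]_x (cauchy_pdf x)%:E = 1)%E.
Proof.
pose p (x : R) : R := (oneDsqr x)^-1.
have cp : continuous p by exact: continuous_oneDsqrV.
have mp : measurable_fun setT p by apply: continuous_measurable_fun.
have p0 (x : R) : 0 <= p x by rewrite /p invr_ge0 (le_trans ler01)// oneDsqr_ge1.
have -> : (\int[lambda]_x (cauchy_pdf x)%:E = (pi^-1)%:E * \int[lambda]_x (p x)%:E)%E.
  rewrite -ge0_integralZl_EFin//; last 3 first.
  - by move=> x _; rewrite lee_fin.
  - exact/measurable_EFinP.
  - by rewrite invr_ge0 pi_ge0.
rewrite ge0_symfun_integralT//; last by move=> x; rewrite /p /= /oneDsqr sqrrN.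
rewrite -set_itvcy integral0y_oneDsqr -!EFinM; congr EFin.
by move: (@pi R) (pi_gt0 R) => q q0; field; rewrite gt_eqF.
Qed.

Lemma measurable_cauchy_pdf : measurable_fun setT cauchy_pdf.
Proof.
apply: measurable_funM => //; apply: (continuous_measurable_fun (f := fun x : R => (1 + x ^+ 2)^-1)).
exact: continuous_oneDsqrV.
Qed.

Lemma cauchy_pdf_integrable : lambda.-integrable setT (EFin \o cauchy_pdf).
Proof.
apply/integrableP; split; first by apply/measurable_EFinP; exact: measurable_cauchy_pdf.
under eq_integral do rewrite /= ger0_norm ?cauchy_pdf_ge0//.
by rewrite cauchy_pdf_integral ltry.
Qed.

Definition k0 x : R := cauchy_pdf x.1 * cauchy_pdf x.2.

Lemma k0_integrable : mu2.-integrable setT (EFin \o k0).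
Proof. exact: integrable_tensor cauchy_pdf_integrable cauchy_pdf_integrable. Qed.

Lemma k0_integral : \int[mu2]_x k0 x = 1.
Proof.
rewrite (Rintegral_tensor cauchy_pdf_integrable cauchy_pdf_integrable).
by rewrite /Rintegral cauchy_pdf_integral mulr1.
Qed.

(** [kern c] is a dilate of the fixed probability density [k0], hence an approximate identity as [c]
    tends to 0. The zero offsets match [plane_jacobian]. *)
Lemma kern_scale c x : 0 < c -> (c / (2 * pi)) ^+ 2 *
  kern c (c / (2 * pi) * x.1 + 0, c / (2 * pi) * x.2 + 0) = k0 x.
Proof.
move=> c0; rewrite /kern /k0 /cauchy_pdf/= !addr0.
move: (@pi R) (pi_gt0 R) => q q0.
have h (y : R) : 2 * c / ((2 * q * (c / (2 * q) * y)) ^+ 2 + c ^+ 2) =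
    (2 * q / c) * (q^-1 / (1 + y ^+ 2)).
  have -> : 2 * q * (c / (2 * q) * y) = c * y by field; rewrite gt_eqF.
  have y0 : 1 + y ^+ 2 != 0 by rewrite gt_eqF// ltr_pwDl// sqr_ge0.
  rewrite exprMn (_ : c ^+ 2 * y ^+ 2 + c ^+ 2 = c ^+ 2 * (1 + y ^+ 2)); last by ring.
  by field; rewrite y0 !gt_eqF.
rewrite !h; move: (_ / (1 + x.1 ^+ 2)) (_ / (1 + x.2 ^+ 2)) => A B.
by field; rewrite !gt_eqF.
Qed.

Lemma kern_integrable c : 0 < c -> mu2.-integrable setT (EFin \o kern c).
Proof.
move=> c0; have p0 := pi_gt0 R; pose a := c / (2 * pi).
have a0 : 0 < a by rewrite divr_gt0// mulr_gt0.
have ai0 : 0 < a^-1 by rewrite invr_gt0.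
have [i _] := jacobian_integrable (exprn_gt0 2 ai0) (plane_jacobian 0 0 ai0) k0_integrable.
have := integrableZl measurableT (a ^- 2) i.
apply: eq_integrable => // u _ /=; rewrite -EFinM; congr EFin.
rewrite -(kern_scale _ c0) -/a mulrA mulVf ?expf_neq0 ?gt_eqF// mul1r.
by rewrite !addr0 !mulrA divff ?gt_eqF// !mul1r -surjective_pairing.
Qed.

Lemma weighted_norm_scaled c h : 0 < c ->
  mu2.-integrable setT (EFin \o h) -> isL2 mu2 h ->
  \int[mu2]_f (wt c f * (Fc h f ^+ 2 + Fs h f ^+ 2)) =
  \int[mu2]_x (k0 x * autocorr h (c / (2 * pi) * x.1 + 0, c / (2 * pi) * x.2 + 0)).
Proof.
move=> c0 ih lh; have p0 := pi_gt0 R; have ik := kern_integrable c0.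
have a0 : 0 < c / (2 * pi) by rewrite divr_gt0// mulr_gt0.
have iA : mu2.-integrable setT (EFin \o (fun u => kern c u * autocorr h u)).
  apply: (integrable_boundedM ik (measurable_autocorr lh.1)) => u.
  exact: autocorr_le.
rewrite (weighted_norm_autocorr c0 ik ih lh).
have [i _] := jacobian_integrable (exprn_gt0 2 a0) (plane_jacobian 0 0 a0) iA.
rewrite -(jacobian_Rintegral (exprn_gt0 2 a0) (plane_jacobian 0 0 a0) iA).
rewrite -RintegralZl//; apply: eq_Rintegral => x _.
by rewrite mulrA kern_scale.
Qed.

(** After rescaling, [c] occurs only in the argument of the autocorrelation, which tends to 0; [k0]
    times the squared norm of [h] dominates. *)
Lemma weighted_norm_cvg h (c_ : nat -> R) : (forall n, 0 < c_ n) -> c_ @ \oo --> (0 : R) ->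
  mu2.-integrable setT (EFin \o h) -> isL2 mu2 h ->
  \int[mu2]_f (wt (c_ n) f * (Fc h f ^+ 2 + Fs h f ^+ 2)) @[n --> \oo] --> fine (L2n mu2 h).
Proof.
move=> c0 cc ih lh.
under eq_fun do rewrite weighted_norm_scaled//.
pose N := fine (L2n mu2 h).
pose tau n x : R2 := (c_ n / (2 * pi) * x.1 + 0, c_ n / (2 * pi) * x.2 + 0).
have mk0 : measurable_fun setT k0 by apply/measurable_EFinP; exact: measurable_int k0_integrable.
have a0 n : 0 < c_ n / (2 * pi) by rewrite divr_gt0// mulr_gt0// pi_gt0.
pose Fn n x := k0 x * autocorr h (tau n x).
pose F0 x := k0 x * N.
have mf n : measurable_fun setT (EFin \o Fn n).
  apply/measurable_EFinP; apply: measurable_funM => //.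
  by apply: (measurableT_comp (measurable_autocorr lh.1)); exact: (plane_jacobian 0 0 (a0 n)).1.
have mg : measurable_fun setT (EFin \o F0).
  by apply/measurable_EFinP; exact: measurable_funM.
have cf : {ae mu2, forall x, setT x -> (EFin \o Fn n) x @[n --> \oo]
    --> (EFin \o F0) x}.
  apply: (ae_imp (P := fun=> True)); first exact: nearW.
  move=> x _ _; apply: cvg_EFin; first exact: nearW.
  apply: cvgM; first exact: cvg_cst.
  have h1 (t : R) : c_ n / (2 * pi) * t + 0 @[n --> \oo] --> (0 : R).
    under eq_fun do rewrite addr0 -mulrA.
    by rewrite -(mul0r ((2 * pi)^-1 * t)); apply: cvgM => //; exact: cvg_cst.
  by apply: autocorr_cvg => //; exact: h1.
have ik : mu2.-integrable setT (EFin \o F0).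
  by apply: eq_integrable (integrableZr measurableT N k0_integrable) => // x _ /=; rewrite EFinM.
have k0ge x : 0 <= k0 x by rewrite mulr_ge0 ?cauchy_pdf_ge0.
have fg : {ae mu2, forall x n, setT x ->
    (`|(EFin \o Fn n) x| <= (EFin \o F0) x)%E}.
  apply: (ae_imp (P := fun=> True)); first exact: nearW.
  move=> x _ n _; rewrite /= lee_fin normrM ger0_norm// ler_wpM2l//.
  exact: autocorr_le.
have [_ _] := @dominated_convergence _ _ R mu2 setT measurableT (fun n => EFin \o Fn n)
  (EFin \o F0) (EFin \o F0) mf mg cf ik fg.
have -> : (\int[mu2]_x (EFin \o F0) x = N%:E)%E.
  rewrite -[LHS]fineK ?(integrable_fin_num _ ik)//; congr EFin.
  by rewrite -[LHS]/(\int[mu2]_x (k0 x * N)) RintegralZr ?k0_integral ?mul1r//; exact: k0_integrable.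
by move=> /fine_cvg.
Qed.

Lemma wt_bound c f : 0 < c -> 0 <= wt c f.
Proof. by move=> c0; rewrite mulr_ge0 ?laplace_wt_ge0. Qed.

(** As [c] decreases to 0 the weights increase to 1, so the weighted energy tends to the full energy
    by monotone convergence, which needs no prior finiteness. Through the autocorrelation it tends
    to the squared norm of [h]. *)
Lemma plancherel_L1L2 h : mu2.-integrable setT (EFin \o h) -> isL2 mu2 h ->
  (\int[mu2]_f (Fc h f ^+ 2 + Fs h f ^+ 2)%:E = L2n mu2 h)%E.
Proof.
move=> ih lh; pose c_ (n : nat) : R := n.+1%:R^-1.
have c0 n : 0 < c_ n by rewrite invr_gt0.
have cc : c_ @ \oo --> (0 : R) by exact: cvg_harmonic.
pose P f := Fc h f ^+ 2 + Fs h f ^+ 2.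
have P0 f : 0 <= P f by rewrite addr_ge0 ?sqr_ge0.
have mP : measurable_fun setT P.
  apply: measurable_funD; apply: measurable_funX; [exact: measurable_Fc lh.1|exact: measurable_Fs lh.1].
pose g n f := (wt (c_ n) f * P f)%:E.
have mg n : measurable_fun setT (g n).
  by apply/measurable_EFinP; apply: measurable_funM => //; exact: measurable_wt.
have g0 n f : setT f -> (0 <= g n f)%E by move=> _; rewrite lee_fin mulr_ge0// wt_bound.
have ndg f : setT f -> nondecreasing_seq (g ^~ f).
  move=> _ m n mn; rewrite lee_fin ler_wpM2r// ler_pM ?laplace_wt_ge0//;
    rewrite ler_expR lerN2 ler_wpM2r// lef_pV2 ?posrE// ler_nat//.
have := @cvg_monotone_convergence _ _ R mu2 setT measurableT g mg g0 ndg.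
have -> : (fun f => limn (g ^~ f)) = (fun f => (P f)%:E).
  apply/funext => f; apply/cvg_lim => //; apply: cvg_EFin; first exact: nearW.
  rewrite -[X in _ --> X]mul1r; apply: cvgM; last exact: cvg_cst.
  rewrite -[X in _ --> X]mul1r.
  have lw (t : R) : laplace_wt (c_ n) t @[n --> \oo] --> (1 : R).
    rewrite -expR0; apply: (@continuous_cvg _ _ _ _ _ (fun n => - (c_ n * `|t|)) expR).
      exact: continuous_expR.
    rewrite -oppr0; apply: cvgN; rewrite -(mul0r `|t|); apply: cvgM => //; exact: cvg_cst.
  by apply: cvgM; exact: lw.
move=> K; have J := weighted_norm_cvg c0 cc ih lh.
have gE n : (\int[mu2]_f g n f = (\int[mu2]_f (wt (c_ n) f * P f))%:E)%E.
  rewrite fineK//; apply: (@integrable_fin_num _ _ _ mu2 setT measurableT).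
  apply: (@integrable_boundedM _ _ _ mu2 (wt (c_ n)) P
    ((\int[mu2]_x `|h x|) ^+ 2 + (\int[mu2]_x `|h x|) ^+ 2)).
  - exact: wt_integrable.
  - exact: mP.
  - have b1 f : `|Fc h f| <= \int[mu2]_x `|h x|.
      rewrite -[leRHS]mul1r; apply: Rint_boundedM_le => // [|x]; last exact: bounded_cos.
      exact: measurable_cos_phr.
    have b2 f : `|Fs h f| <= \int[mu2]_x `|h x|.
      rewrite -[leRHS]mul1r; apply: Rint_boundedM_le => // [|x]; last exact: bounded_sin.
      exact: measurable_sin_phr.
    have I0 : 0 <= \int[mu2]_x `|h x| by apply: Rintegral_ge0.
    move=> f; rewrite ger0_norm// lerD//; rewrite -[leLHS]real_normK ?num_real//.
      by rewrite ler_sqr ?nnegrE.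
    by rewrite ler_sqr ?nnegrE.
have J' : (\int[mu2]_f g n f)%E @[n --> \oo] --> L2n mu2 h.
  under eq_fun do rewrite gE.
  by rewrite -(fineK (isL2_fin lh)); apply: cvg_EFin => //; exact: nearW.
exact: (cvg_unique (@ereal_hausdorff R) K J').
Qed.

End plancherel_limit.

(** * The Fourier transform on L^2 *)

Section L2_limits.
Context d (T : measurableType d) (R : realType) (mu : {measure set T -> \bar R}).
Implicit Types f g : T -> R.

(** With d = g - f one has g^2 - f^2 = 2 f d + d^2, and Young's inequality 2 |f d| <= t f^2 + d^2 /
    t. This gives the continuity of the squared norm without taking roots. *)
Lemma L2n_perturb f g (t : R) : 0 < t -> isL2 mu f -> isL2 mu g ->
  `|fine (L2n mu g) - fine (L2n mu f)| <=
  t * fine (L2n mu f) + (1 + t^-1) * fine (L2n mu (g \- f)).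
Proof.
move=> t0 lf lg; have ld := isL2B lg lf.
have i_f := isL2_integrable_sqr lf; have i_g := isL2_integrable_sqr lg.
have i_d := isL2_integrable_sqr ld.
rewrite -[fine (L2n mu f)]/(\int[mu]_x (f x ^+ 2)) -[fine (L2n mu g)]/(\int[mu]_x (g x ^+ 2)).
rewrite -[fine (L2n mu _)]/(\int[mu]_x ((g x - f x) ^+ 2)).
have i1 : mu.-integrable setT (EFin \o (fun x => t * f x ^+ 2)).
  exact: (integrableZl measurableT t i_f).
have i2 : mu.-integrable setT (EFin \o (fun x => (1 + t^-1) * (g x - f x) ^+ 2)).
  exact: (integrableZl measurableT (1 + t^-1) i_d).
have i3 : mu.-integrable setT (EFin \o (fun x => g x ^+ 2 - f x ^+ 2)).
  exact: (integrableB measurableT i_g i_f).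
rewrite -RintegralB// -RintegralZl// -RintegralZl// -RintegralD//.
apply: (le_trans (le_normr_Rintegral measurableT i3)).
apply: le_Rintegral => //.
- exact: (integrable_norm i3).
- exact: (integrableD measurableT i1 i2).
- move=> x _; set a := f x; set b := g x.
  have ti : 0 < t^-1 by rewrite invr_gt0.
  have tt : t * t^-1 = 1 by rewrite divff ?gt_eqF.
  have e1 := sqr_ge0 (t * a + (b - a)); have e2 := sqr_ge0 (t * a - (b - a)).
  have e1' : 0 <= t * a ^+ 2 + 2 * a * (b - a) + t^-1 * (b - a) ^+ 2.
    rewrite -(pmulr_rge0 _ t0); move: e1; congr (_ <= _).
    by rewrite !mulrDr [t * (t^-1 * _)]mulrA tt; ring.
  have e2' : 0 <= t * a ^+ 2 - 2 * a * (b - a) + t^-1 * (b - a) ^+ 2.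
    rewrite -(pmulr_rge0 _ t0); move: e2; congr (_ <= _).
    by rewrite !mulrDr [t * (t^-1 * _)]mulrA tt; ring.
  rewrite ler_norml; apply/andP; split; first by have := sqr_ge0 (b - a); lra.
  lra.
Qed.

Lemma L2n_cvg (f_ : nat -> T -> R) f : (forall n, isL2 mu (f_ n)) -> isL2 mu f ->
  small (fun n => L2n mu (f_ n \- f)) ->
  fine (L2n mu (f_ n)) @[n --> \oo] --> fine (L2n mu f).
Proof.
move=> lf_ lf sf; apply/cvgrPdist_lt => e e0.
have N0 : 0 <= fine (L2n mu f) by rewrite fine_ge0 ?L2n_ge0.
set N := fine _ in N0 *.
(* Chosen so that t N <= e / 2; the added 1 covers N = 0. *)
pose t := e / (2 * (N + 1)).
have N1 : 0 < N + 1 by rewrite ltr_wpDl.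
have t0 : 0 < t by rewrite divr_gt0// mulr_gt0.
have s0 : 0 < 1 + t^-1 by rewrite addr_gt0// invr_gt0.
have q0 : 0 < e / 2 / (1 + t^-1) by rewrite divr_gt0// divr_gt0.
apply: filterS (sf _ q0) => n.
have := L2n_perturb t0 lf (lf_ n); rewrite -/N distrC.
rewrite -[X in (X < _)%E -> _](fineK (isL2_fin (isL2B (lf_ n) lf))) lte_fin.
rewrite ltr_pdivlMr// => h1 h2; apply: (le_lt_trans h1).
have h3 : t * N <= e / 2.
  have te : t * (2 * (N + 1)) = e by rewrite mulfVK// gt_eqF// mulr_gt0.
  by nra.
by rewrite (splitr e) ler_ltD// mulrC.
Qed.

Lemma small_ae_eq (f_ : nat -> T -> R) f g : (forall n, measurable_fun setT (f_ n)) ->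
  isL2 mu f -> isL2 mu g -> small (fun n => L2n mu (f_ n \- f)) ->
  small (fun n => L2n mu (f_ n \- g)) -> {ae mu, forall x, f x = g x}.
Proof.
move=> mf lf lg sf sg; have ld := isL2B lf lg.
have : L2n mu (f \- g) = 0%E.
  apply/eqP; rewrite eq_le L2n_ge0 andbT.
  apply: (small_le_cst (smallD (smallZ (ler0n R 2) sg) (smallZ (ler0n R 2) sf))) => n.
  have -> : f \- g = (f_ n \- g) \- (f_ n \- f) by apply/funext => x /=; ring.
  by apply: L2n_leB; apply: measurable_funB => //; [exact: lg.1|exact: lf.1].
move=> /(L2n_eq0 ld.1) h; apply: (ae_imp h) => x /eqP.
by rewrite subr_eq0 => /eqP.
Qed.

End L2_limits.

(** Extends a map by continuity: images are Cauchy when their distances are at most those of a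
    convergent sequence. *)
Lemma L2_complete_dom d (T : measurableType d) d' (T' : measurableType d') (R : realType)
    (mu : {measure set T -> \bar R}) (mu' : {measure set T' -> \bar R})
    (f_ : nat -> T -> R) (g_ : nat -> T' -> R) (g : T' -> R) :
  (forall n, isL2 mu (f_ n)) -> (forall n, isL2 mu' (g_ n)) -> isL2 mu' g ->
  small (fun n => L2n mu' (g_ n \- g)) ->
  (forall m n, (L2n mu (f_ m \- f_ n) <= L2n mu' (g_ m \- g_ n))%E) ->
  exists2 f, isL2 mu f & small (fun n => L2n mu (f_ n \- f)).
Proof.
move=> lf lg_ lg sg fg; apply: L2_complete => // e e0.
have e4 : 0 < e / 4 by rewrite divr_gt0.
have [N _ HN] := sg _ e4; exists N => m n Nm Nn.
apply: (le_lt_trans (fg m n)).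
have -> : g_ m \- g_ n = (g_ m \- g) \- (g_ n \- g) by apply/funext => x /=; ring.
have lm := isL2B (lg_ m) lg; have ln := isL2B (lg_ n) lg.
apply: (le_lt_trans (L2n_leB mu' lm.1 ln.1)).
move: (HN m Nm) (HN n Nn); rewrite -(fineK (isL2_fin lm)) -(fineK (isL2_fin ln)).
by rewrite -?EFinM -?EFinD !lte_fin; lra.
Qed.

(** * The L^2 Fourier transform as a relation between real functions *)

Section fourier_pairs.
Variable R : realType.
Local Notation mu2 := (leb2 R).
Local Notation R2 := (R * R)%type.
Implicit Types (h p r : R2 -> R) (f x : R2).

Lemma FcE_B h h' f : mu2.-integrable setT (EFin \o h) -> mu2.-integrable setT (EFin \o h') ->
  Fc (h \- h') f = Fc h f - Fc h' f.
Proof.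
move=> ih ih'; rewrite /Fc -RintegralB//.
- by apply: eq_Rintegral => x _ /=; ring.
- exact: (integrable_boundedM ih (measurable_cos_phr f) (fun x => bounded_cos _)).
- exact: (integrable_boundedM ih' (measurable_cos_phr f) (fun x => bounded_cos _)).
Qed.

Lemma FsE_B h h' f : mu2.-integrable setT (EFin \o h) -> mu2.-integrable setT (EFin \o h') ->
  Fs (h \- h') f = Fs h f - Fs h' f.
Proof.
move=> ih ih'; rewrite /Fs -RintegralB//.
- by apply: eq_Rintegral => x _ /=; ring.
- exact: (integrable_boundedM ih (measurable_sin_phr f) (fun x => bounded_sin _)).
- exact: (integrable_boundedM ih' (measurable_sin_phr f) (fun x => bounded_sin _)).
Qed.

Lemma FcE_Z (a : R) h f : mu2.-integrable setT (EFin \o h) ->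
  Fc (fun x => a * h x) f = a * Fc h f.
Proof.
move=> ih; rewrite /Fc -RintegralZl//.
- by apply: eq_Rintegral => x _ /=; ring.
- exact: (integrable_boundedM ih (measurable_cos_phr f) (fun x => bounded_cos _)).
Qed.

Lemma FsE_Z (a : R) h f : mu2.-integrable setT (EFin \o h) ->
  Fs (fun x => a * h x) f = a * Fs h f.
Proof.
move=> ih; rewrite /Fs -RintegralZl//.
- by apply: eq_Rintegral => x _ /=; ring.
- exact: (integrable_boundedM ih (measurable_sin_phr f) (fun x => bounded_sin _)).
Qed.

Lemma plancherel_split h : mu2.-integrable setT (EFin \o h) -> isL2 mu2 h ->
  (L2n mu2 (Fc h) + L2n mu2 (Fs h) = L2n mu2 h)%E.
Proof.
move=> ih lh; rewrite -(plancherel_L1L2 ih lh) /L2n -ge0_integralD//.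
- by move=> x _; rewrite lee_fin sqr_ge0.
- exact: measurable_sqr (measurable_Fc lh.1).
- by move=> x _; rewrite lee_fin sqr_ge0.
- exact: measurable_sqr (measurable_Fs lh.1).
Qed.

Lemma isL2_Fc h : mu2.-integrable setT (EFin \o h) -> isL2 mu2 h -> isL2 mu2 (Fc h).
Proof.
move=> ih lh; split; first exact: measurable_Fc lh.1.
by apply: le_lt_trans lh.2; rewrite -(plancherel_split ih lh) leeDl// L2n_ge0.
Qed.

Lemma isL2_Fs h : mu2.-integrable setT (EFin \o h) -> isL2 mu2 h -> isL2 mu2 (Fs h).
Proof.
move=> ih lh; split; first exact: measurable_Fs lh.1.
by apply: le_lt_trans lh.2; rewrite -(plancherel_split ih lh) leeDr// L2n_ge0.
Qed.

(* [p - j r] represents the Fourier transform of [h]. *)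
Definition isF h p r := [/\ isL2 mu2 h, isL2 mu2 p, isL2 mu2 r &
  exists h_ : nat -> R2 -> R,
    [/\ forall n, mu2.-integrable setT (EFin \o h_ n) /\ isL2 mu2 (h_ n),
        small (fun n => L2n mu2 (h_ n \- h)),
        small (fun n => L2n mu2 (Fc (h_ n) \- p)) &
        small (fun n => L2n mu2 (Fs (h_ n) \- r))]].

Lemma isF_norm h p r : isF h p r ->
  fine (L2n mu2 p) + fine (L2n mu2 r) = fine (L2n mu2 h).
Proof.
move=> [lh lp lr [h_ [ih sh sp sr]]].
have c1 := L2n_cvg (fun n => (ih n).2) lh sh.
have c2 := L2n_cvg (fun n => isL2_Fc (ih n).1 (ih n).2) lp sp.
have c3 := L2n_cvg (fun n => isL2_Fs (ih n).1 (ih n).2) lr sr.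
have e : (fun n => fine (L2n mu2 (h_ n))) =
    (fun n => fine (L2n mu2 (Fc (h_ n))) + fine (L2n mu2 (Fs (h_ n)))).
  apply/funext => n; rewrite -(plancherel_split (ih n).1 (ih n).2) fineD//.
    exact: isL2_fin (isL2_Fc (ih n).1 (ih n).2).
  exact: isL2_fin (isL2_Fs (ih n).1 (ih n).2).
have c4 := cvgD c2 c3; rewrite e in c1.
exact: (cvg_unique (@Rhausdorff R) (c4 _) c1).
Qed.

Lemma L2n_small_lin (T : nat -> R2 -> R) (T' : nat -> R2 -> R) (a : R) p p' :
  (forall n, isL2 mu2 (T n)) -> (forall n, isL2 mu2 (T' n)) -> isL2 mu2 p -> isL2 mu2 p' ->
  small (fun n => L2n mu2 (T n \- p)) -> small (fun n => L2n mu2 (T' n \- p')) ->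
  small (fun n => L2n mu2 ((fun x => a * T n x - T' n x) \- (fun x => a * p x - p' x))).
Proof.
move=> lT lT' lp lp' s s'.
have := smallD (smallZ (ler0n R 2) (smallZ (sqr_ge0 a) s)) (smallZ (ler0n R 2) s').
apply: small_le => n; have ld := isL2B (lT n) lp; have ld' := isL2B (lT' n) lp'.
rewrite -(L2nZ mu2 a ld.1).
have -> : (fun x => a * T n x - T' n x) \- (fun x => a * p x - p' x) =
  (fun x => a * (T n \- p) x) \- (T' n \- p') by apply/funext => x /=; ring.
by apply: L2n_leB; [exact: (isL2Z a ld).1|exact: ld'.1].
Qed.

(** This shape gives differences at a = 1, and scalar multiples and general combinations by repeated
    use. *)
Lemma isF_lin (a : R) h p r h' p' r' : isF h p r -> isF h' p' r' ->
  isF (fun x => a * h x - h' x) (fun x => a * p x - p' x) (fun x => a * r x - r' x).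
Proof.
move=> [lh lp lr [h_ [ih sh sp sr]]] [lh' lp' lr' [h'_ [ih' sh' sp' sr']]].
have iZ n := integrableZl measurableT a (ih n).1.
split; [exact: isL2B (isL2Z a lh) lh'|exact: isL2B (isL2Z a lp) lp'|
  exact: isL2B (isL2Z a lr) lr'|].
exists (fun n x => a * h_ n x - h'_ n x); split.
- move=> n; split; last exact: isL2B (isL2Z a (ih n).2) (ih' n).2.
  exact: (integrableB measurableT (iZ n) (ih' n).1).
- exact: L2n_small_lin (fun n => (ih n).2) (fun n => (ih' n).2) lh lh' sh sh'.
- have := L2n_small_lin a (fun n => isL2_Fc (ih n).1 (ih n).2)
    (fun n => isL2_Fc (ih' n).1 (ih' n).2) lp lp' sp sp'.
  apply: small_le => n; rewrite le_eqVlt; apply/orP; left; apply/eqP; apply: eq_L2n => f /=.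
  congr (_ - _); rewrite -(FcE_Z a f (ih n).1).
  exact: (FcE_B (h := fun x => a * h_ n x) f (iZ n) (ih' n).1).
- have := L2n_small_lin a (fun n => isL2_Fs (ih n).1 (ih n).2)
    (fun n => isL2_Fs (ih' n).1 (ih' n).2) lr lr' sr sr'.
  apply: small_le => n; rewrite le_eqVlt; apply/orP; left; apply/eqP; apply: eq_L2n => f /=.
  congr (_ - _); rewrite -(FsE_Z a f (ih n).1).
  exact: (FsE_B (h := fun x => a * h_ n x) f (iZ n) (ih' n).1).
Qed.

Lemma isF_unique h p r p' r' : isF h p r -> isF h p' r' ->
  {ae mu2, forall f, p f = p' f} /\ {ae mu2, forall f, r f = r' f}.
Proof.
move=> F F'; have D := isF_lin 1 F F'; have [_ lp lr _] := D.
have := isF_norm D.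
have -> : L2n mu2 (fun x => 1 * h x - h x) = 0%E.
  by rewrite /L2n; under eq_integral do rewrite mul1r subrr expr0n; exact: integral0.
move=> /eqP; rewrite paddr_eq0 ?fine_ge0 ?L2n_ge0// => /andP[/eqP p0 /eqP r0].
have f0 (q : R2 -> R) : isL2 mu2 q -> fine (L2n mu2 q) = 0 -> {ae mu2, forall x, q x = 0}.
  by move=> lq q0; apply: (L2n_eq0 lq.1); rewrite -(fineK (isL2_fin lq)) q0.
split; [apply: (ae_imp (f0 _ lp p0))|apply: (ae_imp (f0 _ lr r0))] => f /eqP;
  by rewrite mul1r subr_eq0 => /eqP.
Qed.

Lemma isF_ae h p r h' p' r' : isF h p r -> measurable_fun setT h' ->
  measurable_fun setT p' -> measurable_fun setT r' ->
  {ae mu2, forall x, h x = h' x} ->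
  {ae mu2, forall f, p f = p' f} -> {ae mu2, forall f, r f = r' f} -> isF h' p' r'.
Proof.
move=> [lh lp lr [h_ [ih sh sp sr]]] mh mp mr eh ep er.
have L q q' : isL2 mu2 q -> measurable_fun setT q' -> {ae mu2, forall x, q x = q' x} ->
    isL2 mu2 q'.
  by move=> lq mq e; split => //; rewrite -(ae_eq_L2n lq.1 mq e); exact: lq.2.
have S (T : nat -> R2 -> R) q q' : (forall n, isL2 mu2 (T n)) -> isL2 mu2 q ->
   measurable_fun setT q' -> {ae mu2, forall x, q x = q' x} ->
   small (fun n => L2n mu2 (T n \- q)) -> small (fun n => L2n mu2 (T n \- q')).
  move=> lT lq mq e; apply: small_le => n; rewrite le_eqVlt; apply/orP; left; apply/eqP.
  apply: ae_eq_L2n; [exact: measurable_funB (lT n).1 mq|exact: measurable_funB (lT n).1 lq.1|].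
  by apply: (ae_imp e) => x /= ->.
split; [exact: L lh mh eh|exact: L lp mp ep|exact: L lr mr er|].
exists h_; split => //.
- exact: S (fun n => (ih n).2) lh mh eh sh.
- exact: S (fun n => isL2_Fc (ih n).1 (ih n).2) lp mp ep sp.
- exact: S (fun n => isL2_Fs (ih n).1 (ih n).2) lr mr er sr.
Qed.

(** Truncations of [h] to growing squares lie in both L^1 and L^2, and by Plancherel's identity
    their transforms are at most as far apart as they are. *)
Lemma isF_exists h : isL2 mu2 h -> exists p r, isF h p r.
Proof.
move=> lh.
pose I n : set R := `[- n%:R, n%:R]%classic.
pose B n : set R2 := I n `*` I n.
have mI n : measurable (I n) by exact: measurable_itv.
have mB n : measurable (B n) by exact: measurableX.
have muI n : (@lebesgue_measure R (I n) < +oo)%E.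
  by rewrite /I lebesgue_measure_itv/=; case: ifP => _; rewrite ?ltry.
have muB n : (mu2 (B n) < +oo)%E.
  have -> : mu2 (B n) = (@lebesgue_measure R (I n) * @lebesgue_measure R (I n))%E.
    exact: (product_measure1E (@lebesgue_measure R) (@lebesgue_measure R) (mI n) (mI n)).
  by rewrite lte_mul_pinfty// ge0_fin_numE.
have l1 n : isL2 mu2 \1_(B n).
  split; first exact: (measurable_indic (mB n)).
  have -> : L2n mu2 \1_(B n) = (\int[mu2]_x (\1_(B n) x)%:E)%E.
    apply: eq_integral => x _; congr EFin.
    by rewrite /indic; case: (_ \in _); rewrite ?expr1n ?expr0n.
  by rewrite (integral_indic mu2 measurableT (mB n)) setIT; exact: muB.
have Bx x : \forall n \near \oo, B n x.
  near=> n; split => /=; rewrite /I/= in_itv/= -ler_norml; near: n; exact: nbhs_infty_ger.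
pose h_ n x := h x * \1_(B n) x.
have ih n : mu2.-integrable setT (EFin \o h_ n) by exact: isL2_integrableM lh (l1 n).
have lh_ n : isL2 mu2 (h_ n).
  apply: (isL2_le _ _ lh); first by apply: measurable_funM; [exact: lh.1|exact: (measurable_indic (mB n))].
  move=> x; rewrite /h_ /indic; case: (_ \in _); rewrite ?mulr1// mulr0 normr0//.
have sh : small (fun n => L2n mu2 (h_ n \- h)).
  apply: small_le (L2n_trunc lh mB Bx) => n; rewrite -L2nN le_eqVlt; apply/orP; left.
  by apply/eqP; apply: eq_L2n => x /=; rewrite opprB.
have dom m n : (L2n mu2 (Fc (h_ m) \- Fc (h_ n)) <= L2n mu2 (h_ m \- h_ n))%E /\
   (L2n mu2 (Fs (h_ m) \- Fs (h_ n)) <= L2n mu2 (h_ m \- h_ n))%E.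
  have id := integrableB measurableT (ih m) (ih n); have ld := isL2B (lh_ m) (lh_ n).
  have := plancherel_split (h := h_ m \- h_ n) id ld.
  have -> : Fc (h_ m \- h_ n) = Fc (h_ m) \- Fc (h_ n) by apply/funext => f; exact: FcE_B.
  have -> : Fs (h_ m \- h_ n) = Fs (h_ m) \- Fs (h_ n) by apply/funext => f; exact: FsE_B.
  by move=> <-; split; [rewrite leeDl ?L2n_ge0|rewrite leeDr ?L2n_ge0].
have [p lp sp] := L2_complete_dom (fun n => isL2_Fc (ih n) (lh_ n)) lh_ lh sh
  (fun m n => (dom m n).1).
have [r lr sr] := L2_complete_dom (fun n => isL2_Fs (ih n) (lh_ n)) lh_ lh sh
  (fun m n => (dom m n).2).
by exists p, r; split => //; exists h_; split.
Unshelve. all: by end_near. Qed.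

(** No diagonal sequence is needed: [h] has some transform (p', r'), Plancherel's identity forces
    [p_] and [r_] to converge to it, and limits in L^2 are unique almost everywhere. *)
Lemma isF_closed (h_ p_ r_ : nat -> R2 -> R) h p r :
  (forall n, isF (h_ n) (p_ n) (r_ n)) -> isL2 mu2 h -> isL2 mu2 p -> isL2 mu2 r ->
  small (fun n => L2n mu2 (h_ n \- h)) -> small (fun n => L2n mu2 (p_ n \- p)) ->
  small (fun n => L2n mu2 (r_ n \- r)) -> isF h p r.
Proof.
move=> F lh lp lr sh sp sr; have [p' [r' F']] := isF_exists lh.
have [_ lp' lr' _] := F'.
have D n : isF (h_ n \- h) (p_ n \- p') (r_ n \- r').
  have := isF_lin 1 (F n) F'; congr isF; by apply/funext => x; rewrite mul1r.
have N n : (L2n mu2 (p_ n \- p') <= L2n mu2 (h_ n \- h))%E /\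
    (L2n mu2 (r_ n \- r') <= L2n mu2 (h_ n \- h))%E.
  have [a b c _] := D n; rewrite -(fineK (isL2_fin a)) -(fineK (isL2_fin b)) -(fineK (isL2_fin c)).
  rewrite !lee_fin -(isF_norm (D n)); split; [rewrite lerDl|rewrite lerDr];
    by rewrite fine_ge0 ?L2n_ge0.
have mp n : measurable_fun setT (p_ n) by have [_ [? _] _ _] := F n.
have mr n : measurable_fun setT (r_ n) by have [_ _ [? _] _] := F n.
apply: (isF_ae F' lh.1 lp.1 lr.1).
- by apply: (ae_imp (P := fun=> True)); first exact: nearW.
- exact: (@small_ae_eq _ _ _ mu2 p_ p' p mp lp' lp (small_le (fun n => (N n).1) sh) sp).
- exact: (@small_ae_eq _ _ _ mu2 r_ r' r mr lr' lr (small_le (fun n => (N n).2) sh) sr).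
Qed.

End fourier_pairs.

(** * Parseval's identity and dilations *)

Section fourier_pair_operations.
Variable R : realType.
Local Notation mu2 := (leb2 R).
Local Notation R2 := (R * R)%type.
Implicit Types (h p r : R2 -> R) (f x : R2).

Lemma isF_scale (b : R) h p r : isF h p r ->
  isF (fun x => b * h x) (fun f => b * p f) (fun f => b * r f).
Proof.
move=> F; have := isF_lin (b + 1) F F.
by congr isF; apply/funext => x; rewrite mulrDl mul1r addrK.
Qed.

Lemma isF_comb (a b : R) h p r h' p' r' : isF h p r -> isF h' p' r' ->
  isF (fun x => a * h x + b * h' x) (fun f => a * p f + b * p' f) (fun f => a * r f + b * r' f).
Proof.
move=> F F'; have := isF_lin a F (isF_scale (- b) F').
by congr isF; apply/funext => x; rewrite mulNr opprK.
Qed.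

(** Polarization of [isF_norm]; p p' + r r' is the real part of one transform times the conjugate of
    the other. *)
Lemma parseval h p r h' p' r' : isF h p r -> isF h' p' r' ->
  \int[mu2]_x (h x * h' x) = \int[mu2]_f (p f * p' f) + \int[mu2]_f (r f * r' f).
Proof.
move=> F F'; have [lh lp lr _] := F; have [lh' lp' lr' _] := F'.
have ND := isF_norm (isF_comb 1 1 F F'); have NB := isF_norm (isF_comb 1 (-1) F F').
have e (q q' : R2 -> R) : (fun x => 1 * q x + 1 * q' x) = q \+ q' /\
    (fun x => 1 * q x + -1 * q' x) = q \- q'.
  by split; apply/funext => x; rewrite !mul1r// mulN1r.
rewrite !(e h h').1 !(e p p').1 !(e r r').1 in ND.
rewrite !(e h h').2 !(e p p').2 !(e r r').2 in NB.
have := RintegralM_polar lh lh'; have := RintegralM_polar lp lp'.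
by have := RintegralM_polar lr lr'; lra.
Qed.

Section dilation.
Variables (a : R) (b : R2).
Hypothesis a0 : 0 < a.

Definition dil x : R2 := (a * x.1 + b.1, a * x.2 + b.2).

(* The zero offsets make this an instance of [plane_jacobian]. *)
Definition undil f : R2 := (a^-1 * f.1 + 0, a^-1 * f.2 + 0).

(* The dual dilation multiplies [p - j r] by [a^-2] and by a phase due to [b];
   [dilre] and [dilim] are the two components of the result. *)
Definition dilre p r f : R :=
  a ^- 2 * (cos (ph (undil f) b) * p (undil f) + sin (ph (undil f) b) * r (undil f)).

Definition dilim p r f : R :=
  a ^- 2 * (cos (ph (undil f) b) * r (undil f) - sin (ph (undil f) b) * p (undil f)).

Let Jd : has_jacobian mu2 (a ^+ 2) dil := plane_jacobian b.1 b.2 a0.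

Let ai0 : 0 < a^-1.
Proof. by rewrite invr_gt0. Qed.

Let Ju : has_jacobian mu2 (a^-1 ^+ 2) undil := plane_jacobian 0 0 ai0.

Lemma ph_dil f x : ph f x = ph (undil f) (dil x) - ph (undil f) b.
Proof.
rewrite /ph/= !addr0; have an0 : a != 0 by rewrite gt_eqF.
have -> : f.1 * x.1 + f.2 * x.2 = a^-1 * a * (f.1 * x.1 + f.2 * x.2) by rewrite mulVf ?mul1r.
by ring.
Qed.

Lemma Fc_dil h f : mu2.-integrable setT (EFin \o h) ->
  Fc (h \o dil) f = dilre (Fc h) (Fs h) f.
Proof.
move=> ih; set g := undil f.
have ic := integrable_boundedM ih (measurable_cos_phr g) (fun x => bounded_cos _).
have isn := integrable_boundedM ih (measurable_sin_phr g) (fun x => bounded_sin _).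
pose F x := cos (ph g b) * (h x * cos (ph g x)) + sin (ph g b) * (h x * sin (ph g x)).
have iF : mu2.-integrable setT (EFin \o F).
  exact: (integrableD measurableT (integrableZl measurableT _ ic) (integrableZl measurableT _ isn)).
have := jacobian_Rintegral (exprn_gt0 2 a0) Jd iF => e.
have -> : Fc (h \o dil) f = \int[mu2]_x F (dil x).
  by apply: eq_Rintegral => x _; rewrite /F/= (ph_dil f x) cosB; ring.
rewrite /dilre -/g; apply: (mulfI (x := a ^+ 2)); first by rewrite gt_eqF// exprn_gt0.
rewrite e mulrA divff ?mul1r ?gt_eqF ?exprn_gt0// /F RintegralD//; last 2 first.
- exact: (integrableZl measurableT _ ic).
- exact: (integrableZl measurableT _ isn).
by rewrite !RintegralZl.
Qed.

Lemma Fs_dil h f : mu2.-integrable setT (EFin \o h) ->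
  Fs (h \o dil) f = dilim (Fc h) (Fs h) f.
Proof.
move=> ih; set g := undil f.
have ic := integrable_boundedM ih (measurable_cos_phr g) (fun x => bounded_cos _).
have isn := integrable_boundedM ih (measurable_sin_phr g) (fun x => bounded_sin _).
pose F x := cos (ph g b) * (h x * sin (ph g x)) - sin (ph g b) * (h x * cos (ph g x)).
have iF : mu2.-integrable setT (EFin \o F).
  exact: (integrableB measurableT (integrableZl measurableT _ isn) (integrableZl measurableT _ ic)).
have := jacobian_Rintegral (exprn_gt0 2 a0) Jd iF => e.
have -> : Fs (h \o dil) f = \int[mu2]_x F (dil x).
  by apply: eq_Rintegral => x _; rewrite /F/= (ph_dil f x) sinB; ring.
rewrite /dilim -/g; apply: (mulfI (x := a ^+ 2)); first by rewrite gt_eqF// exprn_gt0.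
rewrite e mulrA divff ?mul1r ?gt_eqF ?exprn_gt0// /F RintegralB//; last 2 first.
- exact: (integrableZl measurableT _ isn).
- exact: (integrableZl measurableT _ ic).
by rewrite !RintegralZl.
Qed.

Let mc : measurable_fun setT (fun f => cos (ph (undil f) b)).
Proof. by apply: (measurableT_comp (measurable_cos_phl b)); exact: Ju.1. Qed.

Let ms : measurable_fun setT (fun f => sin (ph (undil f) b)).
Proof. by apply: (measurableT_comp (measurable_sin_phl b)); exact: Ju.1. Qed.

Lemma trig_mul_L2 (k q : R2 -> R) : measurable_fun setT k -> (forall x, `|k x| <= 1) ->
  isL2 mu2 q -> isL2 mu2 (fun f => k f * q f) /\ (L2n mu2 (fun f => (k f * q f)%R) <= L2n mu2 q)%E.
Proof.
move=> mk k1 lq; have m : measurable_fun setT (fun f => k f * q f).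
  exact: measurable_funM mk lq.1.
have le x : `|k x * q x| <= `|q x| by rewrite normrM ler_piMl.
split; [exact: (@isL2_le _ _ _ mu2 _ _ m le lq)|exact: (L2n_le mu2 m lq.1 le)].
Qed.

(** One estimate for [dilre] and, with - sin as a multiplier, for [dilim]. Applied to differences it
    also gives the convergence of the transforms. *)
Lemma dil_comb_L2 (k k' q q' : R2 -> R) : measurable_fun setT k -> (forall x, `|k x| <= 1) ->
  measurable_fun setT k' -> (forall x, `|k' x| <= 1) -> isL2 mu2 q -> isL2 mu2 q' ->
  isL2 mu2 (fun f => a ^- 2 * (k f * q (undil f) + k' f * q' (undil f))) /\
  (L2n mu2 (fun f => (a ^- 2 * (k f * q (undil f) + k' f * q' (undil f)))%R)
   <= ((a ^- 2) ^+ 2)%:E * (2%:E * ((a ^+ 2)%:E * L2n mu2 q) + 2%:E * ((a ^+ 2)%:E * L2n mu2 q')))%E.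
Proof.
move=> mk k1 mk' k1' lq lq'.
have ai2 : 0 < a^-1 ^+ 2 by rewrite exprn_gt0.
have lu := jacobian_isL2 ai2 Ju lq; have lu' := jacobian_isL2 ai2 Ju lq'.
have [l n] := trig_mul_L2 mk k1 lu; have [l' n'] := trig_mul_L2 mk' k1' lu'.
have J (w : R2 -> R) : isL2 mu2 w -> L2n mu2 (w \o undil) = ((a ^+ 2)%:E * L2n mu2 w)%E.
  move=> lw; rewrite -(jacobian_L2n Ju lw.1) muleA -EFinM exprVn divff ?mul1e//.
  by rewrite gt_eqF// exprn_gt0.
split; first exact: isL2Z (isL2D l l').
rewrite L2nZ; last exact: measurable_funD l.1 l'.1.
rewrite lee_pmul2l//; last by rewrite lte_fin exprn_gt0// invr_gt0 exprn_gt0.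
apply: (le_trans (L2n_leD mu2 l.1 l'.1)).
by rewrite -!J//; apply: leeD; rewrite lee_pmul2l.
Qed.

Lemma isF_dil h p r : isF h p r -> isF (h \o dil) (dilre p r) (dilim p r).
Proof.
move=> [lh lp lr [h_ [ih sh sp sr]]].
have a2 : 0 < a ^+ 2 by rewrite exprn_gt0.
have kc f := bounded_cos (ph (undil f) b); have ks f := bounded_sin (ph (undil f) b).
have mns : measurable_fun setT (fun f => - sin (ph (undil f) b)) by exact: measurableT_comp ms.
have kns f : `|- sin (ph (undil f) b)| <= 1 by rewrite normrN.
have imE q q' f : dilim q q' f = a ^- 2 * (cos (ph (undil f) b) * q' (undil f) +
    - sin (ph (undil f) b) * q (undil f)) by rewrite /dilim mulNr.
have slim (u v : nat -> \bar R) : small u -> small v ->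
    small (fun n => ((a ^- 2) ^+ 2)%:E * (2%:E * ((a ^+ 2)%:E * u n) + 2%:E * ((a ^+ 2)%:E * v n)))%E.
  move=> su sv; apply: smallZ; first exact: sqr_ge0.
  by apply: smallD; apply: smallZ => //; apply: smallZ => //; exact: sqr_ge0.
have Ld (q : R2 -> R) : isL2 mu2 q -> isL2 mu2 (q \o dil).
  by move=> lq; exact (jacobian_isL2 a2 Jd lq).
split.
- exact: Ld lh.
- exact: (dil_comb_L2 mc kc ms ks lp lr).1.
- have -> : dilim p r = (fun f => a ^- 2 * (cos (ph (undil f) b) * r (undil f) +
      - sin (ph (undil f) b) * p (undil f))) by apply/funext => f; exact: imE.
  exact: (dil_comb_L2 mc kc mns kns lr lp).1.
exists (fun n => h_ n \o dil); split.
- move=> n; split; last exact: Ld (ih n).2.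
  exact: (jacobian_integrable a2 Jd (ih n).1).1.
- have := smallZ (ltW (_ : 0 < a ^- 2)) sh; rewrite invr_gt0 => /(_ a2).
  apply: small_le => n.
  have ld := isL2B (ih n).2 lh.
  rewrite -(jacobian_L2n Jd ld.1) muleA -EFinM mulVf ?mul1e// gt_eqF//.
- have := slim _ _ sp sr; apply: small_le => n.
  have lC := isL2B (isL2_Fc (ih n).1 (ih n).2) lp.
  have lS := isL2B (isL2_Fs (ih n).1 (ih n).2) lr.
  apply: le_trans (dil_comb_L2 mc kc ms ks lC lS).2; rewrite le_eqVlt; apply/orP; left; apply/eqP.
  by apply: eq_L2n => f /=; rewrite (Fc_dil f (ih n).1) /dilre; ring.
- have := slim _ _ sr sp; apply: small_le => n.
  have lC := isL2B (isL2_Fc (ih n).1 (ih n).2) lp.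
  have lS := isL2B (isL2_Fs (ih n).1 (ih n).2) lr.
  apply: le_trans (dil_comb_L2 mc kc mns kns lS lC).2; rewrite le_eqVlt; apply/orP; left; apply/eqP.
  by apply: eq_L2n => f /=; rewrite (Fs_dil f (ih n).1) /dilim; ring.
Qed.

End dilation.
End fourier_pair_operations.

(** * Link with the quaternion-valued transform *)

Section fourier_correspondence.
Variable R : realType.
Local Notation mu2 := (leb2 R).
Local Notation R2 := (R * R)%type.
Implicit Types (h p r : R2 -> R) (f x : R2) (H : R2 -> quat R).

Lemma fourierL1E h f : mu2.-integrable setT (EFin \o h) ->
  fourierL1 h f = Quat (Fc h f) 0 (- Fs h f) 0.
Proof.
move=> ih; rewrite /fourierL1 /qintegral; congr Quat.
- by apply: eq_Rintegral => x _; rewrite /= cosN /ph; ring.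
- by rewrite /Rintegral integral0_eq// => x _; congr EFin => /=; ring.
- rewrite -mulN1r /Fs -RintegralZl//.
    by apply: eq_Rintegral => x _; rewrite /= sinN /ph; ring.
  exact: (integrable_boundedM ih (measurable_sin_phr f) (fun x => bounded_sin _)).
- by rewrite /Rintegral integral0_eq// => x _; congr EFin => /=; ring.
Qed.

Lemma L2n_qnorm H : measurable_fun setT (fun f => q_re (H f)) ->
  measurable_fun setT (fun f => q_i (H f)) -> measurable_fun setT (fun f => q_j (H f)) ->
  measurable_fun setT (fun f => q_k (H f)) ->
  (L2n mu2 (@qnorm R \o H) = L2n mu2 (fun f => q_re (H f)) + L2n mu2 (fun f => q_i (H f))
    + L2n mu2 (fun f => q_j (H f)) + L2n mu2 (fun f => q_k (H f)))%E.
Proof.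
move=> mr mi mj mk; rewrite /L2n.
have g0 (q : R2 -> R) f : (0 <= (q f ^+ 2)%:E)%E by rewrite lee_fin sqr_ge0.
have m (q : R2 -> R) : measurable_fun setT q -> measurable_fun setT (EFin \o (fun f : R2 => q f ^+ 2)).
  exact: measurable_sqr.
have mri := emeasurable_funD (m _ mr) (m _ mi); have mrij := emeasurable_funD mri (m _ mj).
rewrite -(ge0_integralD mu2 measurableT _ (m _ mr) _ (m _ mi)); try by move=> x _; rewrite -?EFinD lee_fin ?addr_ge0 ?sqr_ge0.
rewrite -(ge0_integralD mu2 measurableT _ mri _ (m _ mj)); try by move=> x _; rewrite -?EFinD lee_fin ?addr_ge0 ?sqr_ge0.
rewrite -(ge0_integralD mu2 measurableT _ mrij _ (m _ mk)); try by move=> x _; rewrite -?EFinD lee_fin ?addr_ge0 ?sqr_ge0.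
apply: eq_integral => f _; rewrite /qnorm /= sqr_sqrtr ?EFinD//.
by rewrite !addr_ge0 ?sqr_ge0.
Qed.

(** The squared error splits into four components. Transforms of real integrable functions have no i
    and k components, so these two terms do not change along the sequence and must vanish. *)
Lemma is_fourier_isF h H : is_fourier h H ->
  [/\ isF h (fun f => q_re (H f)) (fun f => - q_j (H f)),
      {ae mu2, forall f, q_i (H f) = 0} & {ae mu2, forall f, q_k (H f) = 0}].
Proof.
move=> [/LfunP2 lh [/LfunP2 lr /LfunP2 li /LfunP2 lj /LfunP2 lk] [h_ [ih sh sF]]].
have ih1 n : mu2.-integrable setT (EFin \o h_ n) /\ isL2 mu2 (h_ n).
  by have [/Lfun1_integrable ? /LfunP2 ?] := ih n.
have sh' := (small_Lnorm mu2 (fun n => h_ n \- h)).2 sh.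
have sF' := (small_Lnorm mu2 (fun n => @qnorm R \o (fourierL1 (h_ n) \- H))).2 sF.
have E n : (L2n mu2 (@qnorm R \o (fourierL1 (h_ n) \- H)%R) =
   L2n mu2 (Fc (h_ n) \- (fun f => q_re (H f))) + L2n mu2 (fun f => q_i (H f)) +
   L2n mu2 (Fs (h_ n) \- (fun f => (- q_j (H f))%R)) + L2n mu2 (fun f => q_k (H f)))%E.
  have e f : (fourierL1 (h_ n) \- H) f = Quat (Fc (h_ n) f - q_re (H f)) (- q_i (H f))
     (- (Fs (h_ n) f - - q_j (H f))) (- q_k (H f)).
    rewrite /= fourierL1E; last exact: (ih1 n).1.
    by congr Quat => /=; ring.
  have -> : fourierL1 (h_ n) \- H = (fun f => Quat (Fc (h_ n) f - q_re (H f)) (- q_i (H f))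
     (- (Fs (h_ n) f - - q_j (H f))) (- q_k (H f))) by apply/funext => f; exact: e.
  have mc := measurable_Fc (ih1 n).2.1; have ms := measurable_Fs (ih1 n).2.1.
  rewrite L2n_qnorm/=; last 4 first.
  - exact: measurable_funB mc lr.1.
  - exact: measurableT_comp li.1.
  - apply: measurableT_comp => //; apply: measurable_funB ms _; exact: measurableT_comp lj.1.
  - exact: measurableT_comp lk.1.
  congr (_ + _ + _ + _)%E.
  - exact: (L2nN mu2 (fun f => q_i (H f))).
  - exact: (L2nN mu2 (Fs (h_ n) \- (fun f => (- q_j (H f))%R))).
  - exact: (L2nN mu2 (fun f => q_k (H f))).
have z q : isL2 mu2 q -> (L2n mu2 q <= 0)%E -> {ae mu2, forall f, q f = 0}.
  by move=> lq q0; apply: (L2n_eq0 lq.1); apply/eqP; rewrite eq_le q0 L2n_ge0.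
have bound (A B C D : \bar R) : (0 <= A -> 0 <= B -> 0 <= C -> 0 <= D ->
    [/\ A <= A + B + C + D, B <= A + B + C + D, C <= A + B + C + D & D <= A + B + C + D])%E.
  move=> A0 B0 C0 D0; split.
  - by rewrite -!addeA leeDl// !adde_ge0.
  - by rewrite (addeC A) -!addeA leeDl// !adde_ge0.
  - by rewrite (addeC _ C) -!addeA leeDl// !adde_ge0.
  - by rewrite leeDr// !adde_ge0.
have le4 n := bound _ _ _ _ (L2n_ge0 mu2 (Fc (h_ n) \- (fun f => q_re (H f))))
  (L2n_ge0 mu2 (fun f => q_i (H f))) (L2n_ge0 mu2 (Fs (h_ n) \- (fun f => (- q_j (H f))%R)))
  (L2n_ge0 mu2 (fun f => q_k (H f))).
split.
- split => //; first exact: isL2N lj.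
  exists h_; split => //.
  + by apply: small_le sF' => n; rewrite E; have [] := le4 n.
  + by apply: small_le sF' => n; rewrite E; have [] := le4 n.
- by apply: (z _ li); apply: (small_le_cst sF') => n; rewrite E; have [] := le4 n.
- by apply: (z _ lk); apply: (small_le_cst sF') => n; rewrite E; have [] := le4 n.
Qed.

Lemma isF_is_fourier h p r : isF h p r ->
  is_fourier h (fun f => Quat (p f) 0 (- r f) 0).
Proof.
move=> [lh lp lr [h_ [ih sh sp sr]]]; have l0 := isL20 mu2.
split; [exact/LfunP2|split; apply/LfunP2 => //=; exact: isL2N lr|exists h_; split].
- by move=> n; have [? ?] := ih n; split; [exact/Lfun1_integrable|exact/LfunP2].
- exact: ((small_Lnorm mu2 (fun n => h_ n \- h)).1 sh).
- apply: ((small_Lnorm mu2 (fun n => @qnorm R \o (fourierL1 (h_ n) \-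
    (fun f => Quat (p f) 0 (- r f) 0)))).1 _).
  apply: small_le (smallD sp sr) => n.
  have -> : fourierL1 (h_ n) \- (fun f => Quat (p f) 0 (- r f) 0) =
     (fun f => Quat (Fc (h_ n) f - p f) 0 (- (Fs (h_ n) f - r f)) 0).
    apply/funext => f; rewrite /= fourierL1E; last exact: (ih n).1.
    by congr Quat => /=; ring.
  have mc := measurable_Fc (ih n).2.1; have ms := measurable_Fs (ih n).2.1.
  rewrite L2n_qnorm//=; last 2 first.
  - exact: measurable_funB mc lp.1.
  - by apply: measurableT_comp => //; exact: measurable_funB ms lr.1.
  have -> : L2n mu2 (fun=> 0 : R) = 0%E by rewrite /L2n expr0n integral0.
  rewrite !adde0 le_eqVlt; apply/orP; left; apply/eqP; congr (_ + _)%E.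
  exact: (L2nN mu2 (Fs (h_ n) \- r)).
Qed.

(** The existence of a transform rules out the default value of [fourier]. *)
Lemma fourier_isF h : isL2 mu2 h ->
  [/\ isF h (fun f => q_re (fourier h f)) (fun f => - q_j (fourier h f)),
      {ae mu2, forall f, q_i (fourier h f) = 0} & {ae mu2, forall f, q_k (fourier h f) = 0}].
Proof.
move=> lh; apply: is_fourier_isF; have [p [r F]] := isF_exists lh.
by apply: (@xgetPex _ (fun=> 0) [set H | is_fourier h H]); exists (fun f => Quat (p f) 0 (- r f) 0); exact: isF_is_fourier.
Qed.

End fourier_correspondence.

(** * Hilbert transforms *)

Section multipliers.
Variable R : realType.
Local Notation mu2 := (leb2 R).
Local Notation R2 := (R * R)%type.
Implicit Types (h p r : R2 -> R) (f : R2) (s : R2 -> R).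

(** Allows a formula proved for one representative of the transform of [h] to be restated for any
    other. *)
Lemma isF_unique_ae h p r p' r' : isF h p r -> isF h p' r' ->
  forall q w q' w' v, (forall f, p f = p' f -> r f = r' f -> q f = q' f /\ w f = w' f) ->
  measurable_fun setT q' -> measurable_fun setT w' -> isF v q w -> isF v q' w'.
Proof.
move=> F F' q w q' w' v H mq mw Fv; have [e1 e2] := isF_unique F F'.
apply: (isF_ae Fv _ mq mw).
- by have [[]] := Fv.
- by apply: (ae_imp (P := fun=> True)); first exact: nearW.
- by apply: (ae_imp2 e1 e2) => f a b; exact: (H f a b).1.
- by apply: (ae_imp2 e1 e2) => f a b; exact: (H f a b).2.
Qed.

(* A family [e x i] of L^2 functions on which multipliers act through [x]. *)
Variables (X I : Type) (e : X -> I -> R2 -> R) (u : R2).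
Hypothesis eL2 : forall x i, isL2 mu2 (e x i).
Hypothesis elin : forall (a b : R) x y, exists z, forall i,
  e z i = (fun t => a * e x i t + b * e y i t).
Hypothesis eshift : forall (t : R) x, exists z, forall i,
  e z i = e x i \o shift2 (t * u.1, t * u.2).
Hypothesis ecomplete : forall y_ : nat -> X,
  (forall i (c : R), 0 < c -> exists N, forall m n, (N <= m)%N -> (N <= n)%N ->
     (L2n mu2 (e (y_ m) i \- e (y_ n) i) < c%:E)%E) ->
  exists y, forall i, small (fun n => L2n mu2 (e (y_ n) i \- e y i)).

(* The multiplier [- j s] maps [p - j r] to [- s r - j s p]. *)
Definition is_mult s := [/\ measurable_fun setT s, forall f, `|s f| <= 1 &
  forall x, exists y, forall i p r, isF (e x i) p r ->
    isF (e y i) (fun f => - (s f * r f)) (fun f => s f * p f)].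

Definition frq f : R := f.1 * u.1 + f.2 * u.2.

Lemma measurable_frq : measurable_fun setT frq.
Proof. by apply: measurable_funD; apply: measurable_funM. Qed.

(** Half the difference of two opposite translates: (exp (- j T) - exp (j T)) / 2 = - j sin T, with
    T = 2 pi t (f.u). *)
Lemma mult_sin (t : R) : is_mult (fun f => sin (2 * pi * t * frq f)).
Proof.
have shE (b : R2) : shift2 b = dil 1 b by apply/funext => x; rewrite /dil !mul1r.
split.
- by apply: (measurableT_comp (@measurable_sin R)); apply: measurable_funM => //; exact: measurable_frq.
- by move=> f; exact: bounded_sin.
move=> x; have [y1 E1] := eshift (- t) x; have [y2 E2] := eshift t x.
have [z Ez] := elin (1 / 2) (- (1 / 2)) y1 y2.
exists z => i p r F; rewrite Ez E1 E2 !shE.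
have := isF_comb (1 / 2) (- (1 / 2)) (isF_dil (- t * u.1, - t * u.2) ltr01 F)
   (isF_dil (t * u.1, t * u.2) ltr01 F).
have P1 f (c : R) : ph (undil 1 f) (c * u.1, c * u.2) = c * (2 * pi * frq f).
  by rewrite /ph /undil /frq /= invr1 !mul1r !addr0; ring.
have P2 f : undil 1 f = f by rewrite /undil invr1 !mul1r !addr0 -surjective_pairing.
congr isF; apply/funext => f; rewrite ?/dilre ?/dilim !P1 !P2 !mulNr cosN sinN expr1n invr1;
  rewrite (_ : 2 * pi * t * frq f = t * (2 * pi * frq f)); by [field|ring].
Qed.

(** Products of an even number of multipliers - j s are real, so only odd polynomials in [s] remain
    available. Since (- j s)^3 = j s^3, the third iterate enters with coefficient + 1/2. This cubic
    fixes 0, 1 and -1, preserves [-1, 1], and has zero derivative at 1 and -1. *)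
Lemma mult_odd_cubic s : is_mult s -> is_mult (fun f => (3 * s f - s f ^+ 3) / 2).
Proof.
move=> [ms s1 H]; split.
- apply: measurable_funM => //; apply: measurable_funB; first exact: measurable_funM.
  exact: measurable_funX.
- move=> f; have := s1 f; rewrite !ler_norml; set y := s f => /andP[y1 y2].
  have -> : (3 * y - y ^+ 3) / 2 = 1 - (1 - y) ^+ 2 * (2 + y) / 2 by field.
  have h1 : 0 <= (1 - y) ^+ 2 * (2 + y) by rewrite mulr_ge0 ?sqr_ge0//; lra.
  have h2 : 0 <= (1 + y) ^+ 2 * (2 - y) by rewrite mulr_ge0 ?sqr_ge0//; lra.
  have h3 : (1 + y) ^+ 2 * (2 - y) + (1 - y) ^+ 2 * (2 + y) = 4 by ring.
  by apply/andP; split; lra.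
move=> x; have [y1 H1] := H x; have [y2 H2] := H y1; have [y3 H3] := H y2.
have [z Ez] := elin (3 / 2) (1 / 2) y1 y3.
exists z => i p r F; rewrite Ez.
have F1 := H1 i _ _ F; have F3 := H3 i _ _ (H2 i _ _ F1).
have := isF_comb (3 / 2) (1 / 2) F1 F3.
by congr isF; apply/funext => f; field.
Qed.

(** On the frequency side, bounded pointwise convergence is convergence in L^2 by domination.
    Plancherel's identity makes the images Cauchy for every index, and the completeness of the
    family supplies one limit for all indices. *)
Lemma mult_lim (s_ : nat -> R2 -> R) s : (forall n, is_mult (s_ n)) ->
  (forall f, s_ n f @[n --> \oo] --> s f) -> is_mult s.
Proof.
move=> M_ sc.
have ms_ n : measurable_fun setT (s_ n) by have [] := M_ n.
have s1_ n f : `|s_ n f| <= 1 by have [] := M_ n.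
have ms : measurable_fun setT s by apply: (measurable_fun_cvg (h := s_)) => // f _; exact: sc.
have s1 f : `|s f| <= 1.
  have h : `|s_ n f| @[n --> \oo] --> `|s f| by apply: cvg_norm; exact: sc.
  rewrite -(cvg_lim (@Rhausdorff R) h).
  by apply: limr_le; [apply/cvg_ex; eexists; exact: h|exact: nearW].
split => // x.
have [y_ Hy] : {y_ : nat -> X & forall n i p r, isF (e x i) p r ->
    isF (e (y_ n) i) (fun f => - (s_ n f * r f)) (fun f => s_ n f * p f)}.
  by apply: (@choice _ _ (fun n y => forall i p r, isF (e x i) p r ->
    isF (e y i) (fun f => - (s_ n f * r f)) (fun f => s_ n f * p f))) => n; have [_ _ /(_ x)] := M_ n.
have mul_lim q : isL2 mu2 q -> isL2 mu2 (fun f => s f * q f) /\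
    small (fun n => L2n mu2 ((fun f => s_ n f * q f) \- (fun f => s f * q f))).
  move=> lq; split; first exact: (trig_mul_L2 ms s1 lq).1.
  apply: (@L2n_dominated _ _ _ mu2 _ (fun f => 2 * q f)).
  - move=> n; apply: measurable_funB.
      exact: (measurable_funM (ms_ n) lq.1).
    exact: (measurable_funM ms lq.1).
  - exact: isL2Z lq.
  - move=> n f; rewrite /= -mulrBl !normrM ler_wpM2r// (le_trans (ler_normB _ _))//.
    by rewrite ger0_norm//; have := s1 f; have := s1_ n f; lra.
  - move=> f; rewrite /= -(subrr (s f * q f)); apply: cvgB; last exact: cvg_cst.
    by apply: cvgM; [exact: sc|exact: cvg_cst].
have [|y Hlim] := ecomplete (y_ := y_).
  move=> i c c0; have [p [r F]] := isF_exists (eL2 x i); have [_ lp lr _] := F.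
  have [_ sp] := mul_lim p lp; have [_ sr] := mul_lim r lr.
  (* Each of the two components then contributes less than 2 (c/8) + 2 (c/8) = c/2. *)
  have c8 : 0 < c / 8 by rewrite divr_gt0.
  have [N1 _ HN1] := sp _ c8; have [N2 _ HN2] := sr _ c8.
  exists (maxn N1 N2) => m n; rewrite !geq_max => /andP[m1 m2] /andP[n1 n2].
  have D := isF_comb 1 (-1) (Hy m i _ _ F) (Hy n i _ _ F).
  have cauchy (q : R2 -> R) : isL2 mu2 q ->
      (L2n mu2 ((fun f => (s_ m f * q f)%R) \- (fun f => (s f * q f)%R)) < (c / 8)%:E)%E ->
      (L2n mu2 ((fun f => (s_ n f * q f)%R) \- (fun f => (s f * q f)%R)) < (c / 8)%:E)%E ->
      (L2n mu2 (fun f => (s_ m f * q f - s_ n f * q f)%R) < (c / 2)%:E)%E.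
    move=> lq hm hn.
    have l0 := (mul_lim q lq).1; have lsm := (trig_mul_L2 (ms_ m) (s1_ m) lq).1.
    have lsn := (trig_mul_L2 (ms_ n) (s1_ n) lq).1.
    have -> : (fun f => s_ m f * q f - s_ n f * q f) =
       ((fun f => s_ m f * q f) \- (fun f => s f * q f)) \- ((fun f => s_ n f * q f) \- (fun f => s f * q f)).
      by apply/funext => f /=; ring.
    have d1 := isL2B lsm l0; have d2 := isL2B lsn l0.
    apply: (le_lt_trans (L2n_leB mu2 d1.1 d2.1)); move: hm hn.
    rewrite -(fineK (isL2_fin d1)) -(fineK (isL2_fin d2)).
    by rewrite -?EFinM -?EFinD !lte_fin; lra.
  have cp := cauchy p lp (HN1 m m1) (HN1 n n1); have cr := cauchy r lr (HN2 m m2) (HN2 n n2).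
  have e1 : L2n mu2 (fun f => 1 * - (s_ m f * r f) + -1 * - (s_ n f * r f)) =
     L2n mu2 (fun f => s_ m f * r f - s_ n f * r f).
    by rewrite -L2nN; apply: eq_L2n => f /=; ring.
  have e2 : L2n mu2 (fun f => 1 * (s_ m f * p f) + -1 * (s_ n f * p f)) =
     L2n mu2 (fun f => s_ m f * p f - s_ n f * p f).
    by apply: eq_L2n => f /=; ring.
  have e3 : L2n mu2 (fun t => 1 * e (y_ m) i t + -1 * e (y_ n) i t) =
     L2n mu2 (e (y_ m) i \- e (y_ n) i).
    by apply: eq_L2n => f /=; ring.
  have := isF_norm D; rewrite e1 e2 e3 => hD.
  have fin A : (A < (c / 2)%:E)%E -> (0 <= A)%E -> A = (fine A)%:E.
    by move=> Ac A0; rewrite fineK// ge0_fin_numE// (lt_trans Ac)// ltry.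
  have cp' := fin _ cp (L2n_ge0 _ _); have cr' := fin _ cr (L2n_ge0 _ _).
  move: cp cr; rewrite cp' cr'.
  rewrite -(fineK (isL2_fin (isL2B (eL2 (y_ m) i) (eL2 (y_ n) i)))) -hD.
  by rewrite !lte_fin; lra.
exists y => i p r F; have [p0 [r0 F0]] := isF_exists (eL2 x i).
have [_ lp lr _] := F0; have [lsp sp] := mul_lim p0 lp; have [lsr sr] := mul_lim r0 lr.
have Fl : isF (e y i) (fun f => - (s f * r0 f)) (fun f => s f * p0 f).
  apply: (isF_closed (fun n => Hy n i _ _ F0) (eL2 y i) _ lsp (Hlim i) _ sp).
  - exact: isL2N lsr.
  - apply: small_le sr => n; rewrite -L2nN le_eqVlt; apply/orP; left; apply/eqP.
    by apply: eq_L2n => f /=; ring.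
have [_ [mp _] [mr _] _] := F.
apply: (isF_unique_ae F0 F _ _ _ Fl).
- by move=> f /= -> ->.
- by apply: measurableT_comp => //; exact: measurable_funM.
- exact: measurable_funM.
Qed.

Lemma odd_cubic_iter_cvg (y : R) : `|y| <= 1 ->
  iter n (fun z => (3 * z - z ^+ 3) / 2) y @[n --> \oo] --> Num.sg y.
Proof.
pose q (z : R) := (3 * z - z ^+ 3) / 2.
have pos (w : R) : 0 < w -> w <= 1 -> iter n q w @[n --> \oo] --> (1 : R).
  move=> w0 w1.
  (* The distance to 1 is multiplied by 1 - (v + v^2) / 2 at each step; the lower bound [w] on the
     iterates keeps this factor below 1 - w / 2, a fixed geometric rate. *)
  have H n : w <= iter n q w <= 1 /\ 1 - iter n q w <= (1 - w / 2) ^+ n.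
    elim: n => [|n [/andP[IH1 IH2] IH3]] /=; first by rewrite lexx w1 expr0; split => //; lra.
    set v := iter n q w in IH1 IH2 IH3 *.
    have e1 : 1 - q v = (1 - v) * (1 - (v + v ^+ 2) / 2) by rewrite /q; field.
    have v0 : 0 < v by apply: lt_le_trans IH1.
    have v2 : v ^+ 2 <= 1 by rewrite expr_le1// ltW.
    have v2' : 0 <= v ^+ 2 by exact: sqr_ge0.
    have c1 : 0 <= 1 - (v + v ^+ 2) / 2 <= 1 - w / 2 by apply/andP; split; lra.
    case/andP: c1 => c1 c2.
    have v1 : 0 <= 1 - v by lra.
    have m1 : 0 <= (1 - v) * (1 - (v + v ^+ 2) / 2) by rewrite mulr_ge0.
    have m2 : (1 - v) * (1 - (v + v ^+ 2) / 2) <= 1 - v by rewrite ler_piMr//; lra.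
    split; first by apply/andP; split; lra.
    by rewrite e1 [leRHS]exprSr ler_pM.
  apply: (@squeeze_cvgr _ _ _ _ (fun n => 1 - (1 - w / 2) ^+ n) (fun=> 1)).
  - by apply: nearW => n; have [/andP[a b] c] := H n; apply/andP; split; lra.
  - rewrite -[X in _ --> X]subr0; apply: cvgB; first exact: cvg_cst.
    by apply: cvg_expr; rewrite ger0_norm; lra.
  - exact: cvg_cst.
have odd (w : R) n : iter n q (- w) = - iter n q w.
  by elim: n => //= n ->; rewrite /q; field.
move=> y1; have [y0|y0|->] := ltrgtP y 0.
- rewrite ltr0_sg//; rewrite -(opprK y); under eq_fun do rewrite odd.
  by apply: cvgN; apply: pos; [rewrite oppr_gt0|rewrite -(ltr0_norm y0)].
- by rewrite gtr0_sg//; apply: pos => //; rewrite -(gtr0_norm y0).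
- rewrite sgr0 (_ : (fun n => _) = (fun=> 0)); first exact: cvg_cst.
  by apply/funext; elim => //= n ->; rewrite expr0n/=; field.
Qed.

(** The iteration turns the sine into a square wave in the frequency. Its half-period grows as t = 1
    / (n + 1) decreases, and once it exceeds a given frequency the square wave has there the sign of
    that frequency. *)
Lemma mult_sgn : is_mult (fun f => Num.sg (frq f)).
Proof.
have M1 (t : R) : is_mult (fun f => Num.sg (sin (2 * pi * t * frq f))).
  apply: (@mult_lim (fun n f => iter n (fun z => (3 * z - z ^+ 3) / 2) (sin (2 * pi * t * frq f)))).
    by elim=> [|n IH] /=; [exact: mult_sin|exact: mult_odd_cubic].
  by move=> f; apply: odd_cubic_iter_cvg; exact: bounded_sin.
apply: (@mult_lim (fun n f => Num.sg (sin (2 * pi * n.+1%:R^-1 * frq f)))) => // f.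
apply: cvg_near_cst.
have p0 := pi_gt0 R.
near=> n; set t := n.+1%:R^-1.
have t0 : 0 < t :> R by rewrite invr_gt0.
have small : `|2 * frq f| < n.+1%:R.
  apply: (@lt_trans _ _ n%:R); last by rewrite ltr_nat.
  by near: n; exact: nbhs_infty_gtr.
have lt1 : `|2 * t * frq f| < 1.
  by rewrite mulrAC normrM (gtr0_norm t0) /t ltr_pdivrMr// mul1r.
have bnd : `|2 * pi * t * frq f| < pi.
  rewrite (_ : 2 * pi * t * frq f = pi * (2 * t * frq f)); last by ring.
  by rewrite normrM gtr0_norm// gtr_pMr.
have [f0|f0|->] := ltrgtP (frq f) 0; last by rewrite mulr0 sin0.
- rewrite [RHS]ltr0_sg// ltr0_sg//; rewrite -(opprK (_ * frq f)) sinN oppr_lt0.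
  apply: sin_gt0_pi; rewrite -mulrN !mulr_gt0 ?oppr_gt0//=.
  by apply: le_lt_trans bnd; rewrite mulrN -normrN ler_norm.
- rewrite [RHS]gtr0_sg// gtr0_sg//; apply: sin_gt0_pi; rewrite !mulr_gt0//=.
  by apply: le_lt_trans bnd; rewrite ler_norm.
Unshelve. all: by end_near. Qed.

End multipliers.

(** * Existence of Hilbert transforms and their action on tensor products *)

Section hilbert_existence.
Variable R : realType.
Local Notation lambda := (@lebesgue_measure R).
Local Notation mu2 := (leb2 R).
Local Notation R2 := (R * R)%type.
Implicit Types (h p r v : R2 -> R) (f u : R2).

Lemma shift_isL2 u h : isL2 mu2 h -> isL2 mu2 (h \o shift2 u).
Proof. by move=> lh; exact (jacobian_isL2 ltr01 (shift_jacobian u) lh). Qed.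

(** The family is all of L^2, with a one-point index. *)
Lemma hilbert_mult_exists u h : isL2 mu2 h -> exists v, forall p r, isF h p r ->
  isF v (fun f => - (Num.sg (frq u f) * r f)) (fun f => Num.sg (frq u f) * p f).
Proof.
move=> lh; pose X := {w : R2 -> R | isL2 mu2 w}.
pose e (x : X) (_ : unit) : R2 -> R := sval x.
have eL2 x i : isL2 mu2 (e x i) by exact: (svalP x).
have [|||_ _ H] := @mult_sgn R X unit e u eL2.
- move=> a b x y; exists (exist _ _ (isL2D (isL2Z a (svalP x)) (isL2Z b (svalP y)))) => i.
  by apply/funext.
- move=> t x; exists (exist _ _ (shift_isL2 (t * u.1, t * u.2) (svalP x))) => i.
  by apply/funext.
- move=> y_ cy; have [v lv sv] := L2_complete (fun n => eL2 (y_ n) tt) (cy tt).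
  by exists (exist _ v lv) => -[].
- by have [[v lv] Hv] := H (exist _ h lh); exists v => p r; exact: Hv tt p r.
Qed.

Definition tensor (a b : R -> R) : R2 -> R := fun x => a x.1 * b x.2.

Lemma measurable_tensor (a b : R -> R) : measurable_fun setT a -> measurable_fun setT b ->
  measurable_fun setT (tensor a b).
Proof. by move=> ma mb; apply: measurable_funM; exact: measurableT_comp. Qed.

Lemma L2n_tensor (a b : R -> R) : measurable_fun setT a -> measurable_fun setT b ->
  L2n mu2 (tensor a b) = (L2n lambda a * L2n lambda b)%E.
Proof.
move=> ma mb; have mt := measurable_tensor ma mb.
rewrite /L2n (fubini_tonelli1 (m1 := lambda) (m2 := lambda))/=; last 2 first.
- exact: measurable_sqr mt.
- by move=> x; rewrite lee_fin sqr_ge0.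
rewrite -ge0_integralZr//; last 3 first.
- exact: (measurable_sqr ma).
- by move=> x _; rewrite lee_fin sqr_ge0.
- by apply: integral_ge0 => x _; rewrite lee_fin sqr_ge0.
apply: eq_integral => x _; rewrite /fubini_F/= -ge0_integralZl_EFin//; last 3 first.
- by move=> y _; rewrite lee_fin sqr_ge0.
- exact: (measurable_sqr mb).
- exact: sqr_ge0.
by apply: eq_integral => y _; rewrite /tensor/= exprMn EFinM.
Qed.

Lemma isL2_tensor (a b : R -> R) : isL2 lambda a -> isL2 lambda b -> isL2 mu2 (tensor a b).
Proof.
move=> la lb; split; first exact: measurable_tensor la.1 lb.1.
by rewrite (L2n_tensor la.1 lb.1) -(fineK (isL2_fin la)) -(fineK (isL2_fin lb)) ltry.
Qed.

Lemma isL2_unit_indic : isL2 lambda \1_`[0, 1]%classic /\ L2n lambda \1_`[0, 1]%classic = 1%E.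
Proof.
have mI : measurable (`[0, 1]%classic : set R) by exact: measurable_itv.
have n1 : L2n lambda \1_`[0, 1]%classic = 1%E.
  have -> : L2n lambda \1_`[0, 1]%classic = (\int[lambda]_x (\1_`[0, 1]%classic x)%:E)%E.
    apply: eq_integral => x _; congr EFin.
    by rewrite /indic; case: (_ \in _); rewrite ?expr1n ?expr0n.
  have -> : 1%E = lambda (`[0, 1]%classic : set R).
    by rewrite lebesgue_measure_itv/= lte_fin ltr01 -EFinB subr0.
  by rewrite (integral_indic lambda measurableT mI) setIT.
by split => //; split; [exact: (measurable_indic mI)|rewrite n1 ltry].
Qed.

Lemma line_shift_isL2 (t : R) (a : R -> R) : isL2 lambda a -> isL2 lambda (a \o (fun x => 1 * x + t)).
Proof. by move=> la; exact (jacobian_isL2 ltr01 (line_jacobian t ltr01) la). Qed.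

(** Testing against the indicator of [0, 1], of norm 1, gives back the norm of the first argument of
    [e]; the limit found there serves every other [b], since the norm of a tensor product is a
    product. *)
Lemma tensor_complete (a_ : nat -> R -> R) (flip : bool) :
  let e (a b : R -> R) := if flip then tensor b a else tensor a b in
  (forall n, isL2 lambda (a_ n)) ->
  (forall b, isL2 lambda b -> forall c : R, 0 < c -> exists N, forall m n, (N <= m)%N -> (N <= n)%N ->
     (L2n mu2 (e (a_ m) b \- e (a_ n) b) < c%:E)%E) ->
  exists2 a, isL2 lambda a & forall b, isL2 lambda b -> small (fun n => L2n mu2 (e (a_ n) b \- e a b)).
Proof.
move=> e la_ ca; have [l1 n1] := isL2_unit_indic.
have eB a a' b : e a b \- e a' b = e (a \- a') b.
  by rewrite /e /tensor; case: (flip); apply/funext => x /=; ring.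
have eN a b : isL2 lambda a -> isL2 lambda b -> L2n mu2 (e a b) = (L2n lambda a * L2n lambda b)%E.
  by move=> la lb; rewrite /e; case: (flip);
    [rewrite (L2n_tensor lb.1 la.1) muleC|rewrite (L2n_tensor la.1 lb.1)].
have [|a la sa] := L2_complete la_.
  move=> c c0; have [N HN] := ca _ l1 c c0; exists N => m n Nm Nn.
  by have := HN m n Nm Nn; rewrite eB eN ?n1 ?mule1//; exact: isL2B.
exists a => // b lb.
have := smallZ (fine_ge0 (L2n_ge0 lambda b)) sa; apply: small_le => n.
rewrite eB (eN _ _ (isL2B (la_ n) la) lb) (fineK (isL2_fin lb)) muleC; exact: lexx.
Qed.

(* The multiplier acts on one factor, uniformly in the other one: [flip] says
   which factor it is. *)
Lemma tensor_mult_exists (flip : bool) (a : R -> R) :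
  let e (a b : R -> R) := if flip then tensor b a else tensor a b in
  let u : R2 := if flip then (0, 1) else (1, 0) in
  isL2 lambda a -> exists2 w, isL2 lambda w & forall b p r, isL2 lambda b ->
    isF (e a b) p r ->
    isF (e w b) (fun f => - (Num.sg (frq u f) * r f)) (fun f => Num.sg (frq u f) * p f).
Proof.
move=> e u la; pose X := {w : R -> R | isL2 lambda w}.
(* The multiplier acts on [x]; the index [y] is the free factor. *)
pose E (x y : X) : R2 -> R := e (sval x) (sval y).
have EL2 x i : isL2 mu2 (E x i).
  by rewrite /E /e; case: (flip); apply: isL2_tensor; exact: svalP.
have [|||_ _ H] := @mult_sgn R X X E u EL2.
- move=> c d x y; exists (exist _ _ (isL2D (isL2Z c (svalP x)) (isL2Z d (svalP y)))) => i.
  by rewrite /E /e /tensor; case: (flip); apply/funext => z /=; ring.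
- move=> t x; exists (exist _ _ (line_shift_isL2 t (svalP x))) => i.
  rewrite /E /e /u /tensor; case: (flip); apply/funext => z /=;
    by rewrite mul1r mulr1 mulr0 addr0.
- move=> y_ cy; have [|w lw sw] := @tensor_complete (fun n => sval (y_ n)) flip (fun n => svalP (y_ n)).
    by move=> b lb c c0; exact: cy (exist _ b lb) c c0.
  by exists (exist _ w lw) => i; exact: sw (sval i) (svalP i).
- have [[w lw] Hw] := H (exist _ a la); exists w => // b p r lb F.
  exact: Hw (exist _ b lb) p r F.
Qed.

Lemma isF_inj v p r v' p' r' : isF v p r -> isF v' p' r' ->
  {ae mu2, forall f, p f = p' f} -> {ae mu2, forall f, r f = r' f} ->
  {ae mu2, forall x, v x = v' x}.
Proof.
move=> F F' ep er; have D := isF_lin 1 F F'; have [ld lp lr _] := D.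
have := isF_norm D.
have z (q q' : R2 -> R) : isL2 mu2 (fun x => 1 * q x - q' x) -> {ae mu2, forall f, q f = q' f} ->
    L2n mu2 (fun x => 1 * q x - q' x) = 0%E.
  move=> lq eq; have -> : L2n mu2 (fun x => 1 * q x - q' x) = L2n mu2 (fun=> 0).
    apply: ae_eq_L2n; [exact: lq.1|exact: measurable_cst|].
    by apply: (ae_imp eq) => f /= ->; rewrite mul1r subrr.
  by rewrite /L2n expr0n integral0.
rewrite (z _ _ lp ep) (z _ _ lr er) /= addr0 => /esym h.
have h0 : L2n mu2 (fun x => 1 * v x - v' x) = 0%E by rewrite -(fineK (isL2_fin ld)) h.
by apply: (ae_imp (L2n_eq0 ld.1 h0)) => x /eqP; rewrite mul1r subr_eq0 => /eqP.
Qed.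

Lemma measurable_sg : measurable_fun setT (@Num.sg R).
Proof.
have -> : @Num.sg R = \1_`]0, +oo[%classic \- \1_`]-oo, 0[%classic.
  apply/funext => x; rewrite /= !indicE !mem_setE !in_itv/= andbT.
  have [x0|x0|->] := ltrgtP x 0; last by rewrite sgr0 subrr.
    by rewrite ltr0_sg//= sub0r.
  by rewrite gtr0_sg//= subr0.
by apply: measurable_funB; apply: measurable_indic; exact: measurable_itv.
Qed.

(** The multiplier shows that the defining condition of [hilbert] can be met, so the chosen value
    meets it; the property is then moved from the chosen transform of [h] to an arbitrary pair. *)
Lemma hilbertP (c : R2 -> R) u h : (forall f, c f = frq u f) -> isL2 mu2 h ->
  isL2 mu2 (hilbert c h) /\ forall p r, isF h p r ->
  isF (hilbert c h) (fun f => - (Num.sg (c f) * r f)) (fun f => Num.sg (c f) * p f).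
Proof.
move=> cE lh; have ec : c = frq u by apply/funext.
have [F Fi Fk] := fourier_isF lh.
(* In the notation p - j r this is a = p, b = - r, whence the new pair - s r, s p. *)
have mulE (s a b : R) : - qj R * qreal s * Quat a 0 b 0 = Quat (s * b) 0 (- (s * a)) 0.
  by congr Quat => /=; ring.
have quatE (q : quat R) : q = Quat (q_re q) (q_i q) (q_j q) (q_k q) by case: q.
have ms : measurable_fun setT (fun f => Num.sg (c f)).
  by rewrite ec; exact: measurableT_comp measurable_sg (measurable_frq u).
have [v Hv] := hilbert_mult_exists u lh.
have Fv := Hv _ _ F; have lv : isL2 mu2 v by have [] := Fv.
have [F' Fi' Fk'] := fourier_isF lv; have [e1 e2] := isF_unique F' Fv.
have [w_L2 w_ae] : [set v : R2 -> R | v \in Lfun mu2 2%:E /\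
    {ae mu2, forall f : R2,
       fourier v f = - qj R * qreal (Num.sg (c f)) * fourier h f}] (hilbert c h).
  apply: xgetPex; exists v; split; first exact/LfunP2.
  have z1 := ae_imp2 Fi Fk (fun f a b => conj a b).
  have z2 := ae_imp2 Fi' Fk' (fun f a b => conj a b).
  have z3 := ae_imp2 e1 e2 (fun f a b => conj a b).
  apply: (ae_imp2 (ae_imp2 z1 z2 (fun f a b => conj a b)) z3) => f [[hi hk] [vi vk]] [h1 h2].
  rewrite (quatE (fourier v f)) (quatE (fourier h f)) hi hk vi vk mulE ec.
  congr Quat; first by rewrite h1 mulrN opprK.
  by rewrite -[LHS]opprK h2.
have {}w_L2 : isL2 mu2 (hilbert c h) by exact/LfunP2.
split => // p r F0; have [G Gi Gk] := fourier_isF w_L2.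
have F1 : isF (hilbert c h) (fun f => - (Num.sg (c f) * - q_j (fourier h f)))
    (fun f => Num.sg (c f) * q_re (fourier h f)).
  have [_ [mp _] [mr _] _] := F.
  have z1 := ae_imp2 Fi Fk (fun f a b => conj a b).
  apply: (isF_ae G w_L2.1).
  - by apply: measurableT_comp => //; exact: (measurable_funM ms mr).
  - exact: (measurable_funM ms mp).
  - by apply: (ae_imp (P := fun=> True)); first exact: nearW.
  - apply: (ae_imp2 w_ae z1) => f -> [hi hk].
    by rewrite {1}(quatE (fourier h f)) hi hk mulE /= mulrN opprK.
  - apply: (ae_imp2 w_ae z1) => f -> [hi hk].
    by rewrite {1}(quatE (fourier h f)) hi hk mulE /= opprK.
have [_ [mp _] [mr _] _] := F0.
apply: (isF_unique_ae F F0 _ _ _ F1).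
- by move=> f /= -> ->.
- by apply: measurableT_comp => //; exact: (measurable_funM ms mr).
- exact: (measurable_funM ms mp).
Qed.

Lemma hilbert1P h : isL2 mu2 h -> isL2 mu2 (hilbert1 h) /\ forall p r, isF h p r ->
  isF (hilbert1 h) (fun f => - (Num.sg f.1 * r f)) (fun f => Num.sg f.1 * p f).
Proof.
by move=> lh; apply: (@hilbertP (fun f => f.1) (1, 0)) => // f; rewrite /frq /= mulr1 mulr0 addr0.
Qed.

Lemma hilbert2P h : isL2 mu2 h -> isL2 mu2 (hilbert2 h) /\ forall p r, isF h p r ->
  isF (hilbert2 h) (fun f => - (Num.sg f.2 * r f)) (fun f => Num.sg f.2 * p f).
Proof.
by move=> lh; apply: (@hilbertP (fun f => f.2) (0, 1)) => // f; rewrite /frq /= mulr1 mulr0 add0r.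
Qed.

(** The same [w1] serves for a b and for a w2 = H2 (a b), as it does not depend on the second
    factor. The four functions are therefore a b, w1 b, a w2 and w1 w2, and both sides are the
    product of all four factors. *)
Lemma hilbert_tensor (a b : R -> R) : isL2 lambda a -> isL2 lambda b ->
  {ae mu2, forall x, tensor a b x * hilbert1 (hilbert2 (tensor a b)) x =
     hilbert1 (tensor a b) x * hilbert2 (tensor a b) x}.
Proof.
move=> la lb.
have [w1 lw1 H1] := tensor_mult_exists false la; have [w2 lw2 H2] := tensor_mult_exists true lb.
have lt := isL2_tensor la lb; have lt2 := isL2_tensor la lw2.
have [l1 G1] := hilbert1P lt; have [l2 G2] := hilbert2P lt.
have [l12 G12] := hilbert1P l2.
have [p [r F]] := isF_exists lt.
have refl (q : R2 -> R) : {ae mu2, forall f, q f = q f}.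
  by apply: (ae_imp (P := fun=> True)); first exact: nearW.
have f1E f : frq (1, 0) f = f.1 by rewrite /frq /= mulr1 mulr0 addr0.
have f2E f : frq (0, 1) f = f.2 by rewrite /frq /= mulr1 mulr0 add0r.
have A1 : {ae mu2, forall x, hilbert1 (tensor a b) x = tensor w1 b x}.
  apply: (isF_inj (G1 _ _ F) (H1 b _ _ lb F));
    by apply: (ae_imp (refl p)) => f _; rewrite f1E.
have K2 := H2 a _ _ la F.
have A2 : {ae mu2, forall x, hilbert2 (tensor a b) x = tensor a w2 x}.
  apply: (isF_inj (G2 _ _ F) K2); by apply: (ae_imp (refl p)) => f _; rewrite f2E.
have A12 : {ae mu2, forall x, hilbert1 (hilbert2 (tensor a b)) x = tensor w1 w2 x}.
  have K12 := H1 w2 _ _ lw2 K2.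
  apply: (isF_inj (G12 _ _ (G2 _ _ F)) K12);
    by apply: (ae_imp (refl p)) => f _; rewrite f1E f2E.
have A := ae_imp2 A1 A2 (fun x y z => conj y z).
apply: (ae_imp2 A A12) => x [-> ->] ->.
by rewrite /tensor; ring.
Qed.

End hilbert_existence.

(** * Polar forms and phase shifts *)

Section polar.
Variable R : realType.
Implicit Types (a b c d x y : R) (q : quat R).

Lemma angle_exists x y : x ^+ 2 + y ^+ 2 = 1 -> exists t, cos t = x /\ sin t = y.
Proof.
move=> xy; have x2 : x ^+ 2 <= 1 by have := sqr_ge0 y; lra.
have x1 : -1 <= x <= 1.
  by rewrite -ler_norml -(@ler_pXn2r _ 2) ?nnegrE// expr1n real_normK ?num_real.
have sa : sin (acos x) = Num.sqrt (1 - x ^+ 2) by apply: sin_acos; case/andP: x1 => *; apply/andP.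
have y2 : 1 - x ^+ 2 = y ^+ 2 by lra.
rewrite y2 sqrtr_sqr in sa.
have [y0|y0] := leP 0 y; [exists (acos x)|exists (- acos x)].
  by rewrite acosK ?in_itv//= sa ger0_norm.
by rewrite cosN sinN acosK ?in_itv//= sa ltr0_norm// opprK.
Qed.

(** The components are [N] times the products of the entries of (cos s, sin s) with those of (cos t,
    sin t), so a d = b c is necessary for this form. *)
Lemma qpolarE (N s t : R) :
  qreal N * qexpi s * qexpj t =
  Quat (N * (cos s * cos t)) (N * (sin s * cos t)) (N * (cos s * sin t)) (N * (sin s * sin t)).
Proof. by congr Quat => /=; ring. Qed.

(** The condition says that (a, c) and (b, d) are parallel. Their common direction is (cos t, sin
    t), and their signed lengths along it, [A] and [k] in the proof, are N cos s and N sin s. *)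
Lemma qpolar_exists a b c d : a * d = b * c -> exists st : R * R,
  Quat a b c d = qreal (qnorm (Quat a b c d)) * qexpi (2 * pi * st.1) * qexpj (2 * pi * st.2).
Proof.
move=> adbc; set N := qnorm _.
have N2 : N ^+ 2 = a ^+ 2 + b ^+ 2 + c ^+ 2 + d ^+ 2.
  by rewrite /N /qnorm sqr_sqrtr// !addr_ge0// sqr_ge0.
suff [s [t [ea eb ec ed]]] : exists s t, [/\ a = N * (cos s * cos t), b = N * (sin s * cos t),
    c = N * (cos s * sin t) & d = N * (sin s * sin t)].
  exists (s / (2 * pi), t / (2 * pi)) => /=.
  have p0 : 2 * pi != 0 :> R by rewrite mulf_neq0// gt_eqF// pi_gt0.
  by rewrite ![2 * pi * (_ / _)]mulrC !mulfVK// qpolarE; congr Quat.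
have [N0|N0] := eqVneq N 0.
  exists 0, 0; rewrite N0 !mul0r; move: N2; rewrite N0 expr0n /= => N2.
  have a0 := sqr_ge0 a; have b0 := sqr_ge0 b; have c0 := sqr_ge0 c; have d0 := sqr_ge0 d.
  by split; apply/eqP; rewrite -sqrf_eq0; apply/eqP; lra.
have [A A2] : exists A, A ^+ 2 = a ^+ 2 + c ^+ 2.
  by exists (Num.sqrt (a ^+ 2 + c ^+ 2)); rewrite sqr_sqrtr// addr_ge0 ?sqr_ge0.
(* If (a, c) vanishes, the direction is taken from (b, d), and s = pi / 2. *)
have [A0|A0] := eqVneq A 0.
  move: A2; rewrite A0 expr0n /= => A2.
  have a0 := sqr_ge0 a; have c0 := sqr_ge0 c.
  have ae : a = 0 by apply/eqP; rewrite -sqrf_eq0; apply/eqP; lra.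
  have ce : c = 0 by apply/eqP; rewrite -sqrf_eq0; apply/eqP; lra.
  have N2' : b ^+ 2 + d ^+ 2 = N ^+ 2 by rewrite N2 ae ce expr0n /= add0r addr0.
  have [|t [ct st]] := @angle_exists (b / N) (d / N).
    by rewrite !exprMn -mulrDl exprVn N2' divff// expf_neq0.
  exists (pi / 2), t; rewrite cos_pihalf sin_pihalf ct st !mul0r !mulr0 !mul1r.
  by rewrite ae ce; split => //; rewrite mulrC mulfVK.
have [|t [ct st]] := @angle_exists (a / A) (c / A).
  by rewrite !exprMn -mulrDl exprVn A2 divff// -A2 expf_neq0.
have [k kE] : exists k, k = (a * b + c * d) / A by exists ((a * b + c * d) / A).
have k2 : A ^+ 2 + k ^+ 2 = N ^+ 2.
  have e : (a * b + c * d) ^+ 2 = A ^+ 2 * (b ^+ 2 + d ^+ 2).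
    have -> : (a * b + c * d) ^+ 2 = (a ^+ 2 + c ^+ 2) * (b ^+ 2 + d ^+ 2) - (a * d - b * c) ^+ 2 by ring.
    by rewrite adbc subrr expr0n subr0 A2.
  by rewrite kE exprMn e exprVn mulrAC divff ?expf_neq0// mul1r N2 A2; ring.
have kb : A * b = k * a.
  apply: (mulfI A0); rewrite kE; have -> : A * ((a * b + c * d) / A * a) = (a * b + c * d) * a by field.
  have -> : (a * b + c * d) * a = a ^+ 2 * b + c * (a * d) by ring.
  by rewrite adbc (mulrA A A b) -(expr2 A) A2; ring.
have kd : A * d = k * c.
  apply: (mulfI A0); rewrite kE; have -> : A * ((a * b + c * d) / A * c) = (a * b + c * d) * c by field.
  have -> : (a * b + c * d) * c = c ^+ 2 * d + a * (b * c) by ring.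
  by rewrite -adbc (mulrA A A d) -(expr2 A) A2; ring.
have [|s [cs ss]] := @angle_exists (A / N) (k / N).
  by rewrite !exprMn -mulrDl exprVn k2 divff// expf_neq0.
exists s, t; rewrite cs ss ct st.
split.
- by field; rewrite A0 N0.
- by apply: (mulfI A0); rewrite kb; field; rewrite A0 N0.
- by field; rewrite A0 N0.
- by apply: (mulfI A0); rewrite kd; field; rewrite A0 N0.
Qed.

(** Only the products of cosines and sines enter after expansion, and these are fixed by the
    quaternion, whichever phases were chosen. *)
Lemma polar_phases_shift a b c d (s1 s2 : R) : a * d = b * c ->
  let st := polar_phases (Quat a b c d) in
  qnorm (Quat a b c d) * cos (2 * pi * st.1 - s1) * cos (2 * pi * st.2 - s2) =
  cos s1 * cos s2 * a + sin s1 * cos s2 * b + cos s1 * sin s2 * c + sin s1 * sin s2 * d.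
Proof.
move=> adbc st.
have : Quat a b c d = qreal (qnorm (Quat a b c d)) * qexpi (2 * pi * st.1) * qexpj (2 * pi * st.2).
  exact: (@xgetPex _ (0, 0) [set ab : R * R | Quat a b c d = qreal (qnorm (Quat a b c d))
    * qexpi (2 * pi * ab.1) * qexpj (2 * pi * ab.2)] (qpolar_exists adbc)).
rewrite qpolarE; move: (qnorm _) => N; move: (2 * pi * st.1) (2 * pi * st.2) => s t [-> -> -> ->].
by rewrite !cosB; ring.
Qed.

(** Gives the phase shift an explicit formula on the exceptional null set as well, for the sake of
    its measurability. *)
Lemma polar_phases_default a b c d : a * d <> b * c -> polar_phases (Quat a b c d) = (0, 0).
Proof.
move=> adbc; rewrite /polar_phases xgetPN// => st /=; rewrite qpolarE.
move: (qnorm _) => N; move: (2 * pi * st.1) (2 * pi * st.2) => s t [ea eb ec ed].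
by apply: adbc; rewrite ea eb ec ed; ring.
Qed.

End polar.

(** * Wavelet transforms in the rotated frame *)

Section pairings.
Variable R : realType.
Local Notation lambda := (@lebesgue_measure R).
Local Notation mu2 := (leb2 R).
Local Notation R2 := (R * R)%type.
Implicit Types (h p r : R2 -> R) (f x y : R2).

Lemma ae_eq_Rintegral (F F' : R2 -> R) : measurable_fun setT F -> measurable_fun setT F' ->
  {ae mu2, forall x, F x = F' x} -> \int[mu2]_x F x = \int[mu2]_x F' x.
Proof.
move=> mF mF' e; congr fine.
apply: (@ae_eq_integral _ _ R mu2 setT (EFin \o F') (EFin \o F) measurableT).
- exact/measurable_EFinP.
- exact/measurable_EFinP.
- by apply: (ae_imp e) => x /= ->.
Qed.

(** The coordinate axes are null sets. Hence a sign carried by both sides of a pairing cancels. *)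
Lemma sg_sqr_ae : {ae mu2, forall f, (Num.sg f.1) ^+ 2 = 1 /\ (Num.sg f.2) ^+ 2 = 1}.
Proof.
have a1 : {ae mu2, forall f, f.1 != 0}.
  exists ([set 0] `*` setT); split.
  - by apply: measurableX.
  - have e : lambda [set 0] = 0%E by exact: lebesgue_measure_set1.
    by rewrite product_measure1E//= e mul0e.
  - by move=> [x y] /= /negP; rewrite negbK => /eqP ->.
have a2 : {ae mu2, forall f, f.2 != 0} := jacobian_ae ltr01 (@swap_jacobian R) a1.
by apply: (ae_imp2 a1 a2) => f n1 n2; rewrite !sqr_sg n1 n2.
Qed.

(** Reduces each pairing to the same four integrals, so that only a pointwise identity between
    integrands has to be checked. *)
Lemma parseval4 h p r h' p' r' (Z1 Z2 Z3 Z4 : R2 -> R) (e1 e2 e3 e4 : R) :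
  isF h p r -> isF h' p' r' ->
  mu2.-integrable setT (EFin \o Z1) -> mu2.-integrable setT (EFin \o Z2) ->
  mu2.-integrable setT (EFin \o Z3) -> mu2.-integrable setT (EFin \o Z4) ->
  {ae mu2, forall f, p f * p' f + r f * r' f = e1 * Z1 f + e2 * Z2 f + e3 * Z3 f + e4 * Z4 f} ->
  \int[mu2]_x (h x * h' x) = e1 * \int[mu2]_f Z1 f + e2 * \int[mu2]_f Z2 f
    + e3 * \int[mu2]_f Z3 f + e4 * \int[mu2]_f Z4 f.
Proof.
move=> F F' i1 i2 i3 i4 e; have [_ lp lr _] := F; have [_ lp' lr' _] := F'.
have ip := isL2_integrableM lp lp'; have ir := isL2_integrableM lr lr'.
have j (c : R) Z : mu2.-integrable setT (EFin \o Z) -> mu2.-integrable setT (EFin \o (fun f => c * Z f)).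
  by move=> iZ; exact: (integrableZl measurableT _ iZ).
have jD Z Z' : mu2.-integrable setT (EFin \o Z) -> mu2.-integrable setT (EFin \o Z') ->
    mu2.-integrable setT (EFin \o (fun f => Z f + Z' f)).
  by move=> iZ iZ'; exact: (integrableD measurableT iZ iZ').
have j12 := jD _ _ (j e1 _ i1) (j e2 _ i2); have j123 := jD _ _ j12 (j e3 _ i3).
have j1234 := jD _ _ j123 (j e4 _ i4).
rewrite (parseval F F') -(RintegralD measurableT ip ir).
rewrite -(RintegralZl _ measurableT i1) -(RintegralZl _ measurableT i2).
rewrite -(RintegralZl _ measurableT i3) -(RintegralZl _ measurableT i4).
rewrite -(RintegralD measurableT (j e1 _ i1) (j e2 _ i2)).
rewrite -(RintegralD measurableT j12 (j e3 _ i3)) -(RintegralD measurableT j123 (j e4 _ i4)).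
apply: ae_eq_Rintegral => //.
- by apply/measurable_EFinP; exact: (measurable_int _ (jD _ _ ip ir)).
- by apply/measurable_EFinP; exact: (measurable_int _ j1234).
Qed.

Lemma dil_mult (c : R2 -> R) (a : R) (b : R2) p r :
  (forall f, Num.sg (c (undil a f)) = Num.sg (c f)) ->
  dilre a b (fun f => - (Num.sg (c f) * r f)) (fun f => Num.sg (c f) * p f) =
    (fun f => - (Num.sg (c f) * dilim a b p r f)) /\
  dilim a b (fun f => - (Num.sg (c f) * r f)) (fun f => Num.sg (c f) * p f) =
    (fun f => Num.sg (c f) * dilre a b p r f).
Proof. by move=> cu; split; apply/funext => f; rewrite /dilre /dilim cu; ring. Qed.

Lemma isF_dil_mult (c : R2 -> R) (a : R) (b : R2) (a0 : 0 < a) v p r :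
  (forall f, Num.sg (c (undil a f)) = Num.sg (c f)) ->
  isF v (fun f => - (Num.sg (c f) * r f)) (fun f => Num.sg (c f) * p f) ->
  isF (v \o dil a b) (fun f => - (Num.sg (c f) * dilim a b p r f))
    (fun f => Num.sg (c f) * dilre a b p r f).
Proof.
by move=> cu F; have := isF_dil b a0 F; have [-> ->] := dil_mult b p r cu.
Qed.

Lemma sg_undil1 (a : R) f : 0 < a -> Num.sg (undil a f).1 = Num.sg f.1.
Proof. by move=> a0; rewrite /= addr0 sgrM gtr0_sg ?mul1r// invr_gt0. Qed.

Lemma sg_undil2 (a : R) f : 0 < a -> Num.sg (undil a f).2 = Num.sg f.2.
Proof. by move=> a0; rewrite /= addr0 sgrM gtr0_sg ?mul1r// invr_gt0. Qed.

End pairings.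

(** * Change of variables to the frame of the wavelet *)

Section frame.
Variable R : realType.
Local Notation mu2 := (leb2 R).
Local Notation R2 := (R * R)%type.
Implicit Types (h p r psi G : R2 -> R) (f x y : R2).

Lemma rotvK (t : R) x : rotv t (rotv (- t) x) = x.
Proof.
case: x => x y; rewrite /rotv /= cosN sinN; have e := cos2Dsin2 t.
by congr pair; [rewrite -[RHS]mul1r -e|rewrite -[RHS]mul1r -e]; ring.
Qed.

Lemma rotvNK (t : R) x : rotv (- t) (rotv t x) = x.
Proof. by rewrite -{2}(opprK t) rotvK. Qed.

Variables (a t : R) (b : R2).
Hypothesis a0 : 0 < a.
Let b' := rotv (- t) b.

Definition unframe x : R2 := rotv (- t) ((x.1 - b.1) / a, (x.2 - b.2) / a).

Lemma unframeK (c y : R2) : b = rotv t c -> unframe (rotv t (dil a c y)) = y.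
Proof.
move=> e; rewrite /unframe e -[RHS](rotvNK t); congr (rotv (- t) _).
case: c y {e} => [c d] [y z]; rewrite /rotv /=.
move: (cos t) (sin t) => u v; have an0 : a != 0 by rewrite gt_eqF.
by congr pair; field.
Qed.

Lemma isL2_unframe h : isL2 mu2 h -> isL2 mu2 (h \o unframe).
Proof.
move=> lh; have ai : 0 < a^-1 by rewrite invr_gt0.
have J := has_jacobian_comp (rot_jacobian (- t)) (plane_jacobian (- b.1 / a) (- b.2 / a) ai).
have -> : unframe = rotv (- t) \o (fun x => (a^-1 * x.1 + - b.1 / a, a^-1 * x.2 + - b.2 / a)).
  by apply/funext => x; rewrite /unframe /=; congr rotv; congr pair; ring.
by apply: (jacobian_isL2 _ J lh); rewrite mulr1 exprn_gt0.
Qed.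

(** Substitution of rotv t (dil a b' y) for x: the Jacobian a^2 meets the factor 1 / a of the
    atom. *)
Lemma pairing_frame u h : isL2 mu2 u -> isL2 mu2 h ->
  \int[mu2]_x (u (rotv (- t) x) * (a^-1 * h (unframe x))) =
  a * \int[mu2]_y (u (dil a b' y) * h y).
Proof.
move=> lu lh.
have lur : isL2 mu2 (u \o rotv (- t)) := jacobian_isL2 ltr01 (rot_jacobian (- t)) lu.
have iF := isL2_integrableM lur (isL2Z a^-1 (isL2_unframe lh)).
have J := has_jacobian_comp (rot_jacobian t) (plane_jacobian b'.1 b'.2 a0).
have c0 : 0 < a ^+ 2 * 1 by rewrite mulr1 exprn_gt0.
rewrite -(jacobian_Rintegral c0 J iF) mulr1 expr2 -mulrA; congr (_ * _).
rewrite -(RintegralZl _ measurableT (jacobian_integrable c0 J iF).1).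
apply: eq_Rintegral => y _.
have e : unframe (rotv t (dil a b' y)) = y by apply: unframeK; rewrite rotvK.
transitivity (a * (u (rotv (- t) (rotv t (dil a b' y))) * (a^-1 * h (unframe (rotv t (dil a b' y)))))); first by [].
by rewrite rotvNK e mulrCA (mulrA a) divff ?mul1r// gt_eqF.
Qed.
End frame.

(** * The components of the wavelet transform *)

Section wavelet_transforms.
Variable R : realType.
Local Notation mu2 := (leb2 R).
Local Notation R2 := (R * R)%type.
Implicit Types (h p r psi G : R2 -> R) (f x y : R2).

Lemma hypercomplexifyE psi x : hypercomplexify psi x =
  Quat (psi x) (hilbert1 psi x) (hilbert2 psi x) (- hilbert2 (hilbert1 psi) x).
Proof. by congr Quat => /=; ring. Qed.

Lemma wavelet_transformE (a t : R) (b : R2) h psi :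
  let I k := \int[mu2]_x (h x * (a^-1 * k (unframe a t b x))) in
  wavelet_transform (hypercomplexify psi) a t b h =
  Quat (I psi) (I (fun y => - hilbert1 psi y)) (I (fun y => - hilbert2 psi y))
    (I (hilbert2 (hilbert1 psi))).
Proof.
rewrite /wavelet_transform /qintegral; congr Quat;
  apply: eq_Rintegral => x _; rewrite /atom -/(unframe a t b x) hypercomplexifyE /=.
- by rewrite !(mul0r, mulr0, subr0, addr0, add0r, oppr0, opprK).
- by rewrite !(mul0r, mulr0, subr0, addr0, add0r, oppr0, opprK, mulrN).
- by rewrite !(mul0r, mulr0, subr0, addr0, add0r, oppr0, opprK, mulrN).
- by rewrite !(mul0r, mulr0, subr0, addr0, add0r, oppr0, opprK, mulrN).
Qed.

Lemma wavelet_transform_ae (a t : R) (b : R2) psi h h' : 0 < a -> isL2 mu2 psi ->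
  measurable_fun setT h -> measurable_fun setT h' -> {ae mu2, forall x, h x = h' x} ->
  wavelet_transform (hypercomplexify psi) a t b h = wavelet_transform (hypercomplexify psi) a t b h'.
Proof.
move=> a0 lpsi mh mh' e.
have [l1 _] := hilbert1P lpsi; have [l2 _] := hilbert2P lpsi; have [l21 _] := hilbert2P l1.
have E k : isL2 mu2 k -> \int[mu2]_x (h x * (a^-1 * k (unframe a t b x))) =
    \int[mu2]_x (h' x * (a^-1 * k (unframe a t b x))).
  move=> lk; have mk := (isL2Z a^-1 (isL2_unframe t b a0 lk)).1.
  apply: ae_eq_Rintegral; [exact: measurable_funM mh mk|exact: measurable_funM mh' mk|].
  by apply: (ae_imp e) => x /= ->.
by rewrite !wavelet_transformE (E _ lpsi) (E _ l21) (E _ (isL2N l1)) (E _ (isL2N l2)).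
Qed.

Lemma wavelet_transform_frame (a t : R) (b : R2) u psi : 0 < a ->
  isL2 mu2 u -> isL2 mu2 psi ->
  let I h := a * \int[mu2]_y (u (dil a (rotv (- t) b) y) * h y) in
  wavelet_transform (hypercomplexify psi) a t b (u \o rotv (- t)) =
  Quat (I psi) (- I (hilbert1 psi)) (- I (hilbert2 psi)) (I (hilbert2 (hilbert1 psi))).
Proof.
move=> a0 lu lpsi I.
have [l1 _] := hilbert1P lpsi; have [l2 _] := hilbert2P lpsi; have [l21 _] := hilbert2P l1.
have IE h : isL2 mu2 h -> I h = \int[mu2]_x (u (rotv (- t) x) * (a^-1 * h (unframe a t b x))).
  by move=> lh; rewrite (pairing_frame t b a0 lu lh).
have IN h : isL2 mu2 h -> - I h = \int[mu2]_x (u (rotv (- t) x) * (a^-1 * - h (unframe a t b x))).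
  move=> lh; rewrite (IE _ lh) (pairing_frame t b a0 lu lh).
  rewrite (pairing_frame t b a0 lu (isL2N lh)) -mulrN; congr (_ * _).
  rewrite -mulN1r -RintegralZl//; first by apply: eq_Rintegral => x _ /=; ring.
  apply: (isL2_integrableM _ lh).
  exact (jacobian_isL2 (exprn_gt0 2 a0) (plane_jacobian _ _ a0) lu).
rewrite wavelet_transformE; congr Quat;
  [rewrite (IE _ lpsi)|rewrite (IN _ l1)|rewrite (IN _ l2)|rewrite (IE _ l21)]; exact: erefl.
Qed.

(* With [p - j r] and [q - j w] the transforms of the dilated [G] and of [psi],
   and [s1], [s2] the signs of the frequencies, the [z]'s are the integrals of
   [A], [s1 B], [s2 B] and [s1 s2 A], where [A = p q + r w] and [B = p w - r q]. *)
Lemma wavelet_transform_norm (a t : R) (b : R2) G psi : 0 < a -> isL2 mu2 G -> isL2 mu2 psi ->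
  exists z1 z2 z3 z4 : R, forall k0 k1 k2 k3 : R,
  let u := fun y => k0 * G y + k1 * hilbert1 G y + (k2 * hilbert2 G y + k3 * hilbert1 (hilbert2 G) y) in
  isL2 mu2 u /\
  qnorm (wavelet_transform (hypercomplexify psi) a t b (u \o rotv (- t))) ^+ 2 =
  a ^+ 2 * ((k0 * z1 + k1 * z2 + k2 * z3 - k3 * z4) ^+ 2
    + (- k0 * z2 + k1 * z1 + k2 * z4 + k3 * z3) ^+ 2
    + (- k0 * z3 + k1 * z4 + k2 * z1 + k3 * z2) ^+ 2
    + (- k0 * z4 - k1 * z3 - k2 * z2 + k3 * z1) ^+ 2).
Proof.
move=> a0 lG lpsi; set b' := rotv (- t) b.
have [l1 H1] := hilbert1P lG; have [l2 H2] := hilbert2P lG; have [l12 H12] := hilbert1P l2.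
have [m1 K1] := hilbert1P lpsi; have [m2 K2] := hilbert2P lpsi; have [m21 K21] := hilbert2P m1.
have [p0 [r0 F0]] := isF_exists lG; have [q [w P0]] := isF_exists lpsi.
have u1 f := sg_undil1 f a0; have u2 f := sg_undil2 f a0.
set p := dilre a b' p0 r0; set r := dilim a b' p0 r0.
have F := isF_dil b' a0 F0; rewrite -/p -/r in F.
have F1 := isF_dil_mult b' a0 u1 (H1 _ _ F0); rewrite -/p -/r in F1.
have F2 := isF_dil_mult b' a0 u2 (H2 _ _ F0); rewrite -/p -/r in F2.
have F12 := isF_dil_mult b' a0 u1 (H12 _ _ (H2 _ _ F0)).
have P1 := K1 _ _ P0; have P2 := K2 _ _ P0; have P21 := K21 _ _ P1.
have [e1 e2] := dil_mult b' p0 r0 u2; rewrite e1 e2 -/p -/r in F12.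
have [_ lp lr _] := F; have [_ lq lw _] := P0; have [_ lw1 lq1 _] := P1.
have [_ lw2 lq2 _] := P2; have [_ lq21 lw21 _] := P21.
pose Z1 f := p f * q f + r f * w f.
pose Z2 f := Num.sg f.1 * (p f * w f - r f * q f).
pose Z3 f := Num.sg f.2 * (p f * w f - r f * q f).
pose Z4 f := Num.sg f.1 * Num.sg f.2 * (p f * q f + r f * w f).
have iZ (g1 g2 h1 h2 Z : R2 -> R) (c : R) : isL2 mu2 g1 -> isL2 mu2 h1 -> isL2 mu2 g2 -> isL2 mu2 h2 ->
    (forall f, Z f = c * (g1 f * h1 f + g2 f * h2 f)) -> mu2.-integrable setT (EFin \o Z).
  move=> a1 a2 a3 a4 e; have -> : Z = (fun f => c * (g1 f * h1 f + g2 f * h2 f)) by apply/funext.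
  have i := integrableD measurableT (isL2_integrableM a1 a2) (isL2_integrableM a3 a4).
  exact: (integrableZl measurableT c i).
have i1 : mu2.-integrable setT (EFin \o Z1).
  by apply: (iZ _ _ _ _ Z1 1 lp lq lr lw) => f; rewrite /Z1; ring.
(* The signs are absorbed into the transforms of the Hilbert transforms of [psi], which makes [Z2],
   [Z3] and [Z4] sums of products of L^2 functions. *)
have i2 : mu2.-integrable setT (EFin \o Z2).
  by apply: (iZ _ _ _ _ Z2 (-1) lp lw1 lr lq1) => f; rewrite /Z2; ring.
have i3 : mu2.-integrable setT (EFin \o Z3).
  by apply: (iZ _ _ _ _ Z3 (-1) lp lw2 lr lq2) => f; rewrite /Z3; ring.
have i4 : mu2.-integrable setT (EFin \o Z4).
  by apply: (iZ _ _ _ _ Z4 (-1) lp lq21 lr lw21) => f; rewrite /Z4; ring.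
exists (\int[mu2]_f Z1 f), (\int[mu2]_f Z2 f), (\int[mu2]_f Z3 f), (\int[mu2]_f Z4 f).
move=> k0 k1 k2 k3 u.
have lu : isL2 mu2 u.
  exact (isL2D (isL2D (isL2Z k0 lG) (isL2Z k1 l1)) (isL2D (isL2Z k2 l2) (isL2Z k3 l12))).
split; first exact: lu.
have FU := isF_comb 1 1 (isF_comb k0 k1 F F1) (isF_comb k2 k3 F2 F12).
have uE y : u (dil a b' y) = 1 * (k0 * G (dil a b' y) + k1 * hilbert1 G (dil a b' y))
  + 1 * (k2 * hilbert2 G (dil a b' y) + k3 * hilbert1 (hilbert2 G) (dil a b' y)) by rewrite !mul1r.
have I (c1 c2 c3 c4 : R) h q' w' : isF h q' w' ->
  (forall f, (Num.sg f.1) ^+ 2 = 1 -> (Num.sg f.2) ^+ 2 = 1 ->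
     (1 * (k0 * p f + k1 * - (Num.sg f.1 * r f)) + 1 * (k2 * - (Num.sg f.2 * r f)
       + k3 * - (Num.sg f.1 * (Num.sg f.2 * p f)))) * q' f +
     (1 * (k0 * r f + k1 * (Num.sg f.1 * p f)) + 1 * (k2 * (Num.sg f.2 * p f)
       + k3 * (Num.sg f.1 * - (Num.sg f.2 * r f)))) * w' f =
     c1 * Z1 f + c2 * Z2 f + c3 * Z3 f + c4 * Z4 f) ->
  \int[mu2]_y (u (dil a b' y) * h y) = c1 * \int[mu2]_f Z1 f + c2 * \int[mu2]_f Z2 f
    + c3 * \int[mu2]_f Z3 f + c4 * \int[mu2]_f Z4 f.
  move=> Fh e; rewrite -(parseval4 (e1 := c1) FU Fh i1 i2 i3 i4).
    by apply: eq_Rintegral => y _; rewrite uE.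
  by apply: (ae_imp (@sg_sqr_ae R)) => f [s1 s2]; exact: e.
have pm (x : R) : x ^+ 2 = 1 -> x = 1 \/ x = -1.
  by move=> /eqP; rewrite sqrf_eq1 => /orP[] /eqP; [left|right].
(* The coefficients come from multiplying out the signs: in the pairing with H1 psi, for instance,
   the term of H1 G loses its sign and gives [Z1], while that of G gives - [Z2]. The identities are
   verified at the four values of the pair of signs. *)
have I0 := I k0 k1 k2 (- k3) _ _ _ P0.
have I1 := I k1 (- k0) k3 k2 _ _ _ P1.
have I2 := I k2 k3 (- k0) k1 _ _ _ P2.
have I3 := I k3 (- k2) (- k1) (- k0) _ _ _ P21.
rewrite (wavelet_transform_frame t b a0 lu lpsi) -/b'.
rewrite I0; last first.
  by move=> f /pm s1 /pm s2; rewrite /Z1 /Z2 /Z3 /Z4; case: s1 => ->; case: s2 => ->; ring.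
rewrite I1; last first.
  by move=> f /pm s1 /pm s2; rewrite /Z1 /Z2 /Z3 /Z4; case: s1 => ->; case: s2 => ->; ring.
rewrite I2; last first.
  by move=> f /pm s1 /pm s2; rewrite /Z1 /Z2 /Z3 /Z4; case: s1 => ->; case: s2 => ->; ring.
rewrite I3; last first.
  by move=> f /pm s1 /pm s2; rewrite /Z1 /Z2 /Z3 /Z4; case: s1 => ->; case: s2 => ->; ring.
move: (\int[mu2]_f Z1 f) (\int[mu2]_f Z2 f) (\int[mu2]_f Z3 f) (\int[mu2]_f Z4 f) => z1 z2 z3 z4.
rewrite /qnorm sqr_sqrtr/=; first by ring.
by rewrite !addr_ge0 ?sqr_ge0.
Qed.
End wavelet_transforms.

(** * The phase shift as a linear combination *)

Section phase_shift.
Variable R : realType.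
Local Notation mu2 := (leb2 R).
Local Notation R2 := (R * R)%type.
Implicit Types (x y : R2).

Lemma hypercomplex_signalE (t : R) (T : R2 -> R) x : let z := rotv (- t) x in
  hypercomplex_signal t T x =
  Quat (T z) (hilbert1 T z) (hilbert2 T z) (hilbert1 (hilbert2 T) z).
Proof.
congr Quat; rewrite /= /rotf; by rewrite !(mul0r, mul1r, mulr0, subr0, addr0, add0r, oppr0, opprK).
Qed.

Lemma measurable_qnorm (k0 k1 k2 k3 : R2 -> R) : measurable_fun setT k0 -> measurable_fun setT k1 ->
  measurable_fun setT k2 -> measurable_fun setT k3 ->
  measurable_fun setT (fun y => qnorm (Quat (k0 y) (k1 y) (k2 y) (k3 y))).
Proof.
move=> m0 m1 m2 m3; apply: measurableT_comp.
  by apply: continuous_measurable_fun; exact: sqrt_continuous.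
by apply: measurable_funD; [apply: measurable_funD; [apply: measurable_funD|]|];
  apply: measurable_funX.
Qed.

Lemma phase_shift_tensor (ts : R * R) (t : R) (a b : R -> R) :
  isL2 (@lebesgue_measure R) a -> isL2 (@lebesgue_measure R) b ->
  let T := tensor a b in
  let h := phase_shift ts t (T \o rotv (- t)) in
  let u := fun y => cos ts.1 * cos ts.2 * T y + sin ts.1 * cos ts.2 * hilbert1 T y +
    (cos ts.1 * sin ts.2 * hilbert2 T y + sin ts.1 * sin ts.2 * hilbert1 (hilbert2 T) y) in
  measurable_fun setT h /\ {ae mu2, forall x, h x = u (rotv (- t) x)}.
Proof.
move=> la lb T h u.
have lT : isL2 mu2 T := isL2_tensor la lb.
have [l1 _] := hilbert1P lT; have [l2 _] := hilbert2P lT; have [l12 _] := hilbert1P l2.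
have TE : (fun y => (T \o rotv (- t)) (rotv t y)) = T by apply/funext => y /=; rewrite rotvNK.
pose Q y := Quat (T y) (hilbert1 T y) (hilbert2 T y) (hilbert1 (hilbert2 T) y).
(* The second branch has the default phases 0. It is met only on a null set, but [v] must describe
   the phase shift at every point for measurability to follow. *)
pose v y := if T y * hilbert1 (hilbert2 T) y == hilbert1 T y * hilbert2 T y then u y
  else qnorm (Q y) * cos (2 * pi * 0 - ts.1) * cos (2 * pi * 0 - ts.2).
have hE : h = v \o rotv (- t).
  apply/funext => x; rewrite /h /phase_shift TE hypercomplex_signalE /= /v.
  case: eqP => e; first by rewrite polar_phases_shift// /u addrA.
  by rewrite polar_phases_default.
have mu_ : measurable_fun setT u.
  exact (isL2D (isL2D (isL2Z _ lT) (isL2Z _ l1)) (isL2D (isL2Z _ l2) (isL2Z _ l12))).1.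
split.
  rewrite hE; apply: measurableT_comp (rot_jacobian (- t)).1; apply: measurable_fun_ifT.
  - by apply: measurable_fun_eqr; [exact: measurable_funM lT.1 l12.1|exact: measurable_funM l1.1 l2.1].
  - exact: mu_.
  - apply: measurable_funM => //; apply: measurable_funM => //.
    exact: measurable_qnorm lT.1 l1.1 l2.1 l12.1.
have := jacobian_ae ltr01 (rot_jacobian (- t)) (hilbert_tensor la lb).
by move/ae_imp; apply => x /eqP e; rewrite hE /v /= e.
Qed.
End phase_shift.

(** * Invariance of the squared modulus *)

Theorem corollary1 (R : realType) (theta : R) (g1 g2 : R -> R)
    (g : R * R -> R) (Psi : R * R -> quat R) (ts : R * R)
    (htheta : 0 <= theta < 2 * pi)
    (hg1 : g1 \in Lfun (@lebesgue_measure R) 2%:E)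
    (hg2 : g2 \in Lfun (@lebesgue_measure R) 2%:E)
    (hg : g = fun x => g1 (rotv (- theta) x).1 * g2 (rotv (- theta) x).2)
    (hPsi : hypercomplexing_wavelet Psi)
    (a : R) (b : R * R) (ha : 0 < a) :
  qnorm (wavelet_transform Psi a theta b (phase_shift ts theta g)) ^+ 2
  = qnorm (wavelet_transform Psi a theta b g) ^+ 2.
Proof.
move/LfunP2: hg1 => l1; move/LfunP2: hg2 => l2.
case: hPsi => psi [/LfunP2 lpsi _ _ _] ->.
have lT := isL2_tensor l1 l2; set T := tensor g1 g2 in lT *.
have gE : g = T \o rotv (- theta) by [].
have [z1 [z2 [z3 [z4 N]]]] := wavelet_transform_norm theta b ha lT lpsi.
have [lu nu] := N (cos ts.1 * cos ts.2) (sin ts.1 * cos ts.2) (cos ts.1 * sin ts.2) (sin ts.1 * sin ts.2).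
have [_ ng] := N 1 0 0 0.
have [mh hu] := phase_shift_tensor ts theta l1 l2; rewrite -/T -gE in mh hu.
have mur := measurableT_comp lu.1 (rot_jacobian (- theta)).1.
rewrite (wavelet_transform_ae theta b ha lpsi mh mur hu) nu.
have -> : g = (fun y => 1 * T y + 0 * hilbert1 T y + (0 * hilbert2 T y + 0 * hilbert1 (hilbert2 T) y))
    \o rotv (- theta).
  by rewrite gE; apply/funext => x /=; rewrite !mul0r !addr0 mul1r.
rewrite ng; congr (_ * _).
have e1 : sin ts.1 ^+ 2 = 1 - cos ts.1 ^+ 2 by exact: sin2cos2.
have e2 : sin ts.2 ^+ 2 = 1 - cos ts.2 ^+ 2 by exact: sin2cos2.
move: (cos ts.1) (sin ts.1) (cos ts.2) (sin ts.2) e1 e2 => c1 s1 c2 s2 e1 e2.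
(* The cross term disappears as (s1 c2)(c1 s2) = (c1 c2)(s1 s2), and the sum of the squared
   coefficients factors; this much holds before the relations between sines and cosines are used. *)
transitivity ((c1 ^+ 2 + s1 ^+ 2) * (c2 ^+ 2 + s2 ^+ 2) * (z1 ^+ 2 + z2 ^+ 2 + z3 ^+ 2 + z4 ^+ 2)).
  by ring.
by rewrite e1 e2; ring.
Qed.
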